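(* Let $E$ be a finite graph without sinks or sources in which every cycle has an exit, let $k\ge1$, let $\tau,\tau'\in\mathrm{Perm}(E^k)$ be endpoint-fixing, and assume that the permutation graphs $(E_\tau,\mathcal{L}_\tau)$ and $(E_{\tau'},\mathcal{L}_{\tau'})$ are both synchronizing in the first label. The following are equivalent: (1) $\tau$ and $\tau'$ are shift space equivalent, i.e. $\mathsf{X}_{(E_\tau,\mathcal{L}_\tau)}=\mathsf{X}_{(E_{\tau'},\mathcal{L}_{\tau'})}$. (2) There exists an endpoint-fixing $\pi\in\mathrm{Perm}(E^{k-1})$ such that $\tau'=g_\pi(\tau)$. (3) There exists an endpoint-fixing $\pi\in\mathrm{Perm}(E^{k-1})$ such that $\mathrm{Ad}(U_\pi)\circ\lambda_\tau=\lambda_{\tau'}$. (4) The shift space maps coded by the textile systems are equal: $\phi_{T_\tau}=\phi_{T_{\tau'}}$. (5) The two-sided shift space maps induced by $\lambda_\tau$ and $\lambda_{\tau'}$ are equal: $\phi_\tau=\phi_{\tau'}$.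
   Context: A graph means a directed multigraph $E=(E^0,E^1,r,s)$. $E^l$ is the set of paths of length $l$ (length-0 paths are vertices), $E^l_{u\to v}$ those with source $u$ and range $v$. A cycle $\mu$ has an exit if some $s(\mu_i)$ emits at least two edges. $\mathsf{X}_E$ (resp. $\mathsf{X}_E^+$) is the set of bi-infinite paths (resp. infinite paths $x_1x_2\cdots$) in $E$. $C^*(E)$ is the universal $C^*$-algebra generated by mutually orthogonal projections $\{P_v\}_{v\in E^0}$ and partial isometries $\{S_e\}_{e\in E^1}$ with $S_e^*S_e=P_{r(e)}$, $S_e^*S_f=0$ for $e\ne f$, $S_eS_e^*\le P_{s(e)}$, and $P_v=\sum_{s(e)=v}S_eS_e^*$ for $v$ emitting a nonzero finite number of edges. $S_\mu=S_{\mu_1}\cdots S_{\mu_l}$ for a path $\mu$, $S_v=P_v$ for a vertex, $P_\mu=S_\mu S_\mu^*$. $\mathcal{D}_E$ is the $C^*$-subalgebra generated by all $P_\mu$. A permutation $\tau$ of $E^l$ is endpoint-fixing if $\tau(E^l_{u\to v})=E^l_{u\to v}$ for all $u,v$; then $U_\tau=\sum_{\alpha\in E^l}S_{\tau(\alpha)}S_\alpha^*$ is unitary, and $\lambda_\tau$ is the unital $*$-endomorphism with $\lambda_\tau(S_e)=U_\tau S_e$. $\mathrm{Ad}(U)(x)=UxU^*$. For endpoint-fixing $\tau\in\mathrm{Perm}(E^k)$, the permutation graph $(E_\tau,\mathcal{L}_\tau)$ has vertex set $E^{k-1}$, edge set $E^k$, and each $\mu=e\alpha\in E^k$ ($e\in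 E^1$, $\alpha\in E^{k-1}$) with $\tau(e\alpha)=\beta f$ ($\beta\in E^{k-1}$, $f\in E^1$) is an edge from $\beta$ to $\alpha$ with first label $\mathcal{L}_1(\mu)=e$, second label $\mathcal{L}_2(\mu)=f$, and $\mathcal{L}_\tau(\mu)=[e,f]$. It is synchronizing in the first label if there is $m$ such that any two paths in $E_\tau$ of length $m$ with equal $\mathcal{L}_1$-labels have equal source. $\mathsf{X}_{(E_\tau,\mathcal{L}_\tau)}$ is the set of $\mathcal{L}_\tau$-labels of bi-infinite paths in $E_\tau$. For endpoint-fixing $\tau\in\mathrm{Perm}(E^k)$ and $\pi\in\mathrm{Perm}(E^{k-1})$, $g_\pi(\tau)\colon E^k\to E^k$ is defined by $g_\pi(\tau)(e\,\pi(\alpha))=\pi(\beta)f$ whenever $\tau(e\alpha)=\beta f$; it is an endpoint-fixing permutation of $E^k$. Let $\phi_1,\phi_2\colon\mathsf{X}_{E_\tau}\to\mathsf{X}_E$ apply $\mathcal{L}_1$, resp. $\mathcal{L}_2$, to each edge. If $(E_\tau,\mathcal{L}_\tau)$ is synchronizing in the first label, then $\phi_1$ is bijective, and $\phi_{T_\tau}=\phi_2\circ\phi_1^{-1}\colon\mathsf{X}_E\to\mathsf{X}_E$ is the map coded by the textile system $T_\tau$ associated with the permutation graph. The Gelfand spectrum of $\mathcal{D}_E$ is identified with $\mathsf{X}_E^+$ by letting $z$ correspond to the character $\phi_z$ with $\phi_z(P_\mu)=1$ if $\mu$ is a prefix of $z$ and $0$ otherwise. If $(E_\tau,\mathcal{L}_\tau)$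 is synchronizing in the first label, $\lambda_\tau$ restricts to an automorphism of $\mathcal{D}_E$, and the induced map $\phi_\tau^+\colon\mathsf{X}_E^+\to\mathsf{X}_E^+$ is given by $\phi_{\phi_\tau^+(x)}=\phi_x\circ(\lambda_\tau|_{\mathcal{D}_E})^{-1}$. The induced two-sided map $\phi_\tau\colon\mathsf{X}_E\to\mathsf{X}_E$ is given by $\phi_\tau(x)_m=\lim_{n\to\infty}\phi_\tau^+(x_{-n}x_{-n+1}x_{-n+2}\cdots)_{m+n+1}$ (the sequence is eventually constant; one-sided sequences are indexed from 1). *)

(* Defs.v *)
From HB Require Import structures.
From mathcomp Require Import all_boot all_order all_fingroup all_algebra.
From mathcomp Require Import complex.
From mathcomp Require Import boolp classical_sets reals topology normedtype.

Set Implicit Arguments.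
Unset Strict Implicit.
Unset Printing Implicit Defensive.

Import Order.TTheory GRing.Theory Num.Theory.
Import numFieldNormedType.Exports.

Local Open Scope classical_set_scope.
Local Open Scope ring_scope.

Record graph := Graph {
  vertex : finType;
  edge : finType;
  src : edge -> vertex;
  rng : edge -> vertex }.

Fixpoint walk (G : graph) (v : vertex G) (s : seq (edge G)) : bool :=
  if s is e :: s' then (src e == v) && walk (rng e) s' else true.

(* The source vertex is stored along with the edges so that paths of length 0
   are exactly the vertices; for positive length it is redundant. *)
Record gpath (G : graph) (l : nat) := GPath {
  gpath_val : vertex G * l.-tuple (edge G);
  _ : walk gpath_val.1 gpath_val.2 }.

HB.instance Definition _ (G : graph) (l : nat) :=
  [isSub for @gpath_val G l].
HB.instance Definition _ (G : graph) (l : nat) :=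
  [Countable of gpath G l by <:].
HB.instance Definition _ (G : graph) (l : nat) := [Finite of gpath G l by <:].

Section Paths.
Variable G : graph.

Definition psrc l (p : gpath G l) : vertex G := (val p).1.
Definition pedges l (p : gpath G l) : l.-tuple (edge G) := (val p).2.
Definition prng l (p : gpath G l) : vertex G :=
  last (psrc p) (map (@rng G) (pedges p)).

Definition paths_between l (u v : vertex G) : {set gpath G l} :=
  [set p | (psrc p == u) && (prng p == v)]%SET.

Definition no_sinks := forall v : vertex G, exists e : edge G, src e = v.
Definition no_sources := forall v : vertex G, exists e : edge G, rng e = v.

Definition every_cycle_has_exit :=
  forall l (p : gpath G l.+1), psrc p = prng p ->
    exists2 e, e \in pedges p & (1 < #|[set f : edge G | src f == src e]%SET|)%N.

Definition phead l (p : gpath G l.+1) : edge G := thead (pedges p).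
Definition plast l (p : gpath G l.+1) : edge G :=
  last (phead p) (behead (pedges p)).

Lemma ptail_subproof l (p : gpath G l.+1) :
  walk (rng (phead p)) [tuple of behead (pedges p)].
Proof.
case: p => -[v t] /=; rewrite /phead /pedges /=.
by case/tupleP: t => e t /= /andP[_]; rewrite theadE.
Qed.

Definition ptail l (p : gpath G l.+1) : gpath G l :=
  @GPath G l (rng (phead p), [tuple of behead (pedges p)]) (ptail_subproof p).

Lemma walk_rcons v (s : seq (edge G)) e :
  walk v (rcons s e) = walk v s && (src e == last v (map (@rng G) s)).
Proof. by elim: s v => [|f s IHs] v /=; rewrite ?andbT // IHs andbA. Qed.

Lemma pfront_subproof l (p : gpath G l.+1) :
  walk (psrc p) [tuple of belast (phead p) (behead (pedges p))].
Proof.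
case: p => -[v t] /=; rewrite /phead /psrc /pedges /=.
case/tupleP: t => e t wt; rewrite theadE /=.
have: walk v (e :: t) by [].
by rewrite lastI walk_rcons => /andP[].
Qed.

Definition pfront l (p : gpath G l.+1) : gpath G l :=
  @GPath G l (psrc p, [tuple of belast (phead p) (behead (pedges p))])
    (pfront_subproof p).

Definition endpoint_fixing l (tau : {perm gpath G l}) :=
  forall u v, [set tau p | p in paths_between l u v]%SET = paths_between l u v.

(* [g_pi tau (e (pi alpha)) = (pi beta) f] whenever [tau (e alpha) = beta f].
   The default value of [insubd] is never used when [pi] and [tau] are
   endpoint-fixing. *)
Definition gmap k (pi : {perm gpath G k}) (tau : {perm gpath G k.+1})
    (m : gpath G k.+1) : gpath G k.+1 :=
  let ealpha : gpath G k.+1 :=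
    insubd m (psrc m, [tuple of phead m :: pedges (pi^-1%g (ptail m))]) in
  let beta := pfront (tau ealpha) in
  let f := plast (tau ealpha) in
  insubd m (psrc (pi beta), [tuple of rcons (pedges (pi beta)) f]).

Definition bi_infinite_paths : set (int -> edge G) :=
  [set x | forall i : int, rng (x i) = src (x (i + 1))].

(* One-sided sequences are indexed from 0: [x i] is the coordinate [x_(i+1)] of
   [x_1 x_2 ...]. *)
Definition infinite_paths : set (nat -> edge G) :=
  [set x | forall i : nat, rng (x i) = src (x i.+1)].

Definition is_prefix l (p : gpath G l) (z : nat -> edge G) : Prop :=
  psrc p = src (z 0%N) /\ tval (pedges p) = mkseq z l.

End Paths.

Arguments no_sinks : clear implicits.
Arguments no_sources : clear implicits.
Arguments every_cycle_has_exit : clear implicits.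
Arguments bi_infinite_paths : clear implicits.
Arguments infinite_paths : clear implicits.

Section PermutationGraph.
Variables (G : graph) (k : nat) (tau : {perm gpath G k.+1}).

Definition perm_graph : graph :=
  @Graph (gpath G k) (gpath G k.+1)
    (fun m => pfront (tau m)) (fun m => ptail m).

Definition label1 (m : edge perm_graph) : edge G := phead m.
Definition label2 (m : edge perm_graph) : edge G := plast (tau m).

Definition synchronizing1 :=
  exists m : nat, forall p q : gpath perm_graph m,
    map label1 (pedges p) = map label1 (pedges q) -> psrc p = psrc q.

Definition label_shift : set (int -> edge G * edge G) :=
  [set (fun i => (label1 (x i), label2 (x i))) |
    x in bi_infinite_paths perm_graph].

Definition textile1 (x : int -> edge perm_graph) : int -> edge G :=
  fun i => label1 (x i).
Definition textile2 (x : int -> edge perm_graph) : int -> edge G :=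
  fun i => label2 (x i).

(* [textile2 \o textile1^-1]: the set below is a singleton when [textile1] is a
   bijection from the bi-infinite paths of the permutation graph onto those
   of [G] and [x] is a bi-infinite path of [G]. *)
Definition textile_map (x : int -> edge G) : int -> edge G :=
  xget x (textile2 @` [set y | bi_infinite_paths perm_graph y
                               /\ textile1 y = x]).

End PermutationGraph.

(* Complex C*-algebras, not assumed to be unital or nonzero. *)
Record cstarAlgebra (R : realType) := CStarAlgebra {
  cstar_sort :> completeNormedModType R[i];
  cmul : cstar_sort -> cstar_sort -> cstar_sort;
  cstar : cstar_sort -> cstar_sort;
  cmulA : forall a b c, cmul a (cmul b c) = cmul (cmul a b) c;
  cmulDl : forall a b c, cmul (a + b) c = cmul a c + cmul b c;
  cmulDr : forall a b c, cmul a (b + c) = cmul a b + cmul a c;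
  cmulZl : forall (t : R[i]) a b, cmul (t *: a) b = t *: cmul a b;
  cmulZr : forall (t : R[i]) a b, cmul a (t *: b) = t *: cmul a b;
  cmul_norm : forall a b, `|cmul a b| <= `|a| * `|b|;
  cstarD : forall a b, cstar (a + b) = cstar a + cstar b;
  cstarZ : forall (t : R[i]) a, cstar (t *: a) = conjc t *: cstar a;
  cstarM : forall a b, cstar (cmul a b) = cmul (cstar b) (cstar a);
  cstarK : forall a, cstar (cstar a) = a;
  cstar_norm : forall a, `|cmul (cstar a) a| = `|a| ^+ 2 }.

Section CStar.
Variable R : realType.

Definition cle (A : cstarAlgebra R) (a b : A) : Prop :=
  exists c : A, b - a = cmul (cstar c) c.

Record star_hom (A B : cstarAlgebra R) (f : A -> B) : Prop := StarHom {
  star_homD : forall a b, f (a + b) = f a + f b;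
  star_homZ : forall (t : R[i]) a, f (t *: a) = t *: f a;
  star_homM : forall a b, f (cmul a b) = cmul (f a) (f b);
  star_homS : forall a, f (cstar a) = cstar (f a) }.

Record cstar_subalgebra (A : cstarAlgebra R) (D : set A) : Prop :=
  CStarSubalgebra {
  subalg0 : D 0;
  subalgD : forall a b, D a -> D b -> D (a + b);
  subalgZ : forall (t : R[i]) a, D a -> D (t *: a);
  subalgM : forall a b, D a -> D b -> D (cmul a b);
  subalgS : forall a, D a -> D (cstar a);
  subalg_topclosed : closed D }.

Definition generated_by (A : cstarAlgebra R) (X : set A) : set A :=
  [set a | forall D : set A, cstar_subalgebra D -> X `<=` D -> D a].

Definition Ad (A : cstarAlgebra R) (u x : A) : A := cmul (cmul u x) (cstar u).

(* *-homomorphisms from the subalgebra [D] to the complex numbers; only the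
   values of [chi] on [D] are relevant. *)
Record character_on (A : cstarAlgebra R) (D : set A) (chi : A -> R[i]) : Prop :=
  CharacterOn {
  charD : forall a b, D a -> D b -> chi (a + b) = chi a + chi b;
  charZ : forall (t : R[i]) a, D a -> chi (t *: a) = t * chi a;
  charM : forall a b, D a -> D b -> chi (cmul a b) = chi a * chi b;
  charS : forall a, D a -> chi (cstar a) = conjc (chi a);
  char_neq0 : exists2 a, D a & chi a <> 0 }.

Record cuntz_krieger (G : graph) (A : cstarAlgebra R)
    (P : vertex G -> A) (S : edge G -> A) : Prop := CuntzKrieger {
  ck_proj : forall v, cmul (P v) (P v) = P v /\ cstar (P v) = P v;
  ck_orth : forall u v, u <> v -> cmul (P u) (P v) = 0;
  ck_pisom : forall e, cmul (cmul (S e) (cstar (S e))) (S e) = S e;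
  ck_initial : forall e, cmul (cstar (S e)) (S e) = P (rng e);
  ck_disjoint : forall e f, e <> f -> cmul (cstar (S e)) (S f) = 0;
  ck_final : forall e, cle (cmul (S e) (cstar (S e))) (P (src e));
  ck_sum : forall v, (exists e, src e = v) ->
    P v = \sum_(e | src e == v) cmul (S e) (cstar (S e)) }.

(* [A], with [P] and [S], is the universal C*-algebra of the Cuntz-Krieger
   relations; uniqueness of [f] expresses that [A] is generated by [P], [S]. *)
Definition graph_cstar (G : graph) (A : cstarAlgebra R)
    (P : vertex G -> A) (S : edge G -> A) : Prop :=
  cuntz_krieger P S /\
  forall (B : cstarAlgebra R) (Q : vertex G -> B) (T : edge G -> B),
    cuntz_krieger Q T ->
    exists! f : A -> B, star_hom f /\
      (forall v, f (P v) = Q v) /\ (forall e, f (S e) = T e).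

Section GraphAlgebra.
Variables (G : graph) (A : cstarAlgebra R).
Variables (P : vertex G -> A) (S : edge G -> A).

Fixpoint S_word (e : edge G) (s : seq (edge G)) : A :=
  if s is f :: s' then cmul (S e) (S_word f s') else S e.

Definition S_path l (p : gpath G l) : A :=
  if tval (pedges p) is e :: s then S_word e s else P (psrc p).

Definition P_path l (p : gpath G l) : A := cmul (S_path p) (cstar (S_path p)).

Definition diagonal : set A :=
  generated_by [set a | exists l (p : gpath G l), a = P_path p].

Definition U_perm l (tau : {perm gpath G l}) : A :=
  \sum_(p : gpath G l) cmul (S_path (tau p)) (cstar (S_path p)).

Definition graph_unit : A := \sum_(v : vertex G) P v.

(* The definitions below by [xget] pick the unique object with the stated
   property (for [point_char], its values on [diagonal] are unique); the default
   values are irrelevant. *)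
Definition lambda l (tau : {perm gpath G l}) : A -> A :=
  xget (fun a : A => a)
    [set f : A -> A | star_hom f /\ f graph_unit = graph_unit /\
                      forall e, f (S e) = cmul (U_perm tau) (S e)].

Definition point_char (z : nat -> edge G) : A -> R[i] :=
  xget (fun=> 0) [set chi : A -> R[i] | character_on diagonal chi /\
    forall l (p : gpath G l),
      (is_prefix p z -> chi (P_path p) = 1) /\
      (~ is_prefix p z -> chi (P_path p) = 0)].

(* The inverse of the restriction of [lambda tau] to the diagonal. *)
Definition lambda_diag_inv l (tau : {perm gpath G l}) (d : A) : A :=
  xget 0 [set c | diagonal c /\ lambda tau c = d].

Definition phi_plus l (tau : {perm gpath G l}) (x : nat -> edge G) :
    nat -> edge G :=
  xget x [set y | infinite_paths G y /\
    forall d, diagonal d ->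
      point_char y d = point_char x (lambda_diag_inv tau d)].

(* The limit is the eventual value in [n]. With indices from 0, coordinate
   [m + n + 1] of a sequence starting at 1 is number [m + n], which is
   nonnegative for large [n]. *)
Definition phi_two_sided l (tau : {perm gpath G l}) (x : int -> edge G) :
    int -> edge G :=
  fun m => xget (x m) [set e | exists N : nat, forall n j : nat, (N <= n)%N ->
    m + n%:Z = j%:Z -> phi_plus tau (fun i : nat => x (i%:Z - n%:Z)) j = e].

End GraphAlgebra.
End CStar.

(* Main.v *)
Require Import Defs.
From HB Require Import structures.
From mathcomp Require Import all_boot all_order all_fingroup all_algebra.
From mathcomp Require Import complex.
From mathcomp Require Import boolp classical_sets reals topology normedtype.
From mathcomp Require Import functions sequences ring lra zify.

(** The permutation graphs compute everything: a path [x] lifts uniquely through the first labels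
    because of synchronization, and its image under the textile map is read off the second labels.

    Two labelled graphs with the same label shift are matched by sending the source of a lift of
    [x] for [tau] to the source of the lift of the same [x] for [tau'].  This is well defined since
    pasts and futures through a vertex can be spliced and since, in the synchronizing graph, a
    vertex is determined by the labels of any of its pasts.  The matching is the permutation [pi].

    On the C*-side, [Ad (U_pi) \o lambda_tau] and [lambda_tau'] are compared on the products
    [S_e S_alpha], where the equality becomes the combinatorial relation defining [g_pi tau];
    conversely the elements [S_alpha] are pairwise different because the universal algebra maps
    to a concrete Cuntz-Krieger family on a Hilbert space with nonzero projections.  Finally, if
    [w] is a one-sided path of the permutation graph with first labels [x], and [y] is the source
    of [w] followed by its second labels, then [phi_y \o lambda_tau] is the character [phi_x]; so
    [phi_tau^+ x = y], and [phi_tau] is the textile map shifted by [k]. *)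

Set Implicit Arguments.
Unset Strict Implicit.
Unset Printing Implicit Defensive.

Import Order.TTheory GRing.Theory Num.Theory.
Import numFieldNormedType.Exports.

Local Open Scope classical_set_scope.
Local Open Scope ring_scope.
Local Open Scope complex_scope.
Obligation Tactic := idtac.
Local Notation "a ** b" := (cmul a b) (at level 40, left associativity).

(** * Bounded operators on a Hilbert space *)

(** Universality only yields homomorphisms out of the graph algebra, so to see that an element is
    nonzero a concrete target is needed: the operators on l^2(N x E^0), where the edges leaving v
    split N x {v} into residue classes modulo the out-degree. The algebra is not assumed unital;
    that the sum of the vertex projections is a unit is itself extracted from universality.
    Homomorphisms and characters are purely algebraic; their continuity, on which the density
    arguments in the diagonal rest, comes from the unitaries h + i sqrt(1 - h^2), with the square
    root obtained as the limit of a contraction. The resulting bound is twice the norm, which is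
    enough for continuity. Finally, the maps in conditions (3) to (5) are chosen by [xget], so
    nothing is known about them before the chosen object is shown to exist. For [phi_plus] this
    means that lambda_tau maps the diagonal onto itself; there synchronization acts as a finite
    lookahead: finitely many first labels decide whether the coded path lies in a given cylinder. *)

Definition cmod (R : realType) (t : R[i]) : R := complex.Re `|t|.

Section Cmod.
Variable R : realType.
Implicit Types s t : R[i].

Lemma cmodE t : `|t| = (cmod t)%:C.
Proof. by rewrite /cmod normc_def. Qed.

Lemma cmod_ge0 t : 0 <= cmod t.
Proof. by rewrite -lecR -cmodE normr_ge0. Qed.

Lemma cmod_eq0 t : (cmod t == 0) = (t == 0).
Proof. by rewrite -(normr_eq0 t) cmodE -(inj_eq (@complexI R)). Qed.

Lemma cmodM s t : cmod (s * t) = cmod s * cmod t.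
Proof. by apply: complexI; rewrite rmorphM /= -!cmodE normrM. Qed.

Lemma cmodD s t : cmod (s + t) <= cmod s + cmod t.
Proof. by rewrite -lecR rmorphD /= -!cmodE ler_normD. Qed.

Lemma cmodN t : cmod (- t) = cmod t.
Proof. by rewrite /cmod normrN. Qed.

Lemma cmod_real (r : R) : cmod r%:C = `|r|.
Proof. by rewrite /cmod normc_def /= expr0n addr0 sqrtr_sqr. Qed.

Lemma mul_conjc t : conjc t * t = (cmod t ^+ 2)%:C.
Proof. by rewrite mulrC -sqr_normc cmodE rmorphXn. Qed.

End Cmod.

(* [ip] is the real part of a complex inner product. *)
Record hilbert (R : realType) := Hilbert {
  hsort :> lmodType R[i];
  ip : hsort -> hsort -> R;
  ipC : forall x y, ip x y = ip y x;
  ipDl : forall x y z, ip (x + y) z = ip x z + ip y z;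
  ipZ : forall (t : R[i]) x y, ip (t *: x) y = ip x (conjc t *: y);
  ipr : forall (r : R) x y, ip (r%:C *: x) y = r * ip x y;
  ip_ge0 : forall x, 0 <= ip x x;
  ip_eq0 : forall x, ip x x = 0 -> x = 0;
  ip_complete : forall u : nat -> hsort,
    (forall e : R, 0 < e -> exists N, forall m n, (N <= m)%N -> (N <= n)%N ->
       ip (u m - u n) (u m - u n) <= e ^+ 2) ->
    exists l, forall e : R, 0 < e -> exists N, forall n, (N <= n)%N ->
       ip (u n - l) (u n - l) <= e ^+ 2 }.

Section HilbertTheory.
Variables (R : realType) (H : hilbert R).
Implicit Types x y z : H.

Lemma ipDr x y z : ip x (y + z) = ip x y + ip x z.
Proof. by rewrite ipC ipDl !(ipC x). Qed.

Lemma ipNl x y : ip (- x) y = - ip x y.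
Proof.
have -> : - x = (-1 : R)%:C *: x by rewrite rmorphN1 scaleN1r.
by rewrite ipr mulN1r.
Qed.

Lemma ipNr x y : ip x (- y) = - ip x y.
Proof. by rewrite ipC ipNl ipC. Qed.

Lemma ip0l y : ip 0 y = 0.
Proof. by rewrite -(scale0r y) -[0]/((0 : R)%:C) ipr mul0r. Qed.

Lemma iprr (r : R) x y : ip x (r%:C *: y) = r * ip x y.
Proof. by rewrite ipC ipr ipC. Qed.

Lemma ip_ext x y : (forall z, ip x z = ip y z) -> x = y.
Proof.
move=> xy; apply/eqP; rewrite -subr_eq0; apply/eqP/ip_eq0.
by rewrite ipDl ipNl xy subrr.
Qed.

Definition hn x : R := Num.sqrt (ip x x).

Lemma hn_ge0 x : 0 <= hn x. Proof. exact: sqrtr_ge0. Qed.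

Lemma hn2 x : hn x ^+ 2 = ip x x.
Proof. by rewrite sqr_sqrtr// ip_ge0. Qed.

Lemma hn_le x (e : R) : 0 <= e -> (hn x <= e) = (ip x x <= e ^+ 2).
Proof. by move=> e0; rewrite -hn2 ler_sqr// nnegrE hn_ge0. Qed.

Lemma hn0 : hn 0 = 0.
Proof. by rewrite /hn ip0l sqrtr0. Qed.

Lemma hn_eq0 x : hn x = 0 -> x = 0.
Proof. by move=> h; apply: ip_eq0; rewrite -hn2 h expr0n. Qed.

Lemma hnN x : hn (- x) = hn x.
Proof. by rewrite /hn ipNl ipNr opprK. Qed.

Lemma hnZ t x : hn (t *: x) = cmod t * hn x.
Proof.
rewrite /hn ipZ scalerA mul_conjc iprr sqrtrM ?sqr_ge0// sqrtr_sqr.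
by rewrite ger0_norm// cmod_ge0.
Qed.

(** Expand the nonnegative square of |y| x - |x| y and cancel the factor |x| |y|. *)
Lemma ip_CS x y : ip x y <= hn x * hn y.
Proof.
have [hx|hx] := eqVneq (hn x) 0.
  by rewrite (hn_eq0 hx) ip0l hn0 mul0r.
have px : 0 < hn x by rewrite lt_neqAle eq_sym hx hn_ge0.
have [hy|hy] := eqVneq (hn y) 0.
  by rewrite (hn_eq0 hy) ipC ip0l hn0 mulr0.
have py : 0 < hn y by rewrite lt_neqAle eq_sym hy hn_ge0.
have := ip_ge0 ((hn y)%:C *: x - (hn x)%:C *: y).
rewrite !(ipDl, ipDr, ipNl, ipNr, ipr, iprr) (ipC y x) -!hn2 => h.
have hp : 0 < hn x * hn y by rewrite mulr_gt0.
rewrite -(ler_pM2l hp); nra.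
Qed.

Lemma hnD x y : hn (x + y) <= hn x + hn y.
Proof.
rewrite hn_le ?addr_ge0 ?hn_ge0//.
rewrite !(ipDl, ipDr) (ipC y x) -!hn2; have := ip_CS x y; nra.
Qed.

End HilbertTheory.

Section Operators.
Variables (R : realType) (H : hilbert R).

(* Bounded operators stored together with their adjoint. *)
Record bop := Bop {
  opf : H -> H;
  opa : H -> H;
  op_adj : forall x y, ip (opf x) y = ip x (opa y);
  opfZ : forall t x, opf (t *: x) = t *: opf x;
  opaZ : forall t x, opa (t *: x) = t *: opa x;
  op_bdd : exists M : R, 0 <= M /\ forall x, hn (opf x) <= M * hn x }.

HB.instance Definition _ := gen_eqMixin bop.
HB.instance Definition _ := gen_choiceMixin bop.

(** The form is nondegenerate, so an operator determines its adjoint and the stored adjoint carries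
    no extra information. *)
Lemma bop_eq (a b : bop) : (forall x, opf a x = opf b x) -> a = b.
Proof.
case: a b => [f g fg fZ gZ fb] [f' g' fg' fZ' gZ' fb'] /= /funext ff.
rewrite -{}ff in fg' fZ' fb' *.
have gg : g = g'.
  apply: funext => y; apply: ip_ext => z; rewrite ipC -fg fg' ipC //.
rewrite -{}gg in fg' gZ' *.
by congr Bop; exact: Prop_irrelevance.
Qed.

(** Additivity is not a field of [bop]: having an adjoint forces it. *)
Lemma opfD (a : bop) x y : opf a (x + y) = opf a x + opf a y.
Proof. by apply: ip_ext => z; rewrite ipDl !op_adj ipDl. Qed.

Lemma opf0 (a : bop) : opf a 0 = 0.
Proof. by have := opfZ a 0 0; rewrite !scale0r. Qed.

Program Definition badd (a b : bop) : bop :=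
  @Bop (fun x => opf a x + opf b x) (fun x => opa a x + opa b x) _ _ _ _.
Next Obligation. by move=> a b x y /=; rewrite ipDl !op_adj ipDr. Qed.
Next Obligation. by move=> a b t x /=; rewrite !opfZ scalerDr. Qed.
Next Obligation. by move=> a b t x /=; rewrite !opaZ scalerDr. Qed.
Next Obligation.
move=> a b; have [M [M0 hM]] := op_bdd a; have [N [N0 hN]] := op_bdd b.
exists (M + N); split=> [|x] /=; first exact: addr_ge0.
by rewrite mulrDl (le_trans (hnD _ _))// lerD.
Qed.

Program Definition bopp (a : bop) : bop :=
  @Bop (fun x => - opf a x) (fun x => - opa a x) _ _ _ _.
Next Obligation. by move=> a x y /=; rewrite ipNl !op_adj ipNr. Qed.
Next Obligation. by move=> a t x /=; rewrite !opfZ scalerN. Qed.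
Next Obligation. by move=> a t x /=; rewrite !opaZ scalerN. Qed.
Next Obligation.
move=> a; have [M [M0 hM]] := op_bdd a.
by exists M; split=> //= x; rewrite hnN.
Qed.

Program Definition bzero : bop := @Bop (fun=> 0) (fun=> 0) _ _ _ _.
Next Obligation. by move=> x y /=; rewrite (ipC x) !ip0l. Qed.
Next Obligation. by move=> t x /=; rewrite scaler0. Qed.
Next Obligation. by move=> t x /=; rewrite scaler0. Qed.
Next Obligation. by exists 0; split=> //= x; rewrite hn0 mul0r. Qed.

Program Definition bscale (t : R[i]) (a : bop) : bop :=
  @Bop (fun x => t *: opf a x) (fun x => conjc t *: opa a x) _ _ _ _.
Next Obligation. by move=> t a x y /=; rewrite ipZ op_adj opaZ. Qed.
Next Obligation. by move=> t a s x /=; rewrite !opfZ !scalerA mulrC. Qed.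
Next Obligation. by move=> t a s x /=; rewrite !opaZ !scalerA mulrC. Qed.
Next Obligation.
move=> t a; have [M [M0 hM]] := op_bdd a.
have t0 : 0 <= cmod t := cmod_ge0 t.
exists (cmod t * M); split=> [|x] /=; first exact: mulr_ge0.
by rewrite hnZ -mulrA ler_wpM2l.
Qed.

Lemma baddA : associative badd.
Proof. by move=> a b c; apply: bop_eq => x /=; rewrite addrA. Qed.
Lemma baddC : commutative badd.
Proof. by move=> a b; apply: bop_eq => x /=; rewrite addrC. Qed.
Lemma badd0 : left_id bzero badd.
Proof. by move=> a; apply: bop_eq => x /=; rewrite add0r. Qed.
Lemma baddN : left_inverse bzero bopp badd.
Proof. by move=> a; apply: bop_eq => x /=; rewrite addNr. Qed.

HB.instance Definition _ := GRing.isZmodule.Build bop baddA baddC badd0 baddN.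

Lemma bscaleA (s t : R[i]) a : bscale s (bscale t a) = bscale (s * t) a.
Proof. by apply: bop_eq => x /=; rewrite scalerA. Qed.
Lemma bscale1 : left_id 1 bscale.
Proof. by move=> a; apply: bop_eq => x /=; rewrite scale1r. Qed.
Lemma bscaleDr : right_distributive bscale +%R.
Proof. by move=> t a b; apply: bop_eq => x /=; rewrite scalerDr. Qed.
Lemma bscaleDl a : {morph bscale^~ a : s t / s + t}.
Proof. by move=> s t; apply: bop_eq => x /=; rewrite scalerDl. Qed.

HB.instance Definition _ :=
  GRing.Zmodule_isLmodule.Build R[i] bop bscaleA bscale1 bscaleDr bscaleDl.

Lemma opf_scale t (a : bop) x : opf (t *: a) x = t *: opf a x.
Proof. by []. Qed.
Lemma opf_sub (a b : bop) x : opf (a - b) x = opf a x - opf b x.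
Proof. by []. Qed.
Lemma opf_sum (I : Type) (r : seq I) (Q : pred I) (F : I -> bop) x :
  opf (\sum_(i <- r | Q i) F i) x = \sum_(i <- r | Q i) opf (F i) x.
Proof. by elim/big_rec2: _ => // i y a _ <-. Qed.

Definition opbounds (a : bop) : set R :=
  [set M | 0 <= M /\ forall x, hn (opf a x) <= M * hn x].

Definition opn (a : bop) : R := inf (opbounds a).

Lemma opn_ge0 a : 0 <= opn a.
Proof. by apply: lb_le_inf; [exact: op_bdd | move=> M []]. Qed.

Lemma opn_le a (M : R) : 0 <= M -> (forall x, hn (opf a x) <= M * hn x) ->
  opn a <= M.
Proof. by move=> M0 hM; apply: ge_inf; [exists 0 => N [] | split]. Qed.

Lemma opnP a x : hn (opf a x) <= opn a * hn x.
Proof.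
have [hx|hx] := eqVneq (hn x) 0.
  by rewrite (hn_eq0 hx) opf0 hn0 mulr0.
have px : 0 < hn x by rewrite lt_neqAle eq_sym hx hn_ge0.
rewrite -ler_pdivrMr//; apply: lb_le_inf; first exact: op_bdd.
by move=> M [M0 hM]; rewrite ler_pdivrMr.
Qed.

Lemma opnD a b : opn (a + b) <= opn a + opn b.
Proof.
apply: opn_le => [|x]; first by rewrite addr_ge0 ?opn_ge0.
by rewrite mulrDl (le_trans (hnD _ _))// lerD ?opnP.
Qed.

Lemma opnZ_le t a : opn (t *: a) <= cmod t * opn a.
Proof.
have t0 : 0 <= cmod t := cmod_ge0 t.
apply: opn_le => [|x]; first by rewrite mulr_ge0 ?opn_ge0.
by rewrite opf_scale hnZ -mulrA ler_wpM2l ?opnP.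
Qed.

Lemma opnZ t a : opn (t *: a) = cmod t * opn a.
Proof.
apply/eqP; rewrite eq_le opnZ_le /=.
have [->|t0] := eqVneq t 0; first by rewrite /cmod normr0 /= mul0r opn_ge0.
(* The reverse inequality is the one already proved, applied to t^-1 and t a. *)
have := opnZ_le t^-1 (t *: a).
rewrite scalerA mulVf// scale1r => h.
have pt : 0 < cmod t by rewrite lt_neqAle eq_sym cmod_eq0 t0 cmod_ge0.
have -> : opn (t *: a) = cmod t * (cmod t^-1 * opn (t *: a)); last first.
  by rewrite ler_pM2l.
by rewrite mulrA -cmodM mulfV// cmod_real normr1 mul1r.
Qed.

Lemma opn_eq0 a : opn a = 0 -> a = 0.
Proof.
move=> h; apply: bop_eq => x /=; apply: hn_eq0.
by apply/eqP; rewrite eq_le hn_ge0 andbT (le_trans (opnP a x))// h mul0r.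
Qed.

Definition bnorm (a : bop) : R[i] := (opn a)%:C.

Lemma bnormD a b : bnorm (a + b) <= bnorm a + bnorm b.
Proof. by rewrite /bnorm -rmorphD lecR opnD. Qed.

Lemma bnormZ (t : R[i]) a : bnorm (t *: a) = `|t| * bnorm a.
Proof. by rewrite /bnorm opnZ rmorphM cmodE. Qed.

Lemma bnorm_eq0 a : bnorm a = 0 -> a = 0.
Proof. by move=> /complexI /opn_eq0. Qed.

HB.instance Definition _ :=
  @Lmodule_isNormed.Build R[i] bop bnorm bnormD bnormZ bnorm_eq0.

Lemma bop_normE (a : bop) : `|a| = (opn a)%:C.
Proof. by []. Qed.

End Operators.

(** * Completeness from Cauchy sequences *)

Lemma ltcR0 (R : realType) (e : R[i]) : 0 < e -> e = (complex.Re e)%:C /\ 0 < complex.Re e.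
Proof. by case: e => a b; rewrite ltcE /= => /andP[/eqP -> ->]. Qed.

Lemma pos_small (R : realType) (e : R) : 0 < e -> exists n : nat, n.+1%:R^-1 < e.
Proof.
move=> e0; exists (Num.truncn e^-1).
by rewrite invf_plt ?posrE// truncnS_gt.
Qed.

Lemma subr_mid (V : zmodType) (y x z : V) : x - z = (x - y) - (z - y).
Proof. by rewrite opprB addrA subrK. Qed.

Section SeqComplete.
Variables (R : realType) (V : normedModType R[i]).

(** Completeness is stated for Cauchy filters. Picking for every n a ball of radius 1/(n+1) that
    belongs to F gives a Cauchy sequence of centres, because two members of F meet; its limit is the
    limit of F. *)
Lemma seq_complete_filter :
  (forall u : nat -> V, (forall e : R, 0 < e -> exists N, forall m n,
      (N <= m)%N -> (N <= n)%N -> `|u m - u n| <= e%:C) ->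
    exists l, forall e : R, 0 < e -> exists N, forall n, (N <= n)%N ->
      `|u n - l| <= e%:C) ->
  forall F : set_system V, ProperFilter F -> cauchy F -> cvg F.
Proof.
move=> Vc F FF /cauchyP Fc.
have pinv n : 0 < (n.+1%:R^-1 : R)%:C by rewrite ltcR invr_gt0.
have /choice[a Fa] n : exists x : V, F (ball x (n.+1%:R^-1 : R)%:C) by exact: Fc.
have aa m n : `|a m - a n| <= ((m.+1%:R^-1 + n.+1%:R^-1) : R)%:C.
  have [x [/= hm hn]] := filter_ex (filterI (Fa m) (Fa n)).
  rewrite -ball_normE /= in hm; rewrite -ball_normE /= in hn.
  rewrite (subr_mid x).
  by rewrite (le_trans (ler_normB _ _))// rmorphD lerD ?ltW.
have inv_le N n : (N <= n)%N -> (n.+1%:R^-1 : R) <= N.+1%:R^-1.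
  by move=> Nn; rewrite lef_pV2 ?posrE// ler_nat.
have [|l hl] := Vc a.
  move=> e e0; have [N hN] := pos_small (divr_gt0 e0 (ltr0n R 2)).
  exists N => m n Nm Nn; rewrite (le_trans (aa m n))// lecR.
  rewrite (le_trans (lerD (inv_le _ _ Nm) (inv_le _ _ Nn)))//.
  by rewrite -mulr2n -[X in X <= _]mulr_natr -ler_pdivlMr// ltW.
apply/cvg_ex; exists l; apply/fcvgrPdist_lt => e e0.
have [-> {}e0] := ltcR0 e0; set d := complex.Re e in e0 *.
have d3 : 0 < d / 3 by rewrite divr_gt0.
have [N hN] := hl _ d3; have [N' hN'] := pos_small d3.
apply: filterS (Fa (maxn N N')) => x; rewrite -ball_normE /= => hx.
rewrite (_ : l - x = (a (maxn N N') - x) - (a (maxn N N') - l)); last first.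
  by rewrite opprB [RHS]addrC addrA subrK.
rewrite (le_lt_trans (ler_normB _ _))//.
rewrite (lt_le_trans (ltr_leD hx (hN _ (leq_maxl _ _))))//.
rewrite -rmorphD lecR.
have := le_lt_trans (inv_le _ _ (leq_maxr N N')) hN'.
by move: (_^-1) => q; lra.
Qed.

End SeqComplete.

(** * The C*-algebra of bounded operators *)

Section OperatorAlgebra.
Variables (R : realType) (H : hilbert R).
Local Notation bop := (bop H).

Lemma opn_leP (a : bop) (M : R) : 0 <= M -> (opn a <= M) <-> (forall x, hn (opf a x) <= M * hn x).
Proof.
move=> M0; split=> [h x|]; last exact: opn_le.
by rewrite (le_trans (opnP a x))// ler_wpM2r ?hn_ge0.
Qed.

(** |a* y|^2 = <a a* y, y> <= M |a* y| |y|; then cancel |a* y|. *)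
Lemma opn_star_le (a : bop) (M : R) : 0 <= M ->
  (forall x, hn (opf a x) <= M * hn x) -> forall x, hn (opa a x) <= M * hn x.
Proof.
move=> M0 hM y; have [h0|h0] := eqVneq (hn (opa a y)) 0.
  by rewrite h0 mulr_ge0 ?hn_ge0.
have p0 : 0 < hn (opa a y) by rewrite lt_neqAle eq_sym h0 hn_ge0.
have : hn (opa a y) ^+ 2 <= M * hn (opa a y) * hn y.
  rewrite hn2 -op_adj (le_trans (ip_CS _ _))// ler_wpM2r ?hn_ge0//.
by rewrite expr2 mulrAC ler_pM2r.
Qed.

Program Definition bstar (a : bop) : bop := @Bop R H (opa a) (opf a) _ _ _ _.
Next Obligation. by move=> a x y; rewrite ipC -op_adj ipC. Qed.
Next Obligation. by move=> a; exact: opaZ. Qed.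
Next Obligation. by move=> a; exact: opfZ. Qed.
Next Obligation.
move=> a; have [M [M0 hM]] := op_bdd a.
by exists M; split=> //; exact: opn_star_le.
Qed.

Program Definition bmul (a b : bop) : bop :=
  @Bop R H (opf a \o opf b) (opa b \o opa a) _ _ _ _.
Next Obligation. by move=> a b x y /=; rewrite !op_adj. Qed.
Next Obligation. by move=> a b t x /=; rewrite !opfZ. Qed.
Next Obligation. by move=> a b t x /=; rewrite !opaZ. Qed.
Next Obligation.
move=> a b /=; exists (opn a * opn b); split=> [|x]; first by rewrite mulr_ge0 ?opn_ge0.
by rewrite (le_trans (opnP a _))// -mulrA ler_wpM2l ?opn_ge0 ?opnP.
Qed.

Lemma opn_mul a b : opn (bmul a b) <= opn a * opn b.
Proof.
apply: opn_le => [|x]; first by rewrite mulr_ge0 ?opn_ge0.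
by rewrite (le_trans (opnP a _))// -mulrA ler_wpM2l ?opn_ge0 ?opnP.
Qed.

Lemma opn_star a : opn (bstar a) <= opn a.
Proof. by apply: opn_le (opn_ge0 _) _; apply: opn_star_le (opn_ge0 _) (@opnP _ _ a). Qed.

(** The lower bound on the norm of a* a comes from |a x|^2 = <x, a* a x> <= |a* a| |x|^2. *)
Lemma opn_cstar a : opn (bmul (bstar a) a) = opn a ^+ 2.
Proof.
apply/eqP; rewrite eq_le; apply/andP; split.
  by rewrite (le_trans (opn_mul _ _))// expr2 ler_wpM2r ?opn_ge0 ?opn_star.
rewrite -ler_sqrt ?exprn_ge0 ?opn_ge0// sqrtr_sqr ger0_norm ?opn_ge0//.
apply: opn_le (sqrtr_ge0 _) _ => x.
rewrite hn_le ?mulr_ge0 ?sqrtr_ge0 ?hn_ge0// op_adj exprMn sqr_sqrtr ?opn_ge0//.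
rewrite -[opa a _]/(opf (bmul (bstar a) a) x) (le_trans (ip_CS _ _))//.
by rewrite mulrC expr2 mulrA ler_wpM2r ?hn_ge0 ?opnP.
Qed.

(** A Cauchy sequence of operators converges pointwise, and so do the adjoints, which are Cauchy
    with the same constants. The two pointwise limits are adjoint to each other, hence form an
    element of [bop]. *)
Lemma bop_complete (F : set_system bop) : ProperFilter F -> cauchy F -> cvg F.
Proof.
apply: seq_complete_filter => u uC.
have uC' (e : R) : 0 < e -> exists N, forall m n, (N <= m)%N -> (N <= n)%N ->
    forall x, hn (opf (u m) x - opf (u n) x) <= e * hn x.
  move=> e0; have [N hN] := uC _ e0; exists N => m n Nm Nn x.
  rewrite -opf_sub; apply/opn_leP: x; first exact: ltW.
  by rewrite -lecR -bop_normE hN.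
(* Stated for an arbitrary [f] so that it serves both [opf] and [opa]. *)
have vC x (f : bop -> H -> H) :
    (forall e : R, 0 < e -> exists N, forall m n, (N <= m)%N -> (N <= n)%N ->
      hn (f (u m) x - f (u n) x) <= e * hn x) ->
    exists l, forall e : R, 0 < e -> exists N, forall n, (N <= n)%N ->
       hn (f (u n) x - l) <= e.
  move=> h; have [|l hl] := ip_complete (u := fun n => f (u n) x); last first.
    by exists l => e e0; have [N hN] := hl _ e0; exists N => n /hN; rewrite (hn_le _ (ltW e0)).
  move=> e e0; have p0 : 0 < 1 + hn x by rewrite ltr_pwDl ?hn_ge0.
  have [N hN] := h _ (divr_gt0 e0 p0); exists N => m n /hN h1 /h1.
  rewrite -(hn_le _ (ltW e0)) => h2; rewrite (le_trans h2)// -mulrA ler_piMr ?(ltW e0)//.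
  by rewrite mulrC ler_pdivrMr// mul1r lerDr.
have uCa (e : R) : 0 < e -> exists N, forall m n, (N <= m)%N -> (N <= n)%N ->
    forall x, hn (opa (u m) x - opa (u n) x) <= e * hn x.
  move=> e0; have [N hN] := uC' _ e0; exists N => m n Nm Nn x.
  have /= := @opn_star_le (u m - u n) e (ltW e0) (hN m n Nm Nn).
  by apply.
have /choice[T hT] x := vC x (@opf R H) (fun e e0 => let: ex_intro N hN := uC' e e0 in
   ex_intro _ N (fun m n Nm Nn => hN m n Nm Nn x)).
have /choice[T' hT'] x := vC x (@opa R H) (fun e e0 => let: ex_intro N hN := uCa e e0 in
   ex_intro _ N (fun m n Nm Nn => hN m n Nm Nn x)).
have small (r : R) (c : R) : (forall e : R, 0 < e -> r <= e * c) -> 0 <= c -> r <= 0.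
  move=> h c0; apply/ler_addgt0Pr => e e0; rewrite add0r.
  have p0 : 0 < c + 1 by rewrite ltr_wpDl.
  rewrite (le_trans (h _ (divr_gt0 e0 p0)))//.
  by rewrite mulrAC ler_pdivrMr// ler_pM2l// lerDl.
have lim_eq (x y : H) (c : R) : 0 <= c ->
    (forall e, 0 < e -> hn (x - y) <= e * c) -> x = y.
  move=> c0 h; apply/eqP; rewrite -subr_eq0; apply/eqP/hn_eq0/eqP.
  by rewrite eq_le hn_ge0 (small _ _ h).
have TZ (f : bop -> H -> H) (S : H -> H) :
    (forall a t x, f a (t *: x) = t *: f a x) ->
    (forall x e, 0 < e -> exists N, forall n, (N <= n)%N -> hn (f (u n) x - S x) <= e) ->
    forall t x, S (t *: x) = t *: S x.
  move=> fZ hS t x; apply: (@lim_eq _ _ (1 + cmod t)); first by rewrite addr_ge0 ?cmod_ge0.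
  move=> e e0; have [N hN] := hS x _ e0; have [N' hN'] := hS (t *: x) _ e0.
  have := hN _ (leq_maxl N N'); have := hN' _ (leq_maxr N N').
  set n := maxn N N' => h1 h2.
  have -> : S (t *: x) - t *: S x
      = t *: (f (u n) x - S x) - (f (u n) (t *: x) - S (t *: x)).
    by rewrite fZ scalerBr opprB [RHS]addrC addrA subrK.
  rewrite (le_trans (hnD _ _))// hnN hnZ mulrDr mulr1 addrC lerD//.
  by rewrite mulrC ler_wpM2r ?cmod_ge0.
have ip_lim (x y : H) (e : R) : hn x <= e -> `|ip x y| <= e * hn y.
  move=> h; rewrite ler_norml lerNl -ipNl !(le_trans (ip_CS _ _))//= ?hnN ler_wpM2r ?hn_ge0//.
have adj x y : ip (T x) y = ip x (T' y).
  apply/eqP; rewrite -subr_eq0 -normr_eq0 eq_le normr_ge0 andbT.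
  apply: (small _ (hn x + hn y)); last by rewrite addr_ge0 ?hn_ge0.
  move=> e e0; have [N hN] := hT x _ e0; have [N' hN'] := hT' y _ e0.
  have /(ip_lim _ y) := hN _ (leq_maxl N N').
  have /(ip_lim _ x) := hN' _ (leq_maxr N N').
  set n := maxn N N' => h1 h2.
  have -> : ip (T x) y - ip x (T' y) =
     ip (opa (u n) y - T' y) x - ip (opf (u n) x - T x) y.
    rewrite !(ipDl, ipNl) op_adj (ipC x (T' y)) (ipC x (opa (u n) y)).
    by ring.
  by rewrite (le_trans (ler_normB _ _))// mulrDr lerD.
(* Letting m grow in |u_n x - u_m x| <= e |x| keeps N independent of x, which gives convergence in
   norm. *)
have bd (e : R) : 0 < e -> exists N, forall n, (N <= n)%N ->
    forall x, hn (opf (u n) x - T x) <= e * hn x.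
  move=> e0; have [N hN] := uC' _ e0; exists N => n Nn x.
  rewrite -subr_le0; apply: (small _ 1) => // d d0; rewrite mulr1.
  have [N' hN'] := hT x _ d0.
  have := hN n _ Nn (leq_maxl N N') x.
  have := hN' _ (leq_maxr N N'); set m := maxn N N' => h1 h2.
  rewrite lerBlDr (_ : opf (u n) x - T x =
    (opf (u m) x - T x) + (opf (u n) x - opf (u m) x)); last by rewrite [RHS]addrC addrA subrK.
  by rewrite (le_trans (hnD _ _))// lerD.
have Tb : exists M : R, 0 <= M /\ forall x, hn (T x) <= M * hn x.
  have [N hN] := bd 1 ltr01; exists (opn (u N) + 1); split=> [|x].
    by rewrite addr_ge0 ?opn_ge0.
  rewrite (_ : T x = opf (u N) x - (opf (u N) x - T x)); last by rewrite opprB addrC subrK.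
  by rewrite (le_trans (hnD _ _))// hnN mulrDl lerD ?opnP ?hN.
exists (Bop adj (TZ _ _ (@opfZ R H) hT) (TZ _ _ (@opaZ R H) hT') Tb) => e e0.
have [N hN] := bd _ e0; exists N => n Nn.
by rewrite bop_normE lecR; apply/opn_leP => [|x]; [exact: ltW|exact: hN].
Qed.

HB.instance Definition _ := Uniform_isComplete.Build bop bop_complete.

Program Definition bop_cstar : cstarAlgebra R :=
  @CStarAlgebra R bop bmul bstar _ _ _ _ _ _ _ _ _ _ _.
Next Obligation. by move=> a b c; apply: bop_eq. Qed.
Next Obligation. by move=> a b c; apply: bop_eq. Qed.
Next Obligation. by move=> a b c; apply: bop_eq => x /=; rewrite opfD. Qed.
Next Obligation. by move=> t a b; apply: bop_eq. Qed.
Next Obligation. by move=> t a b; apply: bop_eq => x /=; rewrite opfZ. Qed.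
Next Obligation. by move=> a b; rewrite !bop_normE -rmorphM lecR opn_mul. Qed.
Next Obligation. by move=> a b; apply: bop_eq. Qed.
Next Obligation. by move=> t a; apply: bop_eq. Qed.
Next Obligation. by move=> a b; apply: bop_eq. Qed.
Next Obligation. by move=> a; apply: bop_eq. Qed.
Next Obligation. by move=> a; rewrite !bop_normE -rmorphXn opn_cstar. Qed.

End OperatorAlgebra.

(** * Square-summable families *)

Section ProjectionDifference.
Variables (R : realType) (A : cstarAlgebra R).
Implicit Types a b c p q : A.

Lemma cmul0 a : cmul a 0 = 0.
Proof. by rewrite -{1}(scale0r (0 : A)) cmulZr scale0r. Qed.
Lemma c0mul a : cmul 0 a = 0.
Proof. by rewrite -{1}(scale0r (0 : A)) cmulZl scale0r. Qed.
Lemma cmulN a b : cmul a (- b) = - cmul a b.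
Proof. by rewrite -scaleN1r cmulZr scaleN1r. Qed.
Lemma cNmul a b : cmul (- a) b = - cmul a b.
Proof. by rewrite -scaleN1r cmulZl scaleN1r. Qed.
Lemma cmulBr a b c : cmul a (b - c) = cmul a b - cmul a c.
Proof. by rewrite cmulDr cmulN. Qed.
Lemma cmulBl a b c : cmul (a - b) c = cmul a c - cmul b c.
Proof. by rewrite cmulDl cNmul. Qed.
Lemma cstarN a : cstar (- a) = - cstar a.
Proof. by rewrite -scaleN1r cstarZ rmorphN1 scaleN1r. Qed.
Lemma cstar0 : cstar (0 : A) = 0.
Proof. by rewrite -(scale0r (0 : A)) cstarZ rmorph0 !scale0r. Qed.
Lemma cstarB a b : cstar (a - b) = cstar a - cstar b.
Proof. by rewrite cstarD cstarN. Qed.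
Lemma cmul_suml (I : Type) (r : seq I) (Q : pred I) (F : I -> A) a :
  cmul (\sum_(i <- r | Q i) F i) a = \sum_(i <- r | Q i) cmul (F i) a.
Proof. by elim/big_rec2: _ => [|i x y _ <-]; rewrite ?c0mul// cmulDl. Qed.
Lemma cmul_sumr (I : Type) (r : seq I) (Q : pred I) (F : I -> A) a :
  cmul a (\sum_(i <- r | Q i) F i) = \sum_(i <- r | Q i) cmul a (F i).
Proof. by elim/big_rec2: _ => [|i x y _ <-]; rewrite ?cmul0// cmulDr. Qed.
Lemma cstar_sum (I : Type) (r : seq I) (Q : pred I) (F : I -> A) :
  cstar (\sum_(i <- r | Q i) F i) = \sum_(i <- r | Q i) cstar (F i).
Proof. by elim/big_rec2: _ => [|i x y _ <-]; rewrite ?cstar0// cstarD. Qed.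

(** Here p - q is itself a projection, hence its own witness of positivity. *)
Lemma cle_proj p q : cmul p p = p -> cstar p = p ->
  cmul q q = q -> cstar q = q -> cmul p q = q -> cle q p.
Proof.
move=> pp ps qq qs pq; exists (p - q).
have qp : cmul q p = q by rewrite -{1}qs -{1}ps -cstarM pq.
by rewrite cstarB ps qs cmulBl !cmulBr pp qq pq qp subrr subr0.
Qed.

End ProjectionDifference.

Section ComplexSequences.
Variable R : realType.

Lemma Rseq_complete (u : nat -> R) :
  (forall e : R, 0 < e -> exists N, forall m n, (N <= m)%N -> (N <= n)%N ->
     `|u m - u n| <= e) -> cvgn u.
Proof.
move=> h; apply/cauchy_cvgP/cauchy_exP => e e0.
have [N hN] := h _ (divr_gt0 e0 (ltr0n R 2)).
exists (u N); exists N => // n Nn /=; rewrite -ball_normE /=.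
by rewrite (le_lt_trans (hN _ _ (leqnn _) Nn))// ltr_pdivrMr// ltr_pMr// ltr1n.
Qed.

Lemma normRe_cmod (z : R[i]) : `|complex.Re z| <= cmod z.
Proof. by rewrite -lecR -cmodE normc_ge_Re. Qed.

Lemma normIm_cmod (z : R[i]) : `|complex.Im z| <= cmod z.
Proof.
rewrite /cmod normc_def /= -sqrtr_sqr ler_wsqrtr// lerDr sqr_ge0 //.
Qed.

Lemma cmod_ReIm (z : R[i]) : cmod z <= `|complex.Re z| + `|complex.Im z|.
Proof.
case: z => a b /=; have -> : (a +i* b)%C = a%:C + 'i%C * b%:C.
  by rewrite [LHS]complexE.
rewrite (le_trans (cmodD _ _))// cmodM !cmod_real.
by rewrite /cmod normc_def /= expr0n add0r expr1n sqrtr1 mul1r.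
Qed.

(** Convergence of the real and imaginary parts is returned as well, because [dot] is written in
    terms of them. *)
Lemma Cseq_complete (u : nat -> R[i]) :
  (forall e : R, 0 < e -> exists N, forall m n, (N <= m)%N -> (N <= n)%N ->
     cmod (u m - u n) <= e) ->
  exists l : R[i],
   [/\ (fun n => complex.Re (u n)) @ \oo --> complex.Re l,
    (fun n => complex.Im (u n)) @ \oo --> complex.Im l &
    forall e : R, 0 < e -> exists N, forall n, (N <= n)%N -> cmod (u n - l) <= e].
Proof.
move=> h.
have hr : cvgn (fun n => complex.Re (u n)).
  apply: Rseq_complete => e /h[N hN]; exists N => m n Nm Nn.
  by rewrite -raddfB (le_trans (normRe_cmod _))// hN.
have hi : cvgn (fun n => complex.Im (u n)).
  apply: Rseq_complete => e /h[N hN]; exists N => m n Nm Nn.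
  by rewrite -raddfB (le_trans (normIm_cmod _))// hN.
exists ((limn (fun n => complex.Re (u n))) +i* (limn (fun n => complex.Im (u n)))).
split=> //= e e0.
have e2 : 0 < e / 2 by rewrite divr_gt0.
move/cvgrPdist_le : hr => /(_ _ e2)[N _ hN].
move/cvgrPdist_le : hi => /(_ _ e2)[N' _ hN'].
exists (maxn N N') => n; rewrite geq_max => /andP[/hN/= h1 /hN'/= h2].
rewrite (le_trans (cmod_ReIm _))// [e]splitr lerD//.
  by rewrite raddfB /= distrC.
by rewrite raddfB /= distrC.
Qed.

End ComplexSequences.

(** * The Hilbert space of square-summable functions on N x V *)

Section SquareSummable.
Variables (R : realType) (V : finType).

(** The real part of z times the conjugate of w. *)
Definition dot (z w : R[i]) : R :=
  complex.Re z * complex.Re w + complex.Im z * complex.Im w.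

Lemma dotC z w : dot z w = dot w z.
Proof. by rewrite /dot mulrC (mulrC (complex.Im z)). Qed.
Lemma dotDl x y z : dot (x + y) z = dot x z + dot y z.
Proof. by case: x y z => [a b] [c d] [e f]; rewrite /dot /=; ring. Qed.
Lemma dotZ t x y : dot (t * x) y = dot x (conjc t * y).
Proof. by case: t x y => [a b] [c d] [e f]; rewrite /dot /=; ring. Qed.
Lemma dotr (r : R) x y : dot (r%:C * x) y = r * dot x y.
Proof. by case: x y => [a b] [c d]; rewrite /dot /=; ring. Qed.
Lemma dot0l x : dot 0 x = 0.
Proof. by rewrite /dot !mul0r addr0. Qed.
Lemma dot_ge0 x : 0 <= dot x x.
Proof. by rewrite addr_ge0 // -expr2 sqr_ge0. Qed.
Lemma dot_cmod x : dot x x = cmod x ^+ 2.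
Proof.
by rewrite /dot /cmod normc_def /= sqr_sqrtr ?addr_ge0 ?sqr_ge0// !expr2.
Qed.

Lemma dot_addle x y : dot (x + y) (x + y) <= 2 * dot x x + 2 * dot y y.
Proof.
case: x y => [a b] [c d]; rewrite /dot /=.
by have := sqr_ge0 (a - c); have := sqr_ge0 (b - d); nra.
Qed.

Definition psum (a : nat * V -> R) (N : nat) : R :=
  \sum_(n < N) \sum_v a (val n, v).

Lemma psum_ge0 a N : (forall i, 0 <= a i) -> 0 <= psum a N.
Proof. by move=> a0; apply: sumr_ge0 => n _; apply: sumr_ge0. Qed.

Lemma psumS a N : psum a N.+1 = psum a N + \sum_v a (N, v).
Proof. by rewrite /psum big_ord_recr. Qed.

Lemma psum_homo a : (forall i, 0 <= a i) -> {homo psum a : n m / (n <= m)%N >-> n <= m}.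
Proof.
move=> a0; apply: (@homo_leq _ (psum a) (fun x y => x <= y)) => [x|x y z|N].
- exact: lexx.
- exact: le_trans.
- by rewrite psumS lerDl sumr_ge0.
Qed.

Lemma psum_le a b N : (forall i, a i <= b i) -> psum a N <= psum b N.
Proof. by move=> ab; apply: ler_sum => n _; apply: ler_sum. Qed.

Lemma psumD a b N : psum (fun i => a i + b i) N = psum a N + psum b N.
Proof.
by rewrite /psum -big_split; apply: eq_bigr => n _; rewrite -big_split.
Qed.

Lemma psumM (r : R) a N : psum (fun i => r * a i) N = r * psum a N.
Proof.
by rewrite /psum mulr_sumr; apply: eq_bigr => n _; rewrite mulr_sumr.
Qed.

Lemma eq_psum a b : a =1 b -> psum a = psum b.
Proof. by move=> /funext ->. Qed.

Definition l2p : {pred (nat * V -> R[i])} := fun f =>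
  `[< exists M : R, forall N, psum (fun i => dot (f i) (f i)) N <= M >].

Lemma l2pP (f : nat * V -> R[i]) :
  reflect (exists M : R, forall N, psum (fun i => dot (f i) (f i)) N <= M)
          (f \in l2p).
Proof. exact: asboolP. Qed.

Lemma l2p_submod : submod_closed l2p.
Proof.
split.
  apply/l2pP; exists 0 => N; rewrite /psum big1// => n _.
  by rewrite big1// => v _; rewrite dot0l.
move=> t f g /l2pP[M hM] /l2pP[M' hM']; apply/l2pP.
exists (2 * cmod t ^+ 2 * M + 2 * M') => N.
rewrite (le_trans (y := psum (fun i => 2 * cmod t ^+ 2 * dot (f i) (f i) +
                                       2 * dot (g i) (g i)) N))//.
  apply: psum_le => i.
  have -> : (t *: f + g) i = t * f i + g i by [].
  rewrite -mulrA (_ : cmod t ^+ 2 * _ = dot (t * f i) (t * f i)).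
    exact: dot_addle.
  by rewrite !dot_cmod cmodM exprMn.
rewrite psumD !psumM lerD// ler_wpM2l// mulr_ge0// sqr_ge0//.
Qed.

HB.instance Definition _ :=
  GRing.isSubmodClosed.Build R[i] (nat * V -> R[i])%type l2p l2p_submod.

Record l2 := L2 { l2val : nat * V -> R[i]; _ : l2val \in l2p }.

HB.instance Definition _ := [isSub for l2val].
HB.instance Definition _ := [Choice of l2 by <:].
HB.instance Definition _ := [SubChoice_isSubLmodule of l2 by <:].

Implicit Types f g h : l2.

Lemma l2_psumP f : exists M : R, forall N, psum (fun i => dot (l2val f i) (l2val f i)) N <= M.
Proof. by apply/l2pP; case: f. Qed.

Lemma l2valD f g i : l2val (f + g) i = l2val f i + l2val g i. Proof. by []. Qed.
Lemma l2valZ t f i : l2val (t *: f) i = t * l2val f i. Proof. by []. Qed.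
Lemma l2valB f g i : l2val (f - g) i = l2val f i - l2val g i. Proof. by []. Qed.
Lemma l2val_sum (I : Type) (r : seq I) (Q : pred I) (F : I -> l2) i :
  l2val (\sum_(j <- r | Q j) F j) i = \sum_(j <- r | Q j) l2val (F j) i.
Proof. by elim/big_rec2: _ => // j y a _ <-. Qed.

Lemma l2_eq f g : (forall i, l2val f i = l2val g i) -> f = g.
Proof. by move=> fg; apply/val_inj/funext. Qed.

Definition pdot f g := psum (fun i => dot (l2val f i) (l2val g i)).

Lemma pdot_cvg0 f : cvgn (pdot f f).
Proof.
apply: nondecreasing_is_cvgn; first by apply: psum_homo => i; exact: dot_ge0.
by have [M hM] := l2_psumP f; exists M => _ [n _ <-]; exact: hM.
Qed.

(** Polarization: the partial sums of <f, f> are monotone and bounded, and those of <f, g> combine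
    three sequences of this kind. *)
Lemma pdot_cvg f g : cvgn (pdot f g).
Proof.
have -> : pdot f g = 2^-1 *: (pdot (f + g) (f + g) - pdot f f - pdot g g).
  apply: funext => N; rewrite !fctE /pdot.
  have -> : psum (fun i => dot (l2val (f + g) i) (l2val (f + g) i)) N =
    psum (fun i => dot (l2val f i) (l2val f i) + dot (l2val g i) (l2val g i)
          + 2 * dot (l2val f i) (l2val g i)) N.
    congr psum; apply: funext => i.
    rewrite l2valD dotDl !(dotC _ (_ + _)) !dotDl (dotC (l2val g i) (l2val f i)); ring.
  rewrite (psumD (fun i => dot (l2val f i) (l2val f i) + dot (l2val g i) (l2val g i))).
  rewrite (psumD (fun i => dot (l2val f i) (l2val f i))) psumM /GRing.scale /=.
  by field.
by apply: is_cvgZr; apply: is_cvgB; [apply: is_cvgB|]; exact: pdot_cvg0.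
Qed.

Definition l2ip f g : R := limn (pdot f g).

Lemma l2ipC f g : l2ip f g = l2ip g f.
Proof. by congr (limn _); apply: eq_psum => i; rewrite dotC. Qed.

Lemma l2ipDl f g h : l2ip (f + g) h = l2ip f h + l2ip g h.
Proof.
rewrite /l2ip -limD; [|exact: pdot_cvg..].
congr (limn _); apply: funext => N; rewrite fctE -psumD; congr psum.
by apply: funext => i; rewrite dotDl.
Qed.

Lemma l2ipZ t f g : l2ip (t *: f) g = l2ip f (conjc t *: g).
Proof. by congr (limn _); apply: eq_psum => i; rewrite dotZ. Qed.

Lemma l2ipr r f g : l2ip (r%:C *: f) g = r * l2ip f g.
Proof.
rewrite /l2ip -[RHS]limZr; last exact: pdot_cvg.
congr (limn _); apply: funext => N.
rewrite [RHS](_ : _ = r * pdot f g N)// /pdot -psumM; congr psum.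
by apply: funext => i; rewrite -dotr.
Qed.

Lemma pdot_le f N : pdot f f N <= l2ip f f.
Proof.
apply: nondecreasing_cvgn_le; last exact: pdot_cvg.
by apply: psum_homo => i; exact: dot_ge0.
Qed.

Lemma l2ip_le f M : (forall N, pdot f f N <= M) -> l2ip f f <= M.
Proof. by move=> h; apply: limr_le; [exact: pdot_cvg | exact: nearW]. Qed.

Lemma l2ip_ge0 f : 0 <= l2ip f f.
Proof. by apply: le_trans (pdot_le f 0); rewrite /pdot /psum big_ord0. Qed.

Lemma dot_le_l2ip f i : dot (l2val f i) (l2val f i) <= l2ip f f.
Proof.
case: i => n v; apply: le_trans (pdot_le f n.+1).
rewrite /pdot psumS (bigD1 v) //= ler_wpDl//; first by apply: psum_ge0 => i; exact: dot_ge0.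
by rewrite lerDl sumr_ge0// => w _; exact: dot_ge0.
Qed.

Lemma l2ip_eq0 f : l2ip f f = 0 -> f = 0.
Proof.
move=> h; apply: l2_eq => i; apply/eqP; rewrite -cmod_eq0 -sqrf_eq0 -dot_cmod.
by rewrite eq_le dot_ge0 andbT -h dot_le_l2ip.
Qed.

Lemma cvg_psum (u : nat -> nat * V -> R) (a : nat * V -> R) N :
  (forall i, u ^~ i @ \oo --> a i) -> (fun m => psum (u m) N) @ \oo --> psum a N.
Proof.
move=> ua; rewrite /psum; elim: N => [|N IHN].
  by under eq_fun do rewrite big_ord0; rewrite big_ord0; exact: cvg_cst.
under eq_fun do rewrite big_ord_recr /=; rewrite big_ord_recr /=.
apply: cvgD => //; elim: (index_enum V) => [|v s IHs].
  by under eq_fun do rewrite big_nil; rewrite big_nil; exact: cvg_cst.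
by under eq_fun do rewrite big_cons; rewrite big_cons; exact: cvgD.
Qed.

(** The limit l is taken coordinatewise. The partial sum up to K of |u_n - l|^2 is the limit over m
    of those of |u_n - u_m|^2, so it is at most e^2 for every K. *)
Lemma l2_complete (u : nat -> l2) :
  (forall e : R, 0 < e -> exists N, forall m n, (N <= m)%N -> (N <= n)%N ->
     l2ip (u m - u n) (u m - u n) <= e ^+ 2) ->
  exists l, forall e : R, 0 < e -> exists N, forall n, (N <= n)%N ->
     l2ip (u n - l) (u n - l) <= e ^+ 2.
Proof.
move=> uC.
have /choice[l hl] i : exists z : R[i],
    (fun n => complex.Re (l2val (u n) i)) @ \oo --> complex.Re z /\
    (fun n => complex.Im (l2val (u n) i)) @ \oo --> complex.Im z.
  have [|z [? ? _]] := @Cseq_complete R (fun n => l2val (u n) i); last by exists z.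
  move=> e e0; have [N hN] := uC _ e0; exists N => m n Nm Nn /=.
  rewrite -ler_sqr ?nnegrE ?cmod_ge0 ?(ltW e0)// -dot_cmod -l2valB.
  by rewrite (le_trans (dot_le_l2ip _ _))// hN.
have key e : 0 < e -> exists N, forall n, (N <= n)%N ->
    forall K, psum (fun i => dot (l2val (u n) i - l i) (l2val (u n) i - l i)) K <= e ^+ 2.
  move=> e0; have [N hN] := uC _ e0; exists N => n Nn K.
  have cv : (fun m => pdot (u n - u m) (u n - u m) K) @ \oo -->
      psum (fun i => dot (l2val (u n) i - l i) (l2val (u n) i - l i)) K.
    apply: cvg_psum => i; rewrite /dot /= ; have [hr hi] := hl i.
    rewrite !raddfB /=.
    have -> : (fun x => complex.Re (l2val (u n - u x) i) * complex.Re (l2val (u n - u x) i) +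
       complex.Im (l2val (u n - u x) i) * complex.Im (l2val (u n - u x) i)) =
      (fun x => (complex.Re (l2val (u n) i) - complex.Re (l2val (u x) i)) *
                (complex.Re (l2val (u n) i) - complex.Re (l2val (u x) i)) +
                (complex.Im (l2val (u n) i) - complex.Im (l2val (u x) i)) *
                (complex.Im (l2val (u n) i) - complex.Im (l2val (u x) i))).
      by apply: funext => x; rewrite !l2valB !raddfB.
    by apply: cvgD; apply: cvgM; apply: cvgB => //; exact: cvg_cst.
  rewrite -(cvg_lim _ cv)//; apply: limr_le; first by apply/cvg_ex; eexists; exact: cv.
  by exists N => // m Nm /=; rewrite (le_trans (pdot_le _ _))// hN.
have [N0 hN0] := key 1 ltr01.
(* Square-summability is first known for u_N0 - l, not for l; the limit is therefore written as u_N0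
   - (u_N0 - l). *)
have dl : (fun i => l2val (u N0) i - l i) \in l2p.
  by apply/l2pP; exists (1 ^+ 2) => K; exact: hN0.
exists (u N0 - L2 dl) => e /key[N hN]; exists N => n Nn; apply: l2ip_le => K.
rewrite (le_trans _ (hN n Nn K))// /pdot; apply: psum_le => i.
have -> : l2val (u n - (u N0 - L2 dl)) i = l2val (u n) i - l i.
  by rewrite !l2valB /=; ring.
exact: lexx.
Qed.

Definition l2_hilbert : hilbert R :=
  @Hilbert R l2 l2ip l2ipC l2ipDl l2ipZ l2ipr l2ip_ge0 l2ip_eq0 l2_complete.

End SquareSummable.

(** * A Cuntz-Krieger family with nonzero projections *)

Section Model.
Variables (R : realType) (G : graph).
Hypothesis Gsinks : no_sinks G.
Local Notation V := (vertex G).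
Local Notation H := (l2_hilbert R V).
Local Notation l2 := (l2 R V).

Definition out_edges (v : V) : seq (edge G) := enum [pred f : edge G | src f == v].
Definition out_deg (v : V) : nat := size (out_edges v).
Definition out_index (e : edge G) : nat := index e (out_edges (src e)).

Lemma out_edgesP e v : (e \in out_edges v) = (src e == v).
Proof. by rewrite mem_enum inE. Qed.

Lemma out_index_lt e : (out_index e < out_deg (src e))%N.
Proof. by rewrite index_mem out_edgesP. Qed.

Lemma out_deg_gt0 v : (0 < out_deg v)%N.
Proof.
have [e ev] := Gsinks v; rewrite -has_predT; apply/hasP; exists e => //.
by rewrite out_edgesP ev.
Qed.

Lemma sum_residue (F : nat -> R) d j N : (j < d)%N ->
  \sum_(n < N * d) (if (n %% d == j)%N then F n else 0) = \sum_(n < N) F (n * d + j)%N.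
Proof.
move=> jd; elim: N => [|N IHN]; first by rewrite mul0n !big_ord0.
rewrite big_ord_recr /= -IHN mulSnr big_split_ord /=; congr (_ + _).
rewrite (bigD1 (Ordinal jd)) //= modnMDl modn_small// eqxx big1 ?addr0// => i ij.
by rewrite modnMDl modn_small// ifN.
Qed.

Lemma psum_residue (f g : nat * V -> R[i]) (w : V) d j N : (j < d)%N ->
  psum (fun i => if (i.2 == w) && (i.1 %% d == j)%N then dot (f i) (g i) else 0)
    (N * d) =
  \sum_(n < N) dot (f (n * d + j, w)%N) (g (n * d + j, w)%N).
Proof.
move=> jd; rewrite -(sum_residue (fun n => dot (f (n, w)) (g (n, w)))) //.
apply: eq_bigr => n _; rewrite (bigD1 w) //= eqxx /= big1 ?addr0// => v vw.
by rewrite (negPf vw).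
Qed.

Lemma psum_vertex (f g : nat * V -> R[i]) (w : V) N :
  psum (fun i => if i.2 == w then dot (f i) (g i) else 0) N =
  \sum_(n < N) dot (f (val n, w)) (g (val n, w)).
Proof.
apply: eq_bigr => n _; rewrite (bigD1 w) //= eqxx /= big1 ?addr0// => v vw.
by rewrite (negPf vw).
Qed.

Section Edge.
Variable e : edge G.
Local Notation d := (out_deg (src e)).
Local Notation j := (out_index e).

(** S_e sends the basis vector at (n, r(e)) to the one at (n d + j, s(e)), where d is the out-degree
    of s(e) and j the rank of e among the edges leaving s(e). Edges with a common source thus have
    complementary residue classes as ranges. [shifta] is the adjoint. *)
Definition shiftf (f : nat * V -> R[i]) (i : nat * V) : R[i] :=
  if (i.2 == src e) && (i.1 %% d == j)%N then f (i.1 %/ d, rng e)%N else 0.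
Definition shifta (f : nat * V -> R[i]) (i : nat * V) : R[i] :=
  if i.2 == rng e then f (i.1 * d + j, src e)%N else 0.

(** The adjoint relation is already exact for finite sums when one cut-off is d times the other; the
    norm bounds follow from it too. *)
Lemma psum_shift f g N :
  psum (fun i => dot (shiftf f i) (g i)) (N * d) =
  psum (fun i => dot (f i) (shifta g i)) N.
Proof.
have jd := out_index_lt e; have d0 := out_deg_gt0 (src e).
rewrite [RHS](_ : _ = psum (fun i => if i.2 == rng e then
    dot (f i) (g (i.1 * d + j, src e)%N) else 0) N); last first.
  by congr psum; apply: funext => i; rewrite /shifta; case: ifP => //; rewrite dotC dot0l.
rewrite (psum_vertex f (fun i => g (i.1 * d + j, src e)%N)) /=.
rewrite [LHS](_ : _ = psum (fun i => if (i.2 == src e) && (i.1 %% d == j)%N then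
    dot (f (i.1 %/ d, rng e)%N) (g i) else 0) (N * d)); last first.
  by congr psum; apply: funext => i; rewrite /shiftf; case: ifP => //; rewrite dot0l.
rewrite (psum_residue (fun i => f (i.1 %/ d, rng e)%N))//.
apply: eq_bigr => n _ /=.
by rewrite divnMDl// divn_small// addn0.
Qed.

Lemma psum_deg_le (a : nat * V -> R) N : (forall i, 0 <= a i) -> psum a N <= psum a (N * d) :> R.
Proof.
by move=> a0; apply: psum_homo => //; rewrite leq_pmulr// out_deg_gt0.
Qed.

Lemma shifta_shiftf f i : shifta (shiftf f) i = if i.2 == rng e then f i else 0.
Proof.
have jd := out_index_lt e; have d0 := out_deg_gt0 (src e).
rewrite /shifta /shiftf /= eqxx modnMDl modn_small// eqxx /= divnMDl// divn_small// addn0.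
by case: i => n v /=; case: eqP => // ->.
Qed.

Lemma shiftf_bound f N :
  psum (fun i => dot (shiftf f i) (shiftf f i)) N <= psum (fun i => dot (f i) (f i)) N.
Proof.
apply: (le_trans (psum_deg_le _ _)) => [i|]; first exact: dot_ge0.
rewrite psum_shift; apply: psum_le => i; rewrite shifta_shiftf.
by case: ifP => // _; rewrite dotC dot0l dot_ge0.
Qed.

Lemma shifta_bound f N :
  psum (fun i => dot (shifta f i) (shifta f i)) N <=
  psum (fun i => dot (f i) (f i)) (N * d).
Proof.
rewrite -psum_shift; apply: psum_le => -[n v]; rewrite /shiftf /shifta /=.
have d0 := out_deg_gt0 (src e).
case: ifP => [/andP[/eqP -> /eqP h]|_]; last by rewrite dot0l dot_ge0.
by rewrite eqxx -h -divn_eq.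
Qed.

Lemma shiftf_l2 (f : l2) : shiftf (l2val f) \in @l2p R V.
Proof.
have [M hM] := l2_psumP f; apply/l2pP; exists M => N.
exact: le_trans (shiftf_bound _ _) (hM N).
Qed.

Lemma shifta_l2 (f : l2) : shifta (l2val f) \in @l2p R V.
Proof.
have [M hM] := l2_psumP f; apply/l2pP; exists M => N.
exact: le_trans (shifta_bound _ _) (hM _).
Qed.

Definition l2shift (f : l2) : l2 := L2 (shiftf_l2 f).
Definition l2shifta (f : l2) : l2 := L2 (shifta_l2 f).

Program Definition edge_op : bop H := @Bop R H l2shift l2shifta _ _ _ _.
Next Obligation.
move=> f g /=; rewrite /l2ip.
(* The finite identity concerns cut-offs that are multiples of d, so the limit is taken along that
   subsequence. *)
have <- : pdot (l2shift f) g \o (fun N => N * d)%N = pdot f (l2shifta g).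
  by apply: funext => N; exact: psum_shift.
apply/esym/cvg_lim => //; apply: cvg_comp; last exact: pdot_cvg.
move=> A [N _ NA]; exists N => // n /= Nn; apply: NA => /=.
by rewrite (leq_trans Nn)// leq_pmulr// out_deg_gt0.
Qed.
Next Obligation.
move=> t f; apply: l2_eq => i; rewrite l2valZ /= /shiftf.
by case: ifP; rewrite ?mulr0.
Qed.
Next Obligation.
move=> t f; apply: l2_eq => i; rewrite l2valZ /= /shifta.
by case: ifP; rewrite ?mulr0.
Qed.
Next Obligation.
exists 1; split=> // f; rewrite mul1r ler_wsqrtr//=; apply: l2ip_le => N.
exact: le_trans (shiftf_bound _ _) (pdot_le _ _).
Qed.

End Edge.

Section Vertex.
Variable v : V.

Definition cutf (f : nat * V -> R[i]) (i : nat * V) : R[i] :=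
  if i.2 == v then f i else 0.

Lemma cut_bound f N :
  psum (fun i => dot (cutf f i) (cutf f i)) N <= psum (fun i => dot (f i) (f i)) N.
Proof.
by apply: psum_le => i; rewrite /cutf; case: ifP; rewrite ?dot0l ?dot_ge0.
Qed.

Lemma cut_l2 (f : l2) : cutf (l2val f) \in @l2p R V.
Proof.
have [M hM] := l2_psumP f; apply/l2pP; exists M => N.
exact: le_trans (cut_bound _ _) (hM N).
Qed.

Definition l2cut (f : l2) : l2 := L2 (cut_l2 f).

Program Definition vertex_op : bop H := @Bop R H l2cut l2cut _ _ _ _.
Next Obligation.
move=> f g /=; congr (limn _); apply: eq_psum => i /=; rewrite /cutf.
by case: ifP; rewrite // dot0l dotC dot0l.
Qed.
Next Obligation.
move=> t f; apply: l2_eq => i; rewrite l2valZ /= /cutf.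
by case: ifP; rewrite ?mulr0.
Qed.
Next Obligation.
move=> t f; apply: l2_eq => i; rewrite l2valZ /= /cutf.
by case: ifP; rewrite ?mulr0.
Qed.
Next Obligation.
exists 1; split=> // f; rewrite mul1r ler_wsqrtr//=; apply: l2ip_le => N.
exact: le_trans (cut_bound _ _) (pdot_le _ _).
Qed.

Lemma vertex_op_neq0 : vertex_op <> 0.
Proof.
move=> v0.
have dl : (fun i => if i == (0%N, v) then 1 else 0) \in @l2p R V.
  apply/l2pP; exists 1; case=> [|N]; first by rewrite /psum big_ord0.
  rewrite /psum big_ord_recl (bigD1 v)//= eqxx big1 => [|w wv]; last first.
    by rewrite ifN ?dot0l// xpair_eqE negb_and wv orbT.
  rewrite addr0 big1 ?addr0; last by move=> n _; rewrite big1// => w _; rewrite dot0l.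
  by rewrite /dot /= mulr1 mulr0 addr0.
have := congr1 (fun a : bop H => l2val (opf a (L2 dl)) (0%N, v)) v0.
by rewrite /= /cutf eqxx /= eqxx => /eqP; rewrite oner_eq0.
Qed.

End Vertex.

Lemma bop_val_eq (a b : bop H) :
  (forall (f : l2) i, l2val (opf a f) i = l2val (opf b f) i) -> a = b.
Proof. by move=> h; apply: bop_eq => f; apply: l2_eq => i; exact: h. Qed.

Local Notation B := (bop_cstar H).

Lemma op_initial e : cstar (edge_op e : B) ** (edge_op e : B) = vertex_op (rng e).
Proof. by apply: bop_val_eq => f i /=; rewrite shifta_shiftf. Qed.

Lemma op_final e (f : l2) i :
  l2val (opf ((edge_op e : B) ** cstar (edge_op e : B)) f) i =
  if (i.2 == src e) && (i.1 %% out_deg (src e) == out_index e)%N then l2val f i else 0.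
Proof.
case: i => n v /=; rewrite /shiftf /shifta /=.
by case: ifP => // /andP[/eqP -> /eqP <-]; rewrite eqxx -divn_eq.
Qed.

Lemma op_cuntz_krieger : @cuntz_krieger R G B vertex_op edge_op.
Proof.
have proj v : (vertex_op v : B) ** (vertex_op v : B) = vertex_op v.
  by apply: bop_val_eq => f i /=; rewrite /cutf; case: eqP.
have projs v : cstar (vertex_op v : B) = vertex_op v.
  by apply: bop_val_eq.
have pisom e : (edge_op e : B) ** cstar (edge_op e : B) ** (edge_op e : B) = edge_op e.
  rewrite -cmulA op_initial; apply: bop_val_eq => f i /=; rewrite /shiftf /cutf /=.
  by case: ifP => //; rewrite eqxx.
split=> //.
- move=> u v uv; apply: bop_val_eq => f i /=; rewrite /cutf /=.
  by case: eqP => // iu; case: eqP => // iv; case: uv; rewrite -iu -iv.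
- exact: op_initial.
(* Either the sources differ or the residues do, since [out_index] determines an edge among those
   with the same source. *)
- move=> e f ef; apply: bop_val_eq => g i /=; rewrite /shifta /shiftf /=.
  case: eqP => // ie; case: ifP => // /andP[/eqP se].
  rewrite -se modnMDl modn_small ?out_index_lt// => /eqP ij; case: ef.
  have := nth_index e (_ : e \in out_edges (src e)); rewrite out_edgesP eqxx => <-//.
  rewrite -/(out_index e) ij /out_index -se nth_index//.
  by rewrite out_edgesP se.
- move=> e; apply: cle_proj => //.
  + by rewrite cmulA pisom.
  + by rewrite cstarM cstarK.
  + apply: bop_val_eq => f i.
    rewrite -[LHS]/(cutf (src e) (l2val (opf ((edge_op e : B) **
      cstar (edge_op e : B)) f)) i) /cutf op_final.
    by case: eqP.
- move=> v _; apply: bop_val_eq => f i.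
  rewrite opf_sum l2val_sum; under eq_bigr do rewrite op_final.
  rewrite /= /cutf; case: eqP => [iv|iv]; last first.
    by rewrite big1// => e /eqP ev; case: ifP => // /andP[/eqP]; rewrite ev.
  have lt : (i.1 %% out_deg v < out_deg v)%N by rewrite ltn_mod out_deg_gt0.
  have [e0 _] := Gsinks v.
  (* The one edge leaving v whose residue class contains the first coordinate of i; only its term of
     the sum survives. *)
  pose e := nth e0 (out_edges v) (i.1 %% out_deg v).
  have ev : src e = v by apply/eqP; rewrite -out_edgesP mem_nth.
  have ei : out_index e = (i.1 %% out_deg v)%N.
    by rewrite /out_index ev index_uniq// enum_uniq.
  rewrite (bigD1 e) ?ev//= iv ei !eqxx /= big1 ?addr0// => f' /andP[/eqP fv fe].
  case: ifP => // /andP[_ /eqP h]; case/negP: fe; apply/eqP.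
  have ff : f' \in out_edges v by rewrite out_edgesP fv.
  rewrite fv in h.
  by rewrite -(nth_index e0 ff) /e h /out_index fv.
Qed.

End Model.

Lemma exists_cuntz_krieger (R : realType) (G : graph) : no_sinks G ->
  exists (B : cstarAlgebra R) (Q : vertex G -> B) (T : edge G -> B),
    cuntz_krieger Q T /\ forall v, Q v <> 0.
Proof.
move=> Gsinks; exists (bop_cstar (l2_hilbert R (vertex G))).
exists (@vertex_op R G), (edge_op R Gsinks); split.
  exact: op_cuntz_krieger.
exact: vertex_op_neq0.
Qed.

(** * Norm estimates in C*-algebras *)

Section Norm.
Variables (R : realType) (A : cstarAlgebra R).
Implicit Types a b c : A.

Definition nrm a : R := complex.Re `|a|.

Lemma nrmE a : `|a| = (nrm a)%:C.
Proof.
rewrite /nrm; have := normr_ge0 a.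
by case: `|a| => x y; rewrite lecE /= => /andP[/eqP ->].
Qed.

Lemma nrm_le a (r : R) : (nrm a <= r) = (`|a| <= r%:C).
Proof. by rewrite nrmE lecR. Qed.
Lemma nrm_ge0 a : 0 <= nrm a.
Proof. by rewrite -lecR -nrmE normr_ge0. Qed.
Lemma nrmD a b : nrm (a + b) <= nrm a + nrm b.
Proof. by rewrite nrm_le rmorphD /= -!nrmE ler_normD. Qed.
Lemma nrmN a : nrm (- a) = nrm a.
Proof. by rewrite /nrm normrN. Qed.
Lemma nrmB a b : nrm (a - b) <= nrm a + nrm b.
Proof. by rewrite -(nrmN b) nrmD. Qed.
Lemma nrmBC a b : nrm (a - b) = nrm (b - a).
Proof. by rewrite -nrmN opprB. Qed.
Lemma nrmZ t a : nrm (t *: a) = cmod t * nrm a.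
Proof. by apply: complexI; rewrite rmorphM /= -nrmE -cmodE normrZ nrmE. Qed.
Lemma nrm0 : nrm 0 = 0.
Proof. by rewrite /nrm normr0. Qed.
Lemma nrm_eq0 a : nrm a = 0 -> a = 0.
Proof. by move=> h; apply/eqP; rewrite -normr_eq0 nrmE h. Qed.
Lemma nrmM a b : nrm (cmul a b) <= nrm a * nrm b.
Proof. by rewrite nrm_le rmorphM /= -!nrmE cmul_norm. Qed.
Lemma nrm_cstar2 a : nrm (cmul (cstar a) a) = nrm a ^+ 2.
Proof. by apply: complexI; rewrite rmorphXn /= -!nrmE cstar_norm. Qed.
Lemma nrm_cstar_le a : nrm a <= nrm (cstar a).
Proof.
have [->|a0] := eqVneq (nrm a) 0; first exact: nrm_ge0.
have p0 : 0 < nrm a by rewrite lt_neqAle eq_sym a0 nrm_ge0.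
by rewrite -(ler_pM2r p0) -expr2 -nrm_cstar2 nrmM.
Qed.
Lemma nrm_cstar a : nrm (cstar a) = nrm a.
Proof. by apply/eqP; rewrite eq_le nrm_cstar_le -{2}(cstarK a) nrm_cstar_le. Qed.
Lemma nrm_trans b a c : nrm (a - c) <= nrm (a - b) + nrm (b - c).
Proof. by rewrite (le_trans _ (nrmD _ _))// addrA subrK. Qed.

Lemma le0_of_small (r c : R) : (forall e : R, 0 < e -> r <= e * c) -> r <= 0.
Proof.
move=> h; apply/ler_addgt0Pr => e e0; rewrite add0r.
have p0 : 0 < `|c| + 1 by rewrite ltr_wpDl.
rewrite (le_trans (h _ (divr_gt0 e0 p0)))//.
rewrite mulrAC ler_pdivrMr// ler_pM2l// (le_trans (ler_norm c))//.
by rewrite lerDl.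
Qed.

Lemma nrm_small_eq a b (c : R) :
  (forall e : R, 0 < e -> nrm (a - b) <= e * c) -> a = b.
Proof.
move=> /le0_of_small h; apply/eqP; rewrite -subr_eq0; apply/eqP/nrm_eq0/eqP.
by rewrite eq_le h nrm_ge0.
Qed.

Lemma closed_nrmP (D : set A) :
  closed D <-> forall a, (forall e : R, 0 < e -> exists2 d, D d & nrm (a - d) <= e) -> D a.
Proof.
split=> [cD a h|h a clDa].
  apply: cD => B /nbhs_ballP[e /= e0 eB].
  have [eE {}e0] := ltcR0 e0; have [d Dd ad] := h _ (divr_gt0 e0 (ltr0n R 2)).
  exists d; split=> //; apply: eB; rewrite -ball_normE /= nrmE eE ltcR.
  by rewrite (le_lt_trans ad)// ltr_pdivrMr// ltr_pMr// ltr1n.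
apply: h => e e0; have e0' : 0 < e%:C by rewrite ltcR.
have /clDa[d [Dd]] : nbhs a (ball a e%:C) by exact: nbhsx_ballx.
rewrite -ball_normE /= => ad; exists d => //.
by rewrite nrm_le ltW.
Qed.

Lemma nrm_complete (u : nat -> A) :
  (forall e : R, 0 < e -> exists N, forall m n, (N <= m)%N -> (N <= n)%N ->
     nrm (u m - u n) <= e) ->
  exists l, forall e : R, 0 < e -> exists N, forall n, (N <= n)%N -> nrm (u n - l) <= e.
Proof.
move=> h.
have /cauchy_cvgP/cvg_ex[l ul] : cauchy (u @ \oo).
  apply: cauchy_exP => e /ltcR0[-> e0].
  have [N hN] := h _ (divr_gt0 e0 (ltr0n R 2)).
  exists (u N); exists N => // n Nn /=; rewrite -ball_normE /= nrmE ltcR.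
  by rewrite (le_lt_trans (hN _ _ (leqnn _) Nn))// ltr_pdivrMr// ltr_pMr// ltr1n.
exists l => e e0; have e0' : 0 < e%:C by rewrite ltcR.
move/cvgrPdist_lt : ul => /(_ _ e0')[N _ hN]; exists N => n /hN /= /ltW.
by rewrite -nrm_le nrmBC.
Qed.

Definition nrm_limit (u : nat -> A) (l : A) :=
  forall e : R, 0 < e -> exists N, forall n, (N <= n)%N -> nrm (u n - l) <= e.

Lemma closed_limit (D : set A) u l : closed D -> (forall n, D (u n)) ->
  nrm_limit u l -> D l.
Proof.
move=> /closed_nrmP cD Du ul; apply: cD => e /ul[N hN].
by exists (u N) => //; rewrite nrmBC hN.
Qed.

Lemma subalgB (D : set A) a b : cstar_subalgebra D -> D a -> D b -> D (a - b).
Proof.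
move=> sD Da Db; apply: subalgD => //.
by rewrite -scaleN1r; apply: subalgZ.
Qed.

Lemma subalg_sum (D : set A) (I : Type) (r : seq I) (Q : pred I) (F : I -> A) :
  cstar_subalgebra D -> (forall i, Q i -> D (F i)) -> D (\sum_(i <- r | Q i) F i).
Proof.
by move=> sD DF; apply: big_ind => //; [exact: subalg0 | exact: subalgD].
Qed.

Lemma nrm_proj_le1 a : cmul a a = a -> cstar a = a -> nrm a <= 1.
Proof.
move=> aa sa; have := nrm_cstar2 a; rewrite sa aa => e.
have := nrm_ge0 a; move: e; set x := nrm a => e x0; nra.
Qed.

Lemma subalgT : cstar_subalgebra (setT : set A).
Proof. by split=> //; exact: closedT. Qed.

End Norm.

(** * Unitaries, and boundedness of characters and homomorphisms *)

Section Unital.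
Variables (R : realType) (A : cstarAlgebra R) (one : A).
Hypotheses (cmul1 : forall a, cmul a one = a) (c1mul : forall a, cmul one a = a).
Implicit Types a b c h w : A.

Lemma cstar1 : cstar one = one.
Proof. by rewrite -[LHS]cmul1 -{2}(cstarK one) -cstarM cmul1 cstarK. Qed.

Lemma nrm_isometry w : cmul (cstar w) w = one -> nrm w <= 1.
Proof.
move=> ww; rewrite -(@ler_pXn2r _ 2) ?nnegrE ?nrm_ge0// expr1n -nrm_cstar2 ww.
by apply: nrm_proj_le1; rewrite ?cmul1 ?cstar1.
Qed.

Section Sqrt.
Variables (D : set A) (h : A).
Hypotheses (sD : cstar_subalgebra D) (D1 : D one) (Dh : D h).
Hypotheses (hs : cstar h = h) (h2 : nrm h <= 2^-1).

Local Notation a := (cmul h h).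
Let half : R[i] := (2^-1 : R)%:C.

(* If [y] is a fixed point then [1 - y] is a square root of [1 - h ^ 2]. *)
Let step y : A := half *: (a + cmul y y).
Fixpoint sqrt_seq (n : nat) : A := if n is n'.+1 then step (sqrt_seq n') else 0.

Let cmod_half : cmod half = 2^-1.
Proof. by rewrite cmod_real ger0_norm// invr_ge0. Qed.

Let half_D (x : A) : half *: (x + x) = x.
Proof.
rewrite -mulr2n -scaler_nat scalerA -(rmorph_nat (real_complex R)) -rmorphM.
by rewrite mulVf ?scale1r// pnatr_eq0.
Qed.

Let nrm_a : nrm a <= 4^-1.
Proof.
rewrite (le_trans (nrmM _ _))//; have := nrm_ge0 h; move: h2; set x := nrm h => x2 x0; nra.
Qed.

(** Twice [step y - step z] is y (y - z) + (y - z) z, which holds without commutativity. *)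
Let step_dist y z (r : R) : nrm y <= r -> nrm z <= r ->
  nrm (step y - step z) <= r * nrm (y - z).
Proof.
move=> yr zr; rewrite /step -scalerBr nrmZ cmod_half.
rewrite (_ : a + cmul y y - (a + cmul z z) = cmul y (y - z) + cmul (y - z) z); last first.
  by rewrite cmulBr cmulBl addrA subrK opprD addrACA subrr add0r.
have := nrmD (cmul y (y - z)) (cmul (y - z) z).
have := nrmM y (y - z); have := nrmM (y - z) z; have := nrm_ge0 (y - z).
move: (nrm (_ + _)) (nrm (cmul _ _)) (nrm (cmul _ _)) (nrm (y - z)) yr zr.
by move: (nrm y) (nrm z) => p q s t u v pr qr; nra.
Qed.

(** The ball of radius 1/4 is stable because (1/4 + 1/16)/2 < 1/4, the first 1/4 being the bound on
    h^2. *)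
Lemma sqrt_seq_le n : nrm (sqrt_seq n) <= 4^-1.
Proof.
elim: n => [|n IHn] /=; first by rewrite nrm0 invr_ge0.
rewrite /step nrmZ cmod_half.
have := nrmD a (cmul (sqrt_seq n) (sqrt_seq n)); have := nrmM (sqrt_seq n) (sqrt_seq n).
have := nrm_ge0 (sqrt_seq n).
move: nrm_a IHn; move: (nrm (_ + _)) (nrm a) (nrm (cmul _ _)) (nrm _) => p q s t; nra.
Qed.

(** The contraction factor 1/4 gives geometric decay; the weaker bound 1/(n+1) passes through the
    induction since n + 2 <= 4 (n + 1). *)
Lemma sqrt_seq_cauchy n k : nrm (sqrt_seq (n + k) - sqrt_seq n) <= n.+1%:R^-1.
Proof.
elim: n => [|n IHn]; first by rewrite subr0 (le_trans (sqrt_seq_le _))// invr1 invf_le1// ler1n.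
rewrite addSn /= (le_trans (step_dist (sqrt_seq_le _) (sqrt_seq_le _)))//.
rewrite (le_trans (ler_wpM2l _ IHn)) ?invr_ge0//.
rewrite -invfM lef_pV2 ?posrE ?mulr_gt0// -natrM ler_nat.
by rewrite mulnS -addn2 addnC leq_add// leq_pmull.
Qed.

Lemma sqrt_seq_props n : [/\ D (sqrt_seq n), cstar (sqrt_seq n) = sqrt_seq n &
   cmul h (sqrt_seq n) = cmul (sqrt_seq n) h].
Proof.
elim: n => [|n [IHD IHs IHc]] /=.
  by split; [exact: subalg0 | exact: cstar0 | rewrite cmul0 c0mul].
split.
- by apply: subalgZ => //; apply: subalgD => //; exact: subalgM.
- by rewrite /step cstarZ conjc_real cstarD !cstarM hs IHs.
- rewrite /step cmulZr cmulZl cmulDr cmulDl !cmulA; congr (_ *: (_ + _)).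
  by rewrite IHc -cmulA IHc cmulA.
Qed.

(** The iterates are polynomials in h, so they lie in D, are self-adjoint and commute with h. All
    this passes to their limit y, and v = 1 - y. *)
Lemma exists_sqrt : exists v, [/\ D v, cstar v = v, cmul h v = cmul v h &
  cmul v v = one - a].
Proof.
have [|y yl] := @nrm_complete R A sqrt_seq.
  move=> e e0; have [N hN] := pos_small (divr_gt0 e0 (ltr0n R 2)).
  exists N => m n Nm Nn; rewrite (le_trans (nrm_trans (sqrt_seq N) _ _))//.
  rewrite (nrmBC _ (sqrt_seq n)) [e]splitr lerD// (le_trans _ (ltW hN))//.
    by rewrite -(subnKC Nm) sqrt_seq_cauchy.
  by rewrite -(subnKC Nn) sqrt_seq_cauchy.
have Dy : D y.
  apply: closed_limit (subalg_topclosed sD) _ yl => n.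
  by have [] := sqrt_seq_props n.
have ys : cstar y = y.
  apply: (@nrm_small_eq _ _ _ _ 2) => e /yl[N /(_ _ (leqnn N)) hN].
  have [_ sN _] := sqrt_seq_props N.
  rewrite (le_trans (nrm_trans (sqrt_seq N) _ _))// -{1}sN -cstarB nrm_cstar.
  by rewrite nrmBC mulr_natr mulr2n lerD.
have yh : cmul h y = cmul y h.
  apply: (@nrm_small_eq _ _ _ _ (2 * nrm h)) => e /yl[N /(_ _ (leqnn N)) hN].
  have [_ _ sN] := sqrt_seq_props N.
  rewrite (le_trans (nrm_trans (cmul h (sqrt_seq N)) _ _))// {2}sN -cmulBr -cmulBl.
  rewrite mulrCA mulr_natl mulr2n lerD//.
    by rewrite (le_trans (nrmM _ _))// mulrC ler_wpM2r ?nrm_ge0// nrmBC.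
  by rewrite (le_trans (nrmM _ _))// ler_wpM2r ?nrm_ge0.
have y1 : nrm y <= 1.
  have [|N /(_ _ (leqnn N)) hN] := yl 2^-1; first by rewrite invr_gt0.
  have := nrm_trans (sqrt_seq N) y 0; rewrite !subr0 nrmBC.
  by have := sqrt_seq_le N; move: hN; lra.
have yf : step y = y.
  apply: (@nrm_small_eq _ _ _ _ 2) => e /yl[N hN].
  rewrite (le_trans (nrm_trans (sqrt_seq N.+1) _ _))// mulr_natr mulr2n.
  (* The radius is 1 here, the bound established for the limit y. *)
  rewrite lerD ?hN// (le_trans (@step_dist _ _ 1 _ _))//.
    by rewrite (le_trans (sqrt_seq_le N))//; lra.
  by rewrite mul1r nrmBC hN.
exists (one - y); split.
- exact: subalgB.
- by rewrite cstarB cstar1 ys.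
- by rewrite cmulBr cmulBl cmul1 c1mul yh.
- rewrite cmulBr !cmulBl !cmul1 c1mul.
  have : y + y = a + cmul y y by rewrite -[a + _]half_D scalerDr -/(step y) yf.
  move=> e; rewrite (_ : a = y + y - cmul y y); last by rewrite e addrK.
  by rewrite -!addrA; congr (_ + _); rewrite [RHS]opprD.
Qed.

(** w = h + i sqrt(1 - h^2), that is cos t + i sin t with h in the role of cos t. *)
Lemma unitary_dilation : exists w, [/\ D w, cmul (cstar w) w = one,
  cmul w (cstar w) = one & w + cstar w = 2%:R *: h].
Proof.
have [v [Dv vs vh vv]] := exists_sqrt.
have ii : conjc ('i%C : R[i]) * 'i%C = 1.
  by apply/eqP; rewrite eq_complex /=; apply/andP; split; apply/eqP; ring.
have ic : conjc ('i%C : R[i]) = - 'i%C by apply/eqP; rewrite eq_complex /= oppr0 !eqxx.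
exists (h + 'i%C *: v); split.
- by apply: subalgD => //; apply: subalgZ.
- rewrite cstarD cstarZ hs vs cmulDl !cmulDr !(cmulZl, cmulZr) vv vh scalerA ii ic.
  by rewrite scale1r scaleNr addrA addrK addrC subrK.
- rewrite cstarD cstarZ hs vs cmulDl !cmulDr !(cmulZl, cmulZr) vv vh scalerA ii ic.
  by rewrite scale1r scaleNr addrA subrK addrC subrK.
- by rewrite cstarD cstarZ hs vs ic scaleNr addrACA subrr addr0 scaler_nat mulr2n.
Qed.

End Sqrt.

Section Contractive.
Variables (D : set A) (N : A -> R).
Hypotheses (sD : cstar_subalgebra D) (D1 : D one).
Hypothesis (ND : forall a b, D a -> D b -> N (a + b) <= N a + N b).
Hypothesis (NZ : forall t a, D a -> N (t *: a) = cmod t * N a).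
Hypothesis (NU : forall w, D w -> cmul (cstar w) w = one -> N w <= 1).

(* A selfadjoint element of norm at most 1/2 is half the sum of a unitary
   and its adjoint, so a seminorm is bounded once it is bounded on unitaries. *)
Lemma seminorm_bound h : D h -> cstar h = h -> N h <= 2 * nrm h.
Proof.
move=> Dh hs; have [h0|h0] := eqVneq (nrm h) 0.
  rewrite (nrm_eq0 h0) nrm0 -(scale0r (0 : A)) NZ ?cmod_real ?normr0 ?mul0r ?mulr0//.
  exact: subalg0.
have p0 : 0 < nrm h by rewrite lt_neqAle eq_sym h0 nrm_ge0.
(* Rescales h to norm 1/2, as the square root requires. *)
pose r : R := (2 * nrm h)^-1; have r0 : 0 < r by rewrite invr_gt0 mulr_gt0.
have rh : nrm (r%:C *: h) <= 2^-1.
  by rewrite nrmZ cmod_real gtr0_norm// /r invfM mulfVK.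
have [||w [Dw ww wws wh]] := @unitary_dilation D (r%:C *: h) sD D1 _ _ rh.
- exact: subalgZ.
- by rewrite cstarZ conjc_real hs.
have Dws : D (cstar w) by exact: subalgS.
have wws' : cmul (cstar (cstar w)) (cstar w) = one by rewrite cstarK.
have := ND Dw Dws; rewrite wh scalerA NZ// cmodM cmod_real (gtr0_norm r0).
have -> : cmod (2%:R : R[i]) = 2 by rewrite -(rmorph_nat (real_complex R)) cmod_real ger0_norm.
have := NU Dw ww; have := NU Dws wws' => h1 h2 h3.
have : 2 * r * N h <= 2 by lra.
by rewrite /r invfM mulrA mulfV ?pnatr_eq0// mul1r mulrC ler_pdivrMr.
Qed.

End Contractive.

Lemma character1 (D : set A) chi : D one -> character_on D chi -> chi one = 1.
Proof.
move=> D1 hc; have [a Da /eqP a0] := char_neq0 hc.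
by apply: (mulIf a0); rewrite mul1r -(Defs.charM hc)// c1mul.
Qed.

(** A unitary w has |chi(w)|^2 = chi(w* w) = 1, which bounds chi on self-adjoint elements; then
    |chi(a)|^2 = chi(a* a) handles the others. *)
Lemma character_bound (D : set A) chi a : cstar_subalgebra D -> D one ->
  character_on D chi -> D a -> cmod (chi a) <= 2 * nrm a.
Proof.
move=> sD D1 hc Da.
have key h : D h -> cstar h = h -> cmod (chi h) <= 2 * nrm h.
  move=> Dh hs; apply: (seminorm_bound (N := fun x => cmod (chi x)) sD D1) => //.
  - by move=> x y Dx Dy; rewrite (charD hc)// cmodD.
  - by move=> t x Dx; rewrite (charZ hc)// cmodM.
  - move=> w Dw ww; rewrite -(@ler_pXn2r _ 2) ?nnegrE ?cmod_ge0// expr1n.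
    rewrite -lecR -mul_conjc -(charS hc)// -(Defs.charM hc) ?ww ?(character1 D1 hc)//.
    exact: subalgS.
rewrite -(@ler_pXn2r _ 2) ?nnegrE ?cmod_ge0 ?mulr_ge0 ?nrm_ge0//.
have Ds : D (cstar a) by exact: subalgS.
have -> : cmod (chi a) ^+ 2 = cmod (chi (cmul (cstar a) a)).
  rewrite (Defs.charM hc)// (charS hc)// mul_conjc cmod_real ger0_norm// sqr_ge0//.
rewrite (le_trans (key _ _ _))//; first exact: subalgM.
  by rewrite cstarM cstarK.
by rewrite nrm_cstar2 exprMn ler_wpM2r ?sqr_ge0//; lra.
Qed.

(** The target may lack a unit, but the image of the unit is a projection, hence of norm at most 1;
    this bounds f on unitaries. *)
Lemma star_hom_bound (B : cstarAlgebra R) (f : A -> B) a :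
  star_hom f -> nrm (f a) <= 2 * nrm a.
Proof.
move=> hf.
have key h : cstar h = h -> nrm (f h) <= 2 * nrm h.
  move=> hs.
  apply: (seminorm_bound (D := setT) (N := fun x => nrm (f x)) (subalgT A)) => //.
  - by move=> x y _ _; rewrite (star_homD hf) nrmD.
  - by move=> t x _; rewrite (star_homZ hf) nrmZ.
  - move=> w _ ww; rewrite -(@ler_pXn2r _ 2) ?nnegrE ?nrm_ge0// expr1n.
    rewrite -nrm_cstar2 -(star_homS hf) -(star_homM hf) ww.
    apply: nrm_proj_le1; first by rewrite -(star_homM hf) cmul1.
    by rewrite -(star_homS hf) cstar1.
rewrite -(@ler_pXn2r _ 2) ?nnegrE ?nrm_ge0 ?mulr_ge0 ?nrm_ge0//.
rewrite -nrm_cstar2 -(star_homS hf) -(star_homM hf) (le_trans (key _ _))//.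
  by rewrite cstarM cstarK.
by rewrite nrm_cstar2 exprMn ler_wpM2r ?sqr_ge0//; lra.
Qed.

End Unital.

Lemma star_homN (R : realType) (A B : cstarAlgebra R) (f : A -> B) a :
  star_hom f -> f (- a) = - f a.
Proof. by move=> hf; rewrite -scaleN1r (star_homZ hf) scaleN1r. Qed.
Lemma star_homB (R : realType) (A B : cstarAlgebra R) (f : A -> B) a b :
  star_hom f -> f (a - b) = f a - f b.
Proof. by move=> hf; rewrite (star_homD hf) star_homN. Qed.
Lemma star_hom0 (R : realType) (A B : cstarAlgebra R) (f : A -> B) :
  star_hom f -> f 0 = 0.
Proof. by move=> hf; rewrite -(scale0r 0) (star_homZ hf) scale0r. Qed.
Lemma star_hom_sum (R : realType) (A B : cstarAlgebra R) (f : A -> B)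
    (I : Type) (r : seq I) (Q : pred I) (F : I -> A) : star_hom f ->
  f (\sum_(i <- r | Q i) F i) = \sum_(i <- r | Q i) f (F i).
Proof.
move=> hf; elim/big_rec2: _ => [|i x y _ <-]; first exact: star_hom0.
by rewrite (star_homD hf).
Qed.

(** * Finite paths and lifts to the permutation graph *)

Section GraphPaths.
Variable G : graph.
Implicit Types (e f : edge G) (u v : vertex G).

Lemma gpath_eq l (p q : gpath G l) :
  psrc p = psrc q -> tval (pedges p) = tval (pedges q) -> p = q.
Proof.
case: p q => -[u s] ws [[v t] wt]; rewrite /psrc /pedges /= => uv /val_inj st.
by apply: val_inj => /=; rewrite uv st.
Qed.

Lemma walk_psrc l (p : gpath G l) : walk (psrc p) (pedges p).
Proof. by case: p. Qed.

Lemma pedgesE l (p : gpath G l.+1) : tval (pedges p) = phead p :: pedges (ptail p).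
Proof. by case: p => -[v t] /=; rewrite /phead /pedges /=; case/tupleP: t => e t. Qed.

Lemma pedges_front l (p : gpath G l.+1) :
  tval (pedges p) = rcons (pedges (pfront p)) (plast p).
Proof. by rewrite pedgesE /plast lastI. Qed.

Lemma psrc_head l (p : gpath G l.+1) : psrc p = src (phead p).
Proof. by have := walk_psrc p; rewrite pedgesE /= => /andP[/eqP]. Qed.

Lemma psrc_tail l (p : gpath G l.+1) : psrc (ptail p) = rng (phead p).
Proof. by []. Qed.

Lemma psrc_front l (p : gpath G l.+1) : psrc (pfront p) = psrc p.
Proof. by []. Qed.

Lemma prng_front l (p : gpath G l.+1) : prng (pfront p) = src (plast p).
Proof.
by have := walk_psrc p; rewrite pedges_front walk_rcons => /andP[_ /eqP ->].
Qed.

Lemma prng_last l (p : gpath G l.+1) : prng p = rng (plast p).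
Proof. by rewrite /prng pedges_front map_rcons last_rcons. Qed.

Lemma prng_tail l (p : gpath G l.+1) : prng (ptail p) = prng p.
Proof. by rewrite {2}/prng pedgesE. Qed.

Lemma gpath_consP l (p q : gpath G l.+1) :
  phead p = phead q -> ptail p = ptail q -> p = q.
Proof. by move=> h t; apply: gpath_eq; rewrite ?psrc_head ?pedgesE h ?t. Qed.

Lemma gpath_rconsP l (p q : gpath G l.+1) :
  pfront p = pfront q -> plast p = plast q -> p = q.
Proof.
move=> h t; apply: gpath_eq; first by rewrite -psrc_front h.
by rewrite !pedges_front h t.
Qed.

Lemma exists_pcons l e (a : gpath G l) : psrc a = rng e ->
  exists p : gpath G l.+1, [/\ phead p = e & ptail p = a].
Proof.
move=> ae; have w : walk (src e) [tuple of e :: pedges a].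
  by rewrite /= eqxx -ae walk_psrc.
exists (@GPath G l.+1 (src e, _) w); split; first by [].
by apply: gpath_eq; rewrite ?ae.
Qed.

Lemma exists_prcons l f (b : gpath G l) : src f = prng b ->
  exists p : gpath G l.+1, [/\ pfront p = b & plast p = f].
Proof.
move=> bf; have w : walk (psrc b) [tuple of rcons (pedges b) f].
  by rewrite walk_rcons walk_psrc bf eqxx.
pose p := @GPath G l.+1 (psrc b, _) w.
have /eqP : rcons (pedges (pfront p)) (plast p) = rcons (pedges b) f.
  by rewrite -pedges_front.
rewrite eqseq_rcons => /andP[/eqP bb /eqP ff].
by exists p; split=> //; apply: gpath_eq.
Qed.

Lemma exists_gpath l v : no_sinks G -> exists p : gpath G l, psrc p = v.
Proof.
move=> Gs; elim: l v => [|l IHl] v.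
  by exists (@GPath G 0 (v, [tuple]) isT).
have [e <-] := Gs v; have [a /exists_pcons[p [<- _]]] := IHl (rng e).
by exists p; rewrite psrc_head.
Qed.

Lemma walk_mkseq (z : nat -> edge G) n v :
  ((0 < n)%N -> src (z 0%N) = v) ->
  (forall i, (i.+1 < n)%N -> rng (z i) = src (z i.+1)) -> walk v (mkseq z n).
Proof.
elim: n z v => // n IHn z v zv zz; rewrite /mkseq /= zv// eqxx /=.
rewrite (iotaDl 1 0) -map_comp; apply: (IHn (z \o S)) => /= [n0|i ni].
  by rewrite zz.
exact: zz.
Qed.

(** Serves for paths of G and also for paths of the permutation graph, whose edges are themselves
    paths. The source v is free when n = 0. *)
Lemma exists_mkseq (z : nat -> edge G) n v :
  ((0 < n)%N -> src (z 0%N) = v) ->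
  (forall i, (i.+1 < n)%N -> rng (z i) = src (z i.+1)) ->
  exists p : gpath G n, psrc p = v /\ tval (pedges p) = mkseq z n.
Proof.
move=> zv zz; have w := walk_mkseq zv zz.
have s : size (mkseq z n) == n by rewrite size_mkseq.
by exists (@GPath G n (v, Tuple s) w).
Qed.

Lemma exists_prefix (z : nat -> edge G) n : infinite_paths G z ->
  exists p : gpath G n, is_prefix p z.
Proof.
by move=> zp; apply: exists_mkseq => // i _; exact: zp.
Qed.

Lemma prefix_inj n (p q : gpath G n) z : is_prefix p z -> is_prefix q z -> p = q.
Proof. by move=> [p1 p2] [q1 q2]; apply: gpath_eq; rewrite ?p1 ?p2. Qed.

Lemma endpoint_fixingP l (tau : {perm gpath G l}) : endpoint_fixing tau <->
  forall p, psrc (tau p) = psrc p /\ prng (tau p) = prng p.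
Proof.
split=> [h p|h u v].
  have : tau p \in [set tau p | p in paths_between l (psrc p) (prng p)]%SET.
    by apply: imset_f; rewrite inE !eqxx.
  by rewrite h inE => /andP[/eqP -> /eqP ->].
apply/setP => q; apply/imsetP/idP => [[p] |].
  by rewrite !inE => /andP[/eqP pu /eqP pv] ->; have [-> ->] := h p; rewrite pu pv !eqxx.
rewrite inE => /andP[/eqP qu /eqP qv]; exists (tau^-1 q)%g; last by rewrite permKV.
by have [] := h (tau^-1 q)%g; rewrite permKV inE => <- <-; rewrite qu qv !eqxx.
Qed.

Lemma endpoint_fixingV l (tau : {perm gpath G l}) : endpoint_fixing tau ->
  endpoint_fixing tau^-1%g.
Proof.
move/endpoint_fixingP => h; apply/endpoint_fixingP => p.
by have [] := h (tau^-1 p)%g; rewrite permKV => -> ->.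
Qed.

End GraphPaths.

Section Lifts.
Variables (G : graph) (k : nat) (tau : {perm gpath G k.+1}).
Hypotheses (Gsinks : no_sinks G) (tauE : endpoint_fixing tau).
Local Notation psrcE p := (proj1 ((endpoint_fixingP tau).1 tauE p)).

Definition tpath (w : nat -> gpath G k.+1) :=
  forall i, ptail (w i) = pfront (tau (w i.+1)).

(** Synchronization for sequences of edges instead of the dependent type of paths. The edges [w 0],
    ..., [w m] are m + 1 in number, one more than in [synchronizing1]. *)
Definition syncing (m : nat) := forall w w' : nat -> gpath G k.+1,
  (forall i, (i < m)%N -> ptail (w i) = pfront (tau (w i.+1))) ->
  (forall i, (i < m)%N -> ptail (w' i) = pfront (tau (w' i.+1))) ->
  (forall i, (i <= m)%N -> phead (w i) = phead (w' i)) ->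
  pfront (tau (w 0%N)) = pfront (tau (w' 0%N)).

Lemma synchronizing1P : synchronizing1 tau -> exists m, syncing m.
Proof.
move=> [m sync]; exists m => w w' hw hw' ww'.
have ex (v : nat -> gpath G k.+1) :
    (forall i, (i < m)%N -> ptail (v i) = pfront (tau (v i.+1))) ->
    exists p : gpath (perm_graph tau) m, psrc p = pfront (tau (v 0%N)) /\
      tval (pedges p) = mkseq v m.
  by move=> hv; apply: (@exists_mkseq (perm_graph tau)) => // i im; apply: hv; exact: ltnW.
have [p [ps pe]] := ex _ hw; have [q [qs qe]] := ex _ hw'.
rewrite -ps -qs; apply: sync; rewrite pe qe /mkseq -!map_comp.
apply/eq_in_map => i; rewrite mem_iota => /andP[_ im].
by rewrite /= /label1 ww'// ltnW.
Qed.

(** This is why the first labels along a path of the permutation graph compose in G: a vertex starts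
    where the first label of any edge leaving it starts. *)
Lemma psrc_front_tau p : psrc (pfront (tau p)) = src (phead p).
Proof. by rewrite psrc_front (psrcE p) psrc_head. Qed.

(** The edge e alpha ends in alpha, so a vertex alpha has exactly one incoming edge with first label
    e whenever r(e) = s(alpha). A finite lift is built backwards from an arbitrary last edge;
    infinite lifts are where synchronization enters. *)
Lemma finite_lift N x : infinite_paths G x -> exists w : nat -> gpath G k.+1,
  (forall i, (i < N)%N -> ptail (w i) = pfront (tau (w i.+1))) /\
  (forall i, (i <= N)%N -> phead (w i) = x i).
Proof.
elim: N x => [|N IHN] x xp.
  have [a /exists_pcons[p [px _]]] := exists_gpath k (rng (x 0%N)) Gsinks.
  by exists (fun=> p); split=> // i; rewrite leqn0 => /eqP ->.
have [w [wt wh]] := IHN (x \o S) (fun i => xp i.+1).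
have /exists_pcons[p [ph pt]] : psrc (pfront (tau (w 0%N))) = rng (x 0%N).
  by rewrite psrc_front_tau wh// xp.
exists (fun i => if i is i'.+1 then w i' else p); split=> [[|i]|[|i]] //= iN.
- exact: wt.
- exact: wh.
Qed.

Variable m : nat.
Hypothesis sync : syncing m.

(** By synchronization, the source [a i] of a finite lift of x_i ... x_(i+m) depends only on these
    labels; the i-th edge of the lift is x_i followed by [a i.+1]. *)
Lemma exists_lift x : infinite_paths G x -> exists w : nat -> gpath G k.+1,
  tpath w /\ forall i, phead (w i) = x i.
Proof.
move=> xp.
have /choice[W hW] i : exists w : nat -> gpath G k.+1,
    (forall n, (n < m)%N -> ptail (w n) = pfront (tau (w n.+1))) /\
    (forall n, (n <= m)%N -> phead (w n) = x (i + n)%N).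
  by apply: (@finite_lift m (fun n => x (i + n)%N)) => n; rewrite /= addnS; exact: xp.
pose a i := pfront (tau (W i 0%N)).
have /choice[w hw] i : exists p : gpath G k.+1, phead p = x i /\ ptail p = a i.+1.
  have [|p [ph pt]] := @exists_pcons G k (x i) (a i.+1); last by exists p.
  by rewrite /a psrc_front_tau (hW i.+1).2// addn0 xp.
have wa i : pfront (tau (w i)) = a i.
  (* Putting [w i] in front of [W i.+1] gives a second finite lift of the labels lifted by [W i], so
     the two sources agree. *)
  apply: (@sync (fun n => if n is n'.+1 then W i.+1 n' else w i)).
  - move=> [|n] nm; first exact: (hw i).2.
    by apply: (hW i.+1).1; exact: ltnW.
  - exact: (hW i).1.
  - move=> [|n] nm; first by rewrite (hw i).1 (hW i).2// addn0.
    by rewrite (hW i.+1).2 ?(hW i).2 ?addnS// ltnW.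
by exists w; split=> i; [rewrite (hw i).2 wa | exact: (hw i).1].
Qed.

(** The edge [w i] is its head followed by the source of [w i.+1], which the labels i+1, ..., i+1+m
    determine; hence a lookahead of m. *)
Lemma lift_unique_upto n w w' : tpath w -> tpath w' ->
  (forall i, (i <= n + m)%N -> phead (w i) = phead (w' i)) ->
  forall i, (i < n)%N -> w i = w' i.
Proof.
move=> hw hw' ww' i ni; apply: gpath_consP.
  by apply: ww'; rewrite (leq_trans (ltnW ni))// leq_addr.
rewrite hw hw'; apply: (@sync (fun j => w (j + i.+1)%N) (fun j => w' (j + i.+1)%N)).
- by move=> j _; exact: hw.
- by move=> j _; exact: hw'.
- by move=> j jm; apply: ww'; rewrite addnC leq_add.
Qed.

Lemma source_unique_upto w w' : tpath w -> tpath w' ->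
  (forall i, (i <= m)%N -> phead (w i) = phead (w' i)) ->
  pfront (tau (w 0%N)) = pfront (tau (w' 0%N)).
Proof. by move=> hw hw' ww'; exact: sync. Qed.

Lemma lift_unique w w' : tpath w -> tpath w' ->
  (forall i, phead (w i) = phead (w' i)) -> w =1 w'.
Proof. by move=> hw hw' ww' i; apply: (@lift_unique_upto i.+1). Qed.

(** Take the initial edge of the lift of each right tail of x; uniqueness of lifts makes consecutive
    choices fit. *)
Lemma exists_bilift x : bi_infinite_paths G x ->
  exists y : int -> gpath G k.+1, bi_infinite_paths (perm_graph tau) y /\
    forall i, phead (y i) = x i.
Proof.
move=> xp.
have /choice[W hW] (j : int) : exists w : nat -> gpath G k.+1,
    tpath w /\ forall n : nat, phead (w n) = x (j + n%:Z).
  apply: (@exists_lift (fun n : nat => x (j + n%:Z))) => n.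
  by rewrite /= xp -addn1 PoszD addrA.
exists (fun j => W j 0%N); split=> [j|j] /=; last by rewrite (hW j).2 addr0.
rewrite (hW j).1; congr (pfront (tau _)).
apply: (@lift_unique (fun n => W j n.+1) (W (j + 1))).
- by move=> n; exact: (hW j).1.
- exact: (hW _).1.
- by move=> n; rewrite (hW j).2 (hW _).2 -add1n PoszD addrA.
Qed.

End Lifts.

(** * Conjugacy and label shifts *)

Lemma addzS (j : int) (n : nat) : j + n.+1%:Z = j + n%:Z + 1.
Proof. by rewrite -addn1 PoszD addrA. Qed.

Section BiInfinite.
Variables (G : graph) (k : nat) (tau : {perm gpath G k.+1}).
Hypotheses (Gsinks : no_sinks G) (Gsources : no_sources G).
Hypothesis tauE : endpoint_fixing tau.
Local Notation bipath y := (bi_infinite_paths (perm_graph tau) y).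

Lemma bipathP y : bipath y <-> forall i, ptail (y i) = pfront (tau (y (i + 1))).
Proof. by []. Qed.

Lemma exists_edge_from (a : gpath G k) : exists p, pfront (tau p) = a.
Proof.
have [f fa] := Gsinks (prng a); have [p [pa _]] := exists_prcons fa.
by exists (tau^-1 p)%g; rewrite permKV.
Qed.

Lemma exists_edge_to (a : gpath G k) : exists p : gpath G k.+1, ptail p = a.
Proof.
have [e ea] := Gsources (psrc a).
by have [p [_ pa]] := exists_pcons (esym ea); exists p.
Qed.

(** The permutation graph inherits from G the absence of sinks and sources, so an edge extends in
    both directions; [Negz n] is time -(n+1), reached by n + 1 predecessors. *)
Lemma exists_bipath (p : gpath G k.+1) : exists y, bipath y /\ y 0 = p.
Proof.
have /choice[nx nxP] q := exists_edge_from (ptail q).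
have /choice[pv pvP] q := exists_edge_to (pfront (tau q)).
exists (fun j : int => match j with Posz n => iter n nx p | Negz n => iter n.+1 pv p end).
split=> //; apply/bipathP => -[n|[|n]].
- have -> : Posz n + 1 = Posz n.+1 by lia.
  exact/esym/nxP.
- exact: pvP.
- have -> : Negz n.+1 + 1 = Negz n by lia.
  exact: pvP.
Qed.

(** Synchronization fixes the vertex m edges back. From there on the path is deterministic forwards:
    an edge is recovered from its source beta and its second label f as the preimage of beta f under
    tau. *)
Lemma left_determined m (y y' : int -> gpath G k.+1) : syncing tau m -> bipath y -> bipath y' ->
  (forall i : int, i < 0 -> phead (y i) = phead (y' i) /\ plast (tau (y i)) = plast (tau (y' i))) ->
  forall i : int, i < 0 -> y i = y' i.
Proof.
move=> sync /bipathP hy /bipathP hy' yy' i i0.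
(* The window of m + 1 edges starting at j ends at i, so it stays within the negative times. *)
pose j := i - m%:Z.
have tp z : bipath z -> tpath tau (fun n : nat => z (j + n%:Z)).
  by move=> hz n; rewrite addzS; exact: hz.
have s0 : pfront (tau (y j)) = pfront (tau (y' j)).
  have := source_unique_upto sync (tp _ hy) (tp _ hy'); rewrite !addr0; apply=> n nm.
  by apply: (proj1 (yy' _ _)); rewrite /j; lia.
suff : forall n : nat, (n <= m)%N -> y (j + n%:Z) = y' (j + n%:Z).
  by move=> /(_ m (leqnn m)); rewrite subrK.
elim=> [|n IHn] nm.
  rewrite addr0; apply: (@perm_inj _ tau); apply: gpath_rconsP => //.
  by apply: (proj2 (yy' _ _)); rewrite /j; lia.
rewrite addzS; apply: (@perm_inj _ tau); apply: gpath_rconsP.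
  by rewrite -hy -hy' IHn// ltnW.
by apply: (proj2 (yy' _ _)); rewrite /j; lia.
Qed.

End BiInfinite.

(** * Matching the vertices of two permutation graphs *)

Section Companions.
Variables (G : graph) (k : nat).
Hypotheses (Gsinks : no_sinks G) (Gsources : no_sources G).
Implicit Types (tau : {perm gpath G k.+1}) (y : int -> gpath G k.+1).

Definition same_labels tau tau' y y' := forall i : int,
  phead (y i) = phead (y' i) /\ plast (tau (y i)) = plast (tau' (y' i)).

(** Relates the vertices visited at time 0 by two paths with the same labels; for equal label shifts
    it is the graph of the permutation pi. *)
Definition companion tau tau' (a a' : gpath G k) := exists y y',
  [/\ bi_infinite_paths (perm_graph tau) y, bi_infinite_paths (perm_graph tau') y',
      same_labels tau tau' y y', pfront (tau (y 0)) = a & pfront (tau' (y' 0)) = a'].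

Lemma companion_sym tau tau' a a' : companion tau tau' a a' -> companion tau' tau a' a.
Proof.
move=> [y [y' [hy hy' yy' ya ya']]]; exists y', y; split=> // i.
by have [-> ->] := yy' i.
Qed.

Lemma label_shiftP tau tau' : label_shift tau `<=` label_shift tau' <->
  forall y, bi_infinite_paths (perm_graph tau) y ->
    exists y', bi_infinite_paths (perm_graph tau') y' /\ same_labels tau tau' y y'.
Proof.
split=> [h y hy|h _ [y hy <-]].
  have /h[y' hy' yy'] : label_shift tau
    (fun i => (@label1 G k tau (y i), @label2 G k tau (y i))) by exists y.
  exists y'; split=> // i; have := congr1 (fun z => z i) yy' => /= -[h1 h2].
  by split; apply/esym.
have [y' [hy' yy']] := h y hy; exists y' => //; apply: funext => i.
by have [h1 h2] := yy' i; rewrite /label1 /label2 h1 h2.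
Qed.

Lemma companion_total tau tau' a : label_shift tau `<=` label_shift tau' ->
  exists a', companion tau tau' a a'.
Proof.
move=> /label_shiftP sub; have [p pa] := exists_edge_from tau Gsinks a.
have [y [hy y0]] := exists_bipath tau Gsinks Gsources p.
have [y' [hy' yy']] := sub _ hy.
by exists (pfront (tau' (y' 0))), y, y'; split; rewrite ?y0.
Qed.

(* Two paths through the same vertex [a] are spliced into one path having the past of
   the first and the future of the second; its companion then starts both in [a1] and
   in [a2]. *)
Lemma companion_fun tau tau' a a1 a2 m : syncing tau' m ->
  label_shift tau `<=` label_shift tau' ->
  companion tau tau' a a1 -> companion tau tau' a a2 -> a1 = a2.
Proof.
move=> sync /label_shiftP sub [y [y' [/bipathP hy /bipathP hy' yy' ya ya']]]
  [z [z' [/bipathP hz /bipathP hz' zz' za za']]].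
pose s (i : int) := if i < 0 then y i else z i.
have hs : bi_infinite_paths (perm_graph tau) s.
  apply/bipathP => i; rewrite /s /=.
  have [i1|i1] := ltP i (-1).
    by rewrite !ifT; [exact: hy|lia|lia].
  have [->|i2] := eqVneq i (-1).
    by rewrite (_ : -1 + 1 = 0 :> int)//= za -ya (hy (-1)).
  by rewrite !ifF; [exact: hz|lia|lia].
have [s' [hs' ss']] := sub _ hs.
(* The past of the splice carries the labels of y, so the companion arrives at time 0 in [a1]. *)
have e1 : s' (-1) = y' (-1).
  apply: (left_determined sync hs' hy') => // i i0.
  by have [<- <-] := ss' i; rewrite /s i0; exact: yy'.
have tp w : bi_infinite_paths (perm_graph tau') w -> tpath tau' (fun n : nat => w (0 + n%:Z)).
  by move=> hw n; rewrite addzS; exact: hw.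
(* Its future carries the first labels of z, so by synchronization it leaves time 0 from [a2]. *)
have := source_unique_upto sync (tp _ hs') (tp _ hz'); rewrite !addr0 => e2.
rewrite -ya' -za' -e2 => [|i im]; last first.
  by have [<- _] := ss' (0 + i%:Z); have [<- _] := zz' (0 + i%:Z).
by have /= := (bipathP _).1 hs' (-1); rewrite e1 => <-; rewrite (hy' (-1)).
Qed.

(** For m = e pi(alpha) the witnesses are p = e alpha and q = pi(beta) f, where tau(p) = beta f.
    Once they are paths, the [insubd] defaults in [gmap] are not reached. *)
Lemma gmapE (pi : {perm gpath G k}) tau (m p q : gpath G k.+1) :
  phead p = phead m -> ptail p = pi^-1%g (ptail m) ->
  pfront q = pi (pfront (tau p)) -> plast q = plast (tau p) -> gmap pi tau m = q.
Proof.
have valE l (r : gpath G l) : val r = (psrc r, pedges r) by case: r => -[].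
move=> pm pt qf ql; rewrite /gmap.
rewrite (_ : (psrc m, _) = val p); last first.
  rewrite valE !psrc_head pm; congr (_, _).
  by apply: val_inj; rewrite /= pedgesE pm pt.
rewrite valKd (_ : (psrc _, _) = val q); first exact: valKd.
rewrite valE -qf -ql psrc_front; congr (_, _).
by apply: val_inj; exact/esym/pedges_front.
Qed.

(* [pi] carries the permutation graph of [tau] onto that of [tau'], preserving both labels. *)
Lemma gmap_labels (pi : {perm gpath G k}) tau tau' : endpoint_fixing pi -> endpoint_fixing tau ->
  (forall m, tau' m = gmap pi tau m) ->
  forall p m : gpath G k.+1, phead p = phead m -> ptail m = pi (ptail p) ->
  pfront (tau' m) = pi (pfront (tau p)) /\ plast (tau' m) = plast (tau p).
Proof.
move=> piE tE h p m pm mp.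
have [|q [qf ql]] := @exists_prcons G k (plast (tau p)) (pi (pfront (tau p))).
  by rewrite ((endpoint_fixingP pi).1 piE _).2 prng_front.
by rewrite h (gmapE (p := p) (q := q)) ?mp ?permK.
Qed.

Lemma gmap_label_shift (pi : {perm gpath G k}) tau tau' :
  endpoint_fixing pi -> endpoint_fixing tau -> endpoint_fixing tau' ->
  (forall m, tau' m = gmap pi tau m) -> label_shift tau = label_shift tau'.
Proof.
move=> piE tE tE' h; have lab := gmap_labels piE tE h.
have psrcP := fun a => ((endpoint_fixingP pi).1 piE a).1.
apply/seteqP; split; apply/label_shiftP => y hy.
  have /choice[y' hy'] i : exists p, phead p = phead (y i) /\ ptail p = pi (ptail (y i)).
    have [|p [? ?]] := @exists_pcons G k (phead (y i)) (pi (ptail (y i))); last by exists p.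
    by rewrite psrcP.
  have yy' i := lab _ _ (esym (hy' i).1) (hy' i).2.
  exists y'; split=> i; last by rewrite (hy' i).1 (yy' i).2.
  by rewrite /= (hy' i).2 (yy' _).1; congr (pi _); exact: hy.
have /choice[y' hy'] i : exists p, phead p = phead (y i) /\ ptail (y i) = pi (ptail p).
  have [|p [? pt]] := @exists_pcons G k (phead (y i)) (pi^-1 (ptail (y i)))%g.
    by rewrite -psrcP permKV.
  by exists p; rewrite pt permKV.
have yy' i := lab _ _ (hy' i).1 (hy' i).2.
exists y'; split=> i; last by rewrite (hy' i).1 (yy' i).2.
by apply: (@perm_inj _ pi); rewrite /= -(hy' i).2 -(yy' _).1; exact: hy.
Qed.

Lemma label_shift_gmap tau tau' m m' :
  endpoint_fixing tau -> endpoint_fixing tau' -> syncing tau m -> syncing tau' m' ->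
  label_shift tau = label_shift tau' ->
  exists pi : {perm gpath G k}, endpoint_fixing pi /\ forall q, tau' q = gmap pi tau q.
Proof.
move=> tE tE' sync sync' eqs.
have sub : label_shift tau `<=` label_shift tau' by rewrite eqs.
have sub' : label_shift tau' `<=` label_shift tau by rewrite eqs.
have /choice[f fP] a := companion_total a sub.
(* The relation is symmetric, so functionality with tau and tau' exchanged is injectivity. *)
have f_inj : injective f.
  move=> a b fab; apply: (companion_fun sync sub' (a := f a)).
    exact: companion_sym.
  by rewrite fab; exact: companion_sym.
pose pi := perm f_inj; have piP a : companion tau tau' a (pi a) by rewrite permE.
have piU a a' : companion tau tau' a a' -> a' = pi a.
  by move=> h; exact: (companion_fun sync' sub h (piP a)).
(* The labels at time 0 show the endpoints of a vertex: it starts at the source of the first label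
   and ends at the source of the second. *)
have piE : endpoint_fixing pi.
  apply/endpoint_fixingP => a; have [y [y' [hy hy' yy' <- <-]]] := piP a.
  have [h1 h2] := yy' 0.
  by rewrite !(psrc_front_tau tE) !(psrc_front_tau tE') !prng_front h1 h2.
exists pi; split=> // q.
(* With q = e pi(alpha), the edge p = e alpha is put on a bi-infinite path. The path with the same
   labels for tau' has q at time 0, since first label and target agree. *)
have [|p [ph pt]] := @exists_pcons G k (phead q) (pi^-1 (ptail q))%g.
  by rewrite ((endpoint_fixingP _).1 (endpoint_fixingV piE) _).1.
have [y [hy y0]] := exists_bipath tau Gsinks Gsources p.
have [y' [hy' yy']] := (label_shiftP tau tau').1 sub _ hy.
move/bipathP : hy => hy; move/bipathP : hy' => hy'.
have s1 : pfront (tau' (y' 0)) = pi (pfront (tau (y 0))) by apply: piU; exists y, y'.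
have s2 : ptail (y' 0) = pi (ptail (y 0)).
  rewrite hy hy'; apply: piU; exists (fun i => y (i + 1)), (fun i => y' (i + 1)).
  by split=> // i; [exact: hy | exact: hy'].
have [l1 l2] := yy' 0.
have qy : y' 0 = q.
  by apply: gpath_consP; rewrite -?l1 ?s2 y0 ?ph ?pt ?permKV.
by rewrite (gmapE (p := p) (q := tau' q)) // -qy ?s1 ?y0// -?l2 ?y0.
Qed.

(** The set from which [textile_map] chooses depends only on the pairs of label sequences. *)
Lemma label_shift_textile tau tau' x : label_shift tau = label_shift tau' ->
  textile_map tau x = textile_map tau' x.
Proof.
move=> eqs; rewrite /textile_map; congr (xget _ _).
have key (t t' : {perm gpath G k.+1}) : label_shift t `<=` label_shift t' ->
    textile2 (tau:=t) @` [set y | bi_infinite_paths (perm_graph t) y /\ textile1 y = x] `<=`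
    textile2 (tau:=t') @` [set y | bi_infinite_paths (perm_graph t') y /\ textile1 y = x].
  move=> h _ [y [hy yx] <-]; have sub := (label_shiftP t t').1 h.
  have [y' [hy' yy']] := sub _ hy; exists y'.
    by split=> //; rewrite -yx; apply: funext => i; rewrite /textile1 /label1; have [] := yy' i.
  by apply: funext => i; rewrite /textile2 /label2; have [] := yy' i.
by apply/seteqP; split; apply: key; rewrite eqs.
Qed.

Lemma textile_mapE tau m y : endpoint_fixing tau -> syncing tau m ->
  bi_infinite_paths (perm_graph tau) y ->
  textile_map tau (fun i => phead (y i)) = (fun i => plast (tau (y i))).
Proof.
move=> tE sync hy; apply: xget_unique; first by exists y.
move=> _ [z [hz zy] <-]; apply: funext => i.
rewrite /textile2 /label2; congr (plast (tau _)).
have tp w : bi_infinite_paths (perm_graph tau) w -> tpath tau (fun n : nat => w (i + n%:Z)).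
  by move=> hw n; rewrite addzS; exact: hw.
have := lift_unique sync (tp _ hz) (tp _ hy) _ 0%N; rewrite !addr0; apply=> n.
by have := congr1 (fun u => u (i + n%:Z)) zy.
Qed.

Lemma bipath_heads tau y : endpoint_fixing tau -> bi_infinite_paths (perm_graph tau) y ->
  bi_infinite_paths G (fun i => phead (y i)).
Proof.
by move=> tE /bipathP hy i /=; rewrite -psrc_tail hy (psrc_front_tau tE).
Qed.

(** Given y for tau, the lift of its first labels to tau' has the same second labels, because these
    are the values of the textile maps. *)
Lemma textile_label_shift tau tau' m m' :
  endpoint_fixing tau -> endpoint_fixing tau' -> syncing tau m -> syncing tau' m' ->
  (forall x, bi_infinite_paths G x -> textile_map tau x = textile_map tau' x) ->
  label_shift tau = label_shift tau'.
Proof.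
move=> tE tE' sync sync' h.
have key (t t' : {perm gpath G k.+1}) n n' :
    endpoint_fixing t -> endpoint_fixing t' -> syncing t n -> syncing t' n' ->
    (forall x, bi_infinite_paths G x -> textile_map t x = textile_map t' x) ->
    label_shift t `<=` label_shift t'.
  move=> {}tE {}tE' {}sync {}sync' {}h; apply/label_shiftP => y hy.
  have hx := bipath_heads tE hy.
  have [y' [hy' yy']] := exists_bilift Gsinks tE' sync' hx.
  exists y'; split=> // i; split; first by rewrite yy'.
  have := h _ hx; rewrite (textile_mapE tE sync hy).
  rewrite (_ : (fun i => phead (y i)) = (fun i => phead (y' i))); last by apply: funext.
  by rewrite (textile_mapE tE' sync' hy') => /(congr1 (fun u => u i)).
apply/seteqP; split; first exact: key sync sync' h.
by apply: key sync' sync _ => // x xp; rewrite h.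
Qed.

End Companions.

(** * Calculus in a Cuntz-Krieger family *)

Section CuntzKriegerCalculus.
Variables (R : realType) (G : graph) (A : cstarAlgebra R).
Variables (P : vertex G -> A) (S : edge G -> A).
Hypotheses (Gsinks : no_sinks G) (CK : cuntz_krieger P S).
Local Notation one := (graph_unit P).
Hypotheses (cmul1 : forall a, a ** one = a) (c1mul : forall a, one ** a = a).
Implicit Types (a b : A) (e f : edge G) (u v : vertex G).

Lemma ck_starP v : cstar (P v) = P v.
Proof. by have [_ ->] := ck_proj CK v. Qed.

Lemma ck_PP u v : P u ** P v = if u == v then P u else 0.
Proof.
case: eqP => [->|uv]; first by have [-> _] := ck_proj CK v.
exact: ck_orth CK _ _ uv.
Qed.

Lemma ck_SS e f : cstar (S e) ** S f = if e == f then P (rng e) else 0.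
Proof.
case: eqP => [->|ef]; first exact: ck_initial CK f.
exact: ck_disjoint CK _ _ ef.
Qed.

Lemma ck_SP e : S e ** P (rng e) = S e.
Proof. by rewrite -(ck_initial CK) cmulA (ck_pisom CK). Qed.

Lemma ck_PS e : P (src e) ** S e = S e.
Proof.
rewrite (ck_sum CK); last by exists e.
rewrite cmul_suml (bigD1 e)//= (ck_pisom CK) big1 ?addr0// => f /andP[_ fe].
by rewrite -cmulA ck_SS (negPf fe) cmul0.
Qed.

Lemma S_path_cons l (p : gpath G l.+1) : S_path P S p = S (phead p) ** S_path P S (ptail p).
Proof.
rewrite /S_path pedgesE.
by case: (tval (pedges (ptail p))) => //=; rewrite ck_SP.
Qed.

Lemma P_S_path l (p : gpath G l) : P (psrc p) ** S_path P S p = S_path P S p.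
Proof.
case: l p => [|l] p; last by rewrite S_path_cons cmulA psrc_head ck_PS.
by rewrite /S_path tuple0 /= ck_PP eqxx.
Qed.

Lemma S_path_P l (p : gpath G l) : S_path P S p ** P (prng p) = S_path P S p.
Proof.
elim: l p => [|l IHl] p; last by rewrite S_path_cons -cmulA -prng_tail IHl.
by rewrite /S_path /prng tuple0 /= ck_PP eqxx.
Qed.

Lemma S_path_star_P l (p : gpath G l) : cstar (S_path P S p) ** P (psrc p) = cstar (S_path P S p).
Proof. by rewrite -[LHS]cstarK cstarM cstarK ck_starP P_S_path. Qed.

Lemma S_path_orth l (p q : gpath G l) :
  cstar (S_path P S p) ** S_path P S q = if p == q then P (prng p) else 0.
Proof.
elim: l p q => [|l IHl] p q.
  have pE (r : gpath G 0) : prng r = psrc r by rewrite /prng tuple0.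
  have SE (r : gpath G 0) : S_path P S r = P (psrc r) by rewrite /S_path tuple0.
  rewrite pE !SE ck_starP ck_PP; congr (if _ then _ else _); apply/eqP/eqP => [pq|->//].
  by apply: gpath_eq => //; rewrite (tuple0 (pedges p)) (tuple0 (pedges q)).
rewrite !S_path_cons cstarM cmulA -(cmulA _ (cstar (S _))) ck_SS.
have [eh|nh] := eqVneq (phead p) (phead q); last first.
  by rewrite cmul0 c0mul ifN//; apply: contra nh => /eqP ->.
rewrite -psrc_tail S_path_star_P IHl prng_tail; congr (if _ then _ else _).
by apply/eqP/eqP => [tt|->//]; exact: gpath_consP.
Qed.

Lemma S_S_path_eq0 l e (t : gpath G l) : psrc t <> rng e -> S e ** S_path P S t = 0.
Proof.
move=> h; rewrite -P_S_path cmulA -(ck_SP e) -(cmulA (S e)) ck_PP ifN ?cmul0 ?c0mul//.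
by apply/eqP => h'; apply: h.
Qed.

Lemma ck_sum_edges : \sum_e S e ** cstar (S e) = one.
Proof.
rewrite /graph_unit (partition_big (@src G) xpredT)//=.
by apply: eq_bigr => v _; rewrite (ck_sum CK)//; exact: Gsinks.
Qed.

Lemma sum_P_path l : \sum_(p : gpath G l) P_path P S p = one.
Proof.
elim: l => [|l IHl].
  rewrite (reindex (fun v : vertex G => @GPath G 0 (v, [tuple]) isT)).
    by apply: eq_bigr => v _; rewrite /P_path /S_path /= ck_starP ck_PP eqxx.
  exists (@psrc G 0) => // p _; apply: gpath_eq => //.
  by rewrite (tuple0 (pedges p)).
rewrite -ck_sum_edges (partition_big (@phead G l) xpredT)//=.
apply: eq_bigr => e _.
transitivity (\sum_(t : gpath G l | psrc t == rng e)
  S e ** P_path P S t ** cstar (S e)); last first.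
  transitivity (S e ** one ** cstar (S e)); last by rewrite cmul1.
  rewrite -IHl cmul_sumr cmul_suml [RHS](bigID (fun t => psrc t == rng e)) /=.
  rewrite [X in _ = _ + X]big1 ?addr0// => t /eqP h.
  by rewrite /P_path cmulA S_S_path_eq0// !c0mul.
(* [c] puts e in front of t; where that is not a path its value is arbitrary. *)
have /choice[c cP] t : exists p : gpath G l.+1, psrc t = rng e -> phead p = e /\ ptail p = t.
  have [h|h] := pselect (psrc t = rng e).
    by have [p [? ?]] := exists_pcons h; exists p.
  by have [p _] := exists_gpath l.+1 (src e) Gsinks; exists p.
rewrite [RHS](reindex_onto (@ptail G l) c) => [|t /eqP /cP[]//].
apply: congr_big => // [p|p /eqP <-]; last first.
  by rewrite /P_path S_path_cons cstarM !cmulA.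
apply/eqP/andP => [pe|[/eqP h1 /eqP h2]].
  have ps : psrc (ptail p) = rng e by rewrite psrc_tail pe.
  split; first exact/eqP.
  by apply/eqP/gpath_consP; rewrite ?(cP _ ps).1 ?(cP _ ps).2.
by rewrite -h2 (cP _ h1).1.
Qed.

(** The projections S_p S_p* of a fixed length sum to the unit. *)
Lemma S_path_ext l a b : (forall p : gpath G l, a ** S_path P S p = b ** S_path P S p) -> a = b.
Proof.
move=> ab; rewrite -(cmul1 a) -(cmul1 b) -(sum_P_path l) !cmul_sumr.
by apply: eq_bigr => p _; rewrite /P_path !cmulA ab.
Qed.

(** Products over bare sequences, with the unit as empty product, so that a path can be cut anywhere
    without transporting path types. *)
Fixpoint S_seq (s : seq (edge G)) : A := if s is e :: s' then S e ** S_seq s' else one.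

Lemma S_seq_cat s t : S_seq (s ++ t) = S_seq s ** S_seq t.
Proof. by elim: s => [|e s IHs] /=; rewrite ?c1mul// IHs cmulA. Qed.

Lemma S_path_seq l (p : gpath G l) : S_path P S p = P (psrc p) ** S_seq (pedges p).
Proof.
elim: l p => [|l IHl] p; first by rewrite /S_path tuple0 /= cmul1.
by rewrite S_path_cons IHl psrc_head pedgesE /= !cmulA ck_PS ck_SP.
Qed.

Lemma S_path_rcons l (p : gpath G l.+1) : S_path P S p = S_path P S (pfront p) ** S (plast p).
Proof.
by rewrite !S_path_seq pedges_front -cats1 S_seq_cat cmulA /= cmul1.
Qed.

Section UnitaryOfPermutation.
Variables (l : nat) (tau : {perm gpath G l}).
Hypothesis tauE : endpoint_fixing tau.
Local Notation U := (U_perm P S tau).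

Let prngE p : prng (tau p) = prng p. Proof. by have [] := (endpoint_fixingP tau).1 tauE p. Qed.
Let psrcE p : psrc (tau p) = psrc p. Proof. by have [] := (endpoint_fixingP tau).1 tauE p. Qed.

Lemma U_perm_S p : U ** S_path P S p = S_path P S (tau p).
Proof.
rewrite /U_perm cmul_suml (bigD1 p)//= -cmulA S_path_orth eqxx -prngE S_path_P.
by rewrite big1 ?addr0// => q qp; rewrite -cmulA S_path_orth (negPf qp) cmul0.
Qed.

Lemma U_perm_star_S p : cstar U ** S_path P S (tau p) = S_path P S p.
Proof.
rewrite /U_perm cstar_sum cmul_suml (bigD1 p)//= cstarM cstarK.
rewrite -cmulA S_path_orth eqxx prngE S_path_P big1 ?addr0// => q qp.
by rewrite cstarM cstarK -cmulA S_path_orth (inj_eq perm_inj) (negPf qp) cmul0.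
Qed.

Lemma U_perm_starU : cstar U ** U = one.
Proof. by apply: (@S_path_ext l) => p; rewrite -cmulA U_perm_S U_perm_star_S c1mul. Qed.

Lemma U_permU : U ** cstar U = one.
Proof.
apply: (@S_path_ext l) => p; rewrite -(permKV tau p) -cmulA U_perm_star_S U_perm_S.
by rewrite permKV c1mul.
Qed.

Lemma P_S_pathE v (p : gpath G l) : P v ** S_path P S p = if psrc p == v then S_path P S p else 0.
Proof.
rewrite -{1}P_S_path cmulA ck_PP eq_sym; by case: eqP => [<-|_]; rewrite ?c0mul// P_S_path.
Qed.

Lemma U_permP v : U ** P v = P v ** U.
Proof.
apply: (@S_path_ext l) => p; rewrite -!cmulA U_perm_S !P_S_pathE psrcE.
by case: eqP => _; rewrite ?U_perm_S ?cmul0.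
Qed.

End UnitaryOfPermutation.

End CuntzKriegerCalculus.

(** * The universal algebra and its permutative endomorphisms *)

Section Universal.
Variables (R : realType) (G : graph) (A : cstarAlgebra R).
Variables (P : vertex G -> A) (S : edge G -> A).
Hypothesis UA : graph_cstar P S.
Local Notation one := (graph_unit P).

Lemma graph_cstar_ext (B : cstarAlgebra R) (f g : A -> B) : cuntz_krieger (f \o P) (f \o S) ->
  star_hom f -> star_hom g -> (forall v, g (P v) = f (P v)) ->
  (forall e, g (S e) = f (S e)) -> f =1 g.
Proof.
move=> CK hf hg gP gS x; have [_ /(_ B _ _ CK)[h [_ hu]]] := UA.
by rewrite -(hu f) ?(hu g).
Qed.

Lemma graph_unit_proj : one ** one = one.
Proof.
have [CK _] := UA; rewrite {1}/graph_unit cmul_suml; apply: eq_bigr => v _.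
rewrite cmul_sumr (bigD1 v)//= (ck_PP CK) eqxx big1 ?addr0// => u /negPf uv.
by rewrite (ck_PP CK) eq_sym uv.
Qed.

Lemma graph_unit_star : cstar one = one.
Proof.
have [CK _] := UA; rewrite /graph_unit cstar_sum.
by apply: eq_bigr => v _; rewrite (ck_starP CK).
Qed.

Lemma graph_unit_P v : one ** P v = P v.
Proof.
have [CK _] := UA; rewrite cmul_suml (bigD1 v)//= (ck_PP CK) eqxx big1 ?addr0// => u /negPf uv.
by rewrite (ck_PP CK) uv.
Qed.

Lemma graph_unit_S e : one ** S e = S e.
Proof. by have [CK _] := UA; rewrite -(ck_PS CK) cmulA graph_unit_P. Qed.

Lemma S_graph_unit e : S e ** one = S e.
Proof.
have [CK _] := UA; rewrite -(ck_SP CK) -cmulA; congr (_ ** _).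
by rewrite -[LHS]cstarK cstarM graph_unit_star (ck_starP CK) graph_unit_P (ck_starP CK).
Qed.

(* Conjugation by the symmetry [2 p - 1], where [p] is the sum of the vertex projections,
   fixes the generators, hence is the identity; so [p] is central, and
   then multiplication by [p] is an endomorphism fixing the generators. *)
Lemma graph_unit_mul x : one ** x = x /\ x ** one = x.
Proof.
have [CK _] := UA; set p := one.
have pp : p ** p = p by exact: graph_unit_proj.
have ps : cstar p = p by exact: graph_unit_star.
have two0 : (2%:R : R[i]) != 0 by rewrite pnatr_eq0.
(* Left and right multiplication by 1 - 2p, written without a unit, which is not yet available. *)
pose L a := a - 2%:R *: (p ** a); pose M a := a - 2%:R *: (a ** p).
have LD a b : L (a + b) = L a + L b by rewrite /L cmulDr scalerDr opprD addrACA.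
have MD a b : M (a + b) = M a + M b by rewrite /M cmulDl scalerDr opprD addrACA.
have LZ t a : L (t *: a) = t *: L a.
  by rewrite /L cmulZr scalerA mulrC -scalerA -scalerBr.
have MZ t a : M (t *: a) = t *: M a.
  by rewrite /M cmulZl scalerA mulrC -scalerA -scalerBr.
have LA a b : L (a ** b) = L a ** b by rewrite /L cmulBl cmulZl cmulA.
have MA a b : M (a ** b) = a ** M b by rewrite /M cmulBr cmulZr cmulA.
have LM a : L (M a) = M (L a).
  rewrite /L /M cmulBr cmulBl !scalerBr !cmulZl !cmulZr !cmulA !opprB.
  by rewrite addrACA [RHS]addrACA (addrC (- (2%:R *: (a ** p)))).
have pL a : p ** L a = - (p ** a).
  by rewrite /L cmulBr cmulZr cmulA pp scaler_nat mulr2n opprD addrA subrr add0r.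
have Mp a : M a ** p = - (a ** p).
  by rewrite /M cmulBl cmulZl -cmulA pp scaler_nat mulr2n opprD addrA subrr add0r.
have ML a b : M a ** L b = a ** b.
  by rewrite {1}/M cmulBl cmulZl -(cmulA a) pL cmulN scalerN opprK /L cmulBr cmulZr cmulA subrK.
have sL a : cstar (L a) = M (cstar a).
  by rewrite /L /M cstarB cstarZ cstarM ps rmorph_nat.
have sM a : cstar (M a) = L (cstar a) by rewrite -{1}(cstarK a) -sL cstarK.
have gen a : p ** a = a -> a ** p = a -> L (M a) = a.
  move=> pa ap; rewrite /M ap /L cmulBr cmulZr pa scaler_nat mulr2n opprD addNKr scalerN.
  by rewrite opprK scaler_nat mulr2n addrA addNr add0r.
have idE f : star_hom f -> (forall v, f (P v) = P v) -> (forall e, f (S e) = S e) -> f =1 id.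
  move=> hf fP fS a; apply/esym; apply: (@graph_cstar_ext A id f) => //.
have PO v : P v ** p = P v.
  by rewrite -[LHS]cstarK cstarM ps (ck_starP CK) graph_unit_P (ck_starP CK).
have LMid a : L (M a) = a.
  apply: (idE (fun a => L (M a))) => [|v|e].
  - split.
    + by move=> b c; rewrite MD LD.
    + by move=> t b; rewrite MZ LZ.
    + by move=> b c; rewrite MA LA LM -[L b ** _](ML (L b) (M c)).
    + by move=> b; rewrite -sL -sM LM.
  - by apply: gen; [exact: graph_unit_P | exact: PO].
  - by apply: gen; [exact: graph_unit_S | exact: S_graph_unit].
(* Multiplying [L (M a) = a] by p on the left gives 2 p a p = 2 p a; the adjoint version follows,
   and both together say that p is central. *)
have pap a : p ** a = p ** a ** p.
  apply: (scalerI two0).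
  have := congr1 (cmul p) (LMid a); rewrite pL /M cmulBr opprB cmulZr cmulA => /eqP.
  by rewrite subr_eq => /eqP ->; rewrite scaler_nat mulr2n.
have apa a : a ** p = p ** a ** p.
  by rewrite -[LHS]cstarK cstarM ps pap !cstarM ps cstarK cmulA.
have comm a : a ** p = p ** a by rewrite pap -apa.
have pid a : p ** a = a.
  apply: (idE (cmul p)) => [|v|e]; [|exact: graph_unit_P|exact: graph_unit_S].
  split=> [b c|t b|b c|b].
  - by rewrite cmulDr.
  - by rewrite cmulZr.
  - by rewrite !cmulA -(cmulA p b p) (comm b) !cmulA pp.
  - by rewrite cstarM ps comm.
by rewrite comm pid.
Qed.

Lemma cmul1 a : a ** one = a. Proof. exact: (graph_unit_mul a).2. Qed.
Lemma c1mul a : one ** a = a. Proof. exact: (graph_unit_mul a).1. Qed.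

Hypotheses (Gsinks : no_sinks G) (Gsources : no_sources G).
Let CK := UA.1.

Lemma graph_P_neq0 v : P v <> 0.
Proof.
have [B [Q [T [CK' Q0]]]] := exists_cuntz_krieger R Gsinks.
have [_ /(_ B _ _ CK')[f [[hf [fP _]] _]]] := UA.
by move=> v0; apply: (Q0 v); rewrite -fP v0 (star_hom0 hf).
Qed.

Lemma S_path_inj l (p q : gpath G l) : S_path P S p = S_path P S q -> p = q.
Proof.
move=> pq; apply/eqP; have := S_path_orth CK p q; rewrite -pq (S_path_orth CK) eqxx.
by case: (p == q) => // /graph_P_neq0.
Qed.

Section Lambda.
Variables (l : nat) (tau : {perm gpath G l}).
Hypothesis tauE : endpoint_fixing tau.
Local Notation U := (U_perm P S tau).
Local Notation lam := (lambda P S tau).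

Let UU : cstar U ** U = one := U_perm_starU Gsinks CK cmul1 c1mul tauE.
Let UV : U ** cstar U = one := U_permU Gsinks CK cmul1 c1mul tauE.

(** U is unitary and commutes with every P_v, so it cancels in the initial projections and
    conjugates the final ones. Universality then supplies the endomorphism. *)
Lemma U_cuntz_krieger : cuntz_krieger P (fun e => U ** S e).
Proof.
have TT e f : cstar (U ** S e) ** (U ** S f) = cstar (S e) ** S f.
  by rewrite cstarM -cmulA (cmulA (cstar U)) UU c1mul.
have pis e : U ** S e ** cstar (U ** S e) ** (U ** S e) = U ** S e.
  by rewrite -cmulA TT (ck_initial CK) -cmulA (ck_SP CK).
have UP := U_permP Gsinks CK cmul1 tauE.
split=> //.
- by move=> v; split; [exact: (ck_proj CK v).1 | exact: (ck_proj CK v).2].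
- by move=> u v; exact: (ck_orth CK).
- by move=> e; rewrite TT (ck_initial CK).
- by move=> e f ef; rewrite TT (ck_disjoint CK).
- move=> e; apply: cle_proj.
  + exact: (ck_proj CK _).1.
  + exact: (ck_proj CK _).2.
  + by rewrite cmulA pis.
  + by rewrite cstarM cstarK.
  + by rewrite !cmulA -UP -(cmulA U) (ck_PS CK).
- move=> v vs; under eq_bigr do rewrite cstarM cmulA -(cmulA U).
  rewrite -cmul_suml -cmul_sumr -(ck_sum CK)// UP -cmulA UV.
  by rewrite cmul1.
Qed.

Lemma lambdaP : star_hom lam /\ (forall e, lam (S e) = U ** S e).
Proof.
suff ex : exists f, [set f : A -> A | star_hom f /\ f one = one /\
    forall e, f (S e) = U ** S e] f.
  by rewrite /lambda; case: xgetP => [f _ [? [? ?]]|h] //; case: ex => f /h.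
have [_ /(_ A _ _ U_cuntz_krieger)[f [[hf [fP fS]] _]]] := UA.
exists f; split=> //; split=> //.
by rewrite /graph_unit (star_hom_sum _ _ _ hf); apply: eq_bigr.
Qed.

Lemma lambda_hom : star_hom lam. Proof. exact: lambdaP.1. Qed.
Lemma lambda_S e : lam (S e) = U ** S e. Proof. exact: lambdaP.2. Qed.

Lemma lambda_P v : lam (P v) = P v.
Proof.
have [e <-] := Gsources v; rewrite -(ck_initial CK) (star_homM lambda_hom).
rewrite (star_homS lambda_hom) lambda_S cstarM -cmulA (cmulA (cstar U)) UU c1mul //.
Qed.

End Lambda.

Section Conjugacy.
Variables (k : nat) (tau tau' : {perm gpath G k.+1}) (pi : {perm gpath G k}).
Hypotheses (tauE : endpoint_fixing tau) (tauE' : endpoint_fixing tau').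
Hypothesis piE : endpoint_fixing pi.
Local Notation U := (U_perm P S tau).
Local Notation U' := (U_perm P S tau').
Local Notation W := (U_perm P S pi).

Let WW : cstar W ** W = one := U_perm_starU Gsinks CK cmul1 c1mul piE.

(** With p = e alpha and tau(p) = beta f: W U S_e W* S_(pi alpha) = W U S_(e alpha) = W S_beta S_f =
    S_(pi beta) S_f. *)
Lemma conjugate_U_S (m p q : gpath G k.+1) :
  phead p = phead m -> ptail m = pi (ptail p) ->
  pfront q = pi (pfront (tau p)) -> plast q = plast (tau p) ->
  Ad W (U ** S (phead m)) ** S_path P S (ptail m) = S_path P S q.
Proof.
move=> pm mp qf ql; rewrite /Ad -!cmulA mp (U_perm_star_S CK piE) -pm.
rewrite -(S_path_cons CK) (U_perm_S CK tauE) (S_path_rcons CK cmul1 c1mul) cmulA.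
by rewrite (U_perm_S CK piE) -qf -ql -(S_path_rcons CK cmul1 c1mul).
Qed.

Lemma exists_gmap_edge (m : gpath G k.+1) : exists p q, [/\ phead p = phead m,
  ptail m = pi (ptail p), pfront q = pi (pfront (tau p)) & plast q = plast (tau p)].
Proof.
have [|p [ph pt]] := @exists_pcons G k (phead m) (pi^-1 (ptail m))%g.
  by rewrite ((endpoint_fixingP _).1 (endpoint_fixingV piE) _).1.
have [|q [qf ql]] := @exists_prcons G k (plast (tau p)) (pi (pfront (tau p))).
  by rewrite ((endpoint_fixingP pi).1 piE _).2 prng_front.
by exists p, q; rewrite pt permKV.
Qed.

Lemma gmap_Ad : (forall m, tau' m = gmap pi tau m) ->
  forall x, Ad W (lambda P S tau x) = lambda P S tau' x.
Proof.
move=> h.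
have hl := lambda_hom tauE; have hl' := lambda_hom tauE'.
have hA : star_hom (fun x => Ad W (lambda P S tau x)).
  split=> [a b|t a|a b|a]; rewrite /Ad.
  - by rewrite (star_homD hl) cmulDr cmulDl.
  - by rewrite (star_homZ hl) cmulZr cmulZl.
  - rewrite (star_homM hl) !cmulA; congr (_ ** _ ** _).
    by rewrite -[in RHS](cmulA _ (cstar W)) WW cmul1.
  - by rewrite (star_homS hl) !cstarM cstarK cmulA.
have AS e : Ad W (lambda P S tau (S e)) = lambda P S tau' (S e).
  (* Both sides are compared after multiplication by S_t with t of length k; when e t is not a path,
     both vanish. *)
  rewrite !lambda_S//; apply: (S_path_ext Gsinks CK cmul1 (l := k)) => t.
  have [te|te] := eqVneq (psrc t) (rng e); last first.
    rewrite -[RHS]cmulA (S_S_path_eq0 CK) ?cmul0; last exact/eqP.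
    rewrite /Ad -!cmulA -{1}(permKV pi t) (U_perm_star_S CK piE) (S_S_path_eq0 CK) ?cmul0//.
    by rewrite ((endpoint_fixingP _).1 (endpoint_fixingV piE) _).1; exact/eqP.
  have [m [mh mt]] := exists_pcons te.
  have [p [q [pm mp qf ql]]] := exists_gmap_edge m.
  rewrite -{1}mh -{1}mt (conjugate_U_S pm mp qf ql) -cmulA -mh -mt -(S_path_cons CK).
  rewrite (U_perm_S CK tauE') h.
  by rewrite (gmapE (p := p) (q := q)) ?mp ?permK.
move=> x; apply/esym; apply: (graph_cstar_ext (f := lambda P S tau')
  (g := fun x => Ad W (lambda P S tau x))) => //.
- have -> : lambda P S tau' \o P = P by apply: funext => v /=; exact: lambda_P.
  have -> : lambda P S tau' \o S = (fun e => U' ** S e) by apply: funext => e /=; exact: lambda_S.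
  exact: U_cuntz_krieger.
(* P_v = S_e* S_e for an edge e ending in v, so agreement on edges gives agreement on vertices. *)
- move=> v; have [e <-] := Gsources v; rewrite -(ck_initial CK).
  by rewrite (star_homM hA) (star_homS hA) AS -(star_homS hl') -(star_homM hl').
Qed.

Lemma Ad_gmap : (forall x, Ad W (lambda P S tau x) = lambda P S tau' x) ->
  forall m, tau' m = gmap pi tau m.
Proof.
move=> h m; have [p [q [pm mp qf ql]]] := exists_gmap_edge m.
rewrite (gmapE (p := p) (q := q)) ?mp ?permK//; apply: S_path_inj.
rewrite -(conjugate_U_S pm mp qf ql) -(lambda_S tauE) h lambda_S// -cmulA.
by rewrite -(S_path_cons CK) (U_perm_S CK tauE').
Qed.

End Conjugacy.

End Universal.

(** * The diagonal and its spectrum *)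

Section Prefixes.
Variable G : graph.

Lemma mkseq_cons (T : Type) (z : nat -> T) n : mkseq z n.+1 = z 0%N :: mkseq (z \o S) n.
Proof. by rewrite /mkseq /= (iotaDl 1 0) -map_comp. Qed.

Lemma prefix_front n (p : gpath G n.+1) z : is_prefix p z -> is_prefix (pfront p) z.
Proof.
move=> [ps pe]; split; first by rewrite psrc_front.
by have /eqP := pe; rewrite pedges_front mkseqS eqseq_rcons => /andP[/eqP].
Qed.

Lemma prefix_tail n (p : gpath G n.+1) z : is_prefix p z ->
  phead p = z 0%N /\ (infinite_paths G z -> is_prefix (ptail p) (z \o S)).
Proof.
move=> [_]; rewrite pedgesE mkseq_cons => -[h t]; split=> // zp; split=> //.
by rewrite psrc_tail h zp.
Qed.

Lemma exists_infinite_path v : no_sinks G -> exists z, infinite_paths G z /\ src (z 0%N) = v.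
Proof.
move=> /choice[nx nxP].
exists (fun n => iter n (fun e => nx (rng e)) (nx v)); by split=> [n|]; rewrite /= nxP.
Qed.

Lemma exists_extension n (p : gpath G n) : no_sinks G ->
  exists z, infinite_paths G z /\ is_prefix p z.
Proof.
move=> Gs; elim: n p => [|n IHn] p.
  have [z [zp zs]] := exists_infinite_path (psrc p) Gs.
  by exists z; split=> //; split=> //; rewrite tuple0.
have [z [zp [ts te]]] := IHn (ptail p).
exists (fun i => if i is i'.+1 then z i' else phead p); split.
  by move=> [|i] /=; [rewrite -ts psrc_tail | exact: zp].
split; first by rewrite psrc_head.
by rewrite pedgesE te mkseq_cons.
Qed.

End Prefixes.

Section Diagonal.
Variables (R : realType) (G : graph) (A : cstarAlgebra R).
Variables (P : vertex G -> A) (S : edge G -> A).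
Hypothesis UA : graph_cstar P S.
Hypotheses (Gsinks : no_sinks G).
Local Notation one := (graph_unit P).
Local Notation Pp p := (P_path P S p).
Local Notation Dg := (Defs.diagonal P S).
Let CK := UA.1.
Let cmul1 := cmul1 UA.
Let c1mul := c1mul UA.

Lemma generated_subalgebra (X : set A) : cstar_subalgebra (generated_by X).
Proof.
split.
- by move=> D sD _; exact: subalg0.
- by move=> a b ha hb D sD XD; apply: subalgD; [|exact: ha|exact: hb].
- by move=> t a ha D sD XD; apply: subalgZ => //; exact: ha.
- by move=> a b ha hb D sD XD; apply: subalgM; [|exact: ha|exact: hb].
- by move=> a ha D sD XD; apply: subalgS => //; exact: ha.
- apply/closed_nrmP => a h D sD XD.
  apply: (closed_nrmP D).1 (subalg_topclosed sD) _ _ => e /h[d hd ad].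
  by exists d => //; exact: hd.
Qed.

Lemma diag_subalg : cstar_subalgebra Dg.
Proof. exact: generated_subalgebra. Qed.

Lemma diag_P l (p : gpath G l) : Dg (Pp p).
Proof. by move=> D sD; apply; exists l, p. Qed.

Lemma diag_ind (C : set A) : cstar_subalgebra C -> (forall l (p : gpath G l), C (Pp p)) ->
  forall d, Dg d -> C d.
Proof. by move=> sC CP d; apply=> // _ [l [p ->]]. Qed.

Lemma diag_one : Dg one.
Proof.
rewrite -(sum_P_path Gsinks CK cmul1 0); apply: (subalg_sum _ diag_subalg) => p _.
exact: diag_P.
Qed.

Lemma P_path_star l (p : gpath G l) : cstar (Pp p) = Pp p.
Proof. by rewrite /P_path cstarM cstarK. Qed.

Lemma P_path_S l (p q : gpath G l) : Pp p ** S_path P S q = if p == q then S_path P S q else 0.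
Proof.
rewrite /P_path -cmulA (S_path_orth CK); case: eqP => [->|_]; last by rewrite cmul0.
exact: S_path_P.
Qed.

Lemma P_path_orth l (p q : gpath G l) : Pp p ** Pp q = if p == q then Pp q else 0.
Proof. by rewrite {2}/P_path cmulA P_path_S; case: eqP => _; rewrite ?c0mul. Qed.

Lemma P_path_front l (p : gpath G l) (q : gpath G l.+1) :
  Pp p ** Pp q = if p == pfront q then Pp q else 0.
Proof.
rewrite {2}/P_path cmulA (S_path_rcons CK cmul1 c1mul) cmulA P_path_S.
by case: eqP => _; rewrite ?c0mul// /P_path (S_path_rcons CK cmul1 c1mul).
Qed.

Lemma P_path_neq0 l (p : gpath G l) : Pp p <> 0.
Proof.
move=> p0; apply: (graph_P_neq0 UA Gsinks (v := prng p)).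
have := S_path_orth CK p p; rewrite eqxx => <-.
by have := P_path_S p p; rewrite eqxx p0 c0mul => <-; rewrite cmul0.
Qed.

Lemma nrm_P_path l (p : gpath G l) : nrm (Pp p) = 1.
Proof.
have := nrm_cstar2 (Pp p); rewrite P_path_star P_path_orth eqxx => /esym/eqP.
rewrite expr2 -subr_eq0 -{3}[nrm _]mulr1 -mulrBr mulf_eq0 subr_eq0 => /orP[/eqP h|/eqP//].
by case: (@P_path_neq0 l p); exact: nrm_eq0.
Qed.

Lemma P_path_refine l (p : gpath G l) : Pp p = \sum_(q | pfront q == p) Pp q.
Proof.
rewrite -[LHS]cmul1 -(sum_P_path Gsinks CK cmul1 l.+1) cmul_sumr [RHS]big_mkcond.
by apply: eq_bigr => q _; rewrite P_path_front eq_sym.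
Qed.

(** The cylinder of p is contained in that of mu if mu is a prefix of z, and disjoint from it
    otherwise. *)
Lemma prefix_P_path l n (mu : gpath G l) (p : gpath G n) z : (l <= n)%N -> is_prefix p z ->
  Pp mu ** Pp p = if `[< is_prefix mu z >] then Pp p else 0.
Proof.
elim: n p => [|n IHn] p ln pz.
  have l0 : l = 0%N by apply/eqP; rewrite -leqn0.
  subst l; rewrite P_path_orth; congr (if _ then _ else _).
  apply/eqP/asboolP => [->//|h]; exact: prefix_inj h pz.
move: ln; rewrite leq_eqVlt => /orP[/eqP ln|ln].
  subst l; rewrite P_path_orth; congr (if _ then _ else _).
  apply/eqP/asboolP => [->//|h]; exact: prefix_inj h pz.
have e : Pp p = Pp (pfront p) ** Pp p by rewrite P_path_front eqxx.
rewrite e cmulA IHn//; last exact: prefix_front.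
by case: ifP => _; rewrite ?c0mul.
Qed.

Section Span.

(** The function on the spectrum with constant value [c p] on the cylinder of p. *)
Definition pspan n (c : gpath G n -> R[i]) : A := \sum_p c p *: Pp p.

Lemma pspan_diag n c : Dg (@pspan n c).
Proof.
rewrite /pspan; apply: (@subalg_sum _ _ Dg _ _ _ _ diag_subalg) => p _.
by apply: (subalgZ diag_subalg); exact: diag_P.
Qed.

Lemma pspanD n (c c' : gpath G n -> R[i]) : pspan c + pspan c' = pspan (fun p => c p + c' p).
Proof. by rewrite /pspan -big_split; apply: eq_bigr => p _; rewrite scalerDl. Qed.

Lemma pspanZ n t (c : gpath G n -> R[i]) : t *: pspan c = pspan (fun p => t * c p).
Proof. by rewrite /pspan scaler_sumr; apply: eq_bigr => p _; rewrite scalerA. Qed.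

Lemma pspanS n (c : gpath G n -> R[i]) : cstar (pspan c) = pspan (fun p => conjc (c p)).
Proof. by rewrite /pspan cstar_sum; apply: eq_bigr => p _; rewrite cstarZ P_path_star. Qed.

Lemma pspanM n (c c' : gpath G n -> R[i]) : pspan c ** pspan c' = pspan (fun p => c p * c' p).
Proof.
rewrite /pspan cmul_suml; apply: eq_bigr => p _; rewrite cmul_sumr (bigD1 p)//=.
rewrite cmulZl cmulZr P_path_orth eqxx scalerA big1 ?addr0// => q /negPf qp.
by rewrite cmulZl cmulZr P_path_orth eq_sym qp !scaler0.
Qed.

Lemma pspan1 n : pspan (fun _ : gpath G n => 1) = one.
Proof. by rewrite -(sum_P_path Gsinks CK cmul1 n); apply: eq_bigr => p _; rewrite scale1r. Qed.

Lemma pspan_delta n (p : gpath G n) : Pp p = pspan (fun q => (q == p)%:R).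
Proof.
rewrite /pspan (bigD1 p)//= eqxx scale1r big1 ?addr0// => q /negPf ->.
by rewrite scale0r.
Qed.

Lemma pspan_refine n (c : gpath G n -> R[i]) :
  pspan c = pspan (fun q : gpath G n.+1 => c (pfront q)).
Proof.
rewrite [RHS](partition_big (@pfront G n) xpredT)//=; apply: eq_bigr => p _.
by rewrite P_path_refine scaler_sumr; apply: eq_bigr => q /eqP ->.
Qed.

Lemma pspan_extend n m (c : gpath G n -> R[i]) :
  exists c' : gpath G (m + n) -> R[i], pspan c = pspan c'.
Proof.
elim: m => [|m [c' h]]; first by exists c.
by exists (fun q : gpath G (m + n).+1 => c' (pfront q)); rewrite h pspan_refine.
Qed.

Lemma pspan_common n m (c : gpath G n -> R[i]) (c' : gpath G m -> R[i]) :
  exists N (d d' : gpath G N -> R[i]), pspan c = pspan d /\ pspan c' = pspan d'.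
Proof.
have [d hd] := pspan_extend m c; have [d' hd'] := pspan_extend n c'.
move: d' hd'; rewrite addnC => d' hd'.
by exists (m + n)%N, d, d'.
Qed.

(** A real function r bounded by 1 is the real part of the unimodular function r + i sqrt(1 - r^2),
    whose span is a unitary. *)
Lemma nrm_pspan_real n (r : gpath G n -> R) : (forall p, `|r p| <= 1) ->
  nrm (pspan (fun p => (r p)%:C)) <= 1.
Proof.
move=> r1.
pose w p : R[i] := (r p +i* Num.sqrt (1 - r p ^+ 2))%C.
have ww p : conjc (w p) * w p = 1.
  have h : 0 <= 1 - r p ^+ 2 by rewrite subr_ge0 -real_normK ?num_real// expr_le1.
  rewrite /w; apply/eqP; rewrite eq_complex /=; apply/andP; split; apply/eqP.
    by have := sqr_sqrtr h; set s := Num.sqrt _; nra.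
  by ring.
have sw : cstar (pspan w) ** pspan w = one.
  by rewrite pspanS pspanM -(pspan1 n); congr pspan; apply: funext.
have nw := nrm_isometry cmul1 sw.
have -> : pspan (fun p => (r p)%:C) = (2^-1 : R)%:C *: (pspan w + cstar (pspan w)).
  rewrite pspanS pspanD pspanZ; congr pspan; apply: funext => p.
  by apply/eqP; rewrite eq_complex /=; apply/andP; split; apply/eqP; field.
rewrite nrmZ cmod_real ger0_norm ?invr_ge0//.
have := nrmD (pspan w) (cstar (pspan w)); rewrite nrm_cstar.
by move: nw; set x := nrm _; set y := nrm _; lra.
Qed.

(** After scaling to M = 1, the C*-identity replaces c by the real function |c|^2. *)
Lemma nrm_pspan n (c : gpath G n -> R[i]) (M : R) : 0 < M -> (forall p, cmod (c p) <= M) ->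
  nrm (pspan c) <= M.
Proof.
move=> M0 cM.
have -> : pspan c = M%:C *: pspan (fun p => (M^-1)%:C * c p).
  rewrite pspanZ; congr pspan; apply: funext => p.
  by rewrite mulrA -rmorphM mulfV ?mul1r// gt_eqF.
rewrite nrmZ cmod_real gtr0_norm// ler_piMr ?(ltW M0)//.
rewrite -(@ler_pXn2r _ 2) ?nnegrE ?nrm_ge0// expr1n -nrm_cstar2 pspanS pspanM.
under [X in pspan X]eq_fun do rewrite mul_conjc.
apply: nrm_pspan_real => p; rewrite ger0_norm ?sqr_ge0// expr_le1 ?cmod_ge0//.
by rewrite cmodM cmod_real gtr0_norm ?invr_gt0// mulrC ler_pdivrMr// mul1r.
Qed.

Lemma diag_approx d : Dg d -> forall e : R, 0 < e ->
  exists n (c : gpath G n -> R[i]), nrm (d - pspan c) <= e.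
Proof.
pose C := [set a : A | forall e : R, 0 < e ->
  exists n (c : gpath G n -> R[i]), nrm (a - pspan c) <= e].
apply: (diag_ind (C := C)) => [|l p e e0]; last first.
  by exists l, (fun q => (q == p)%:R); rewrite -pspan_delta subrr nrm0 ltW.
split.
- move=> e e0; exists 0%N, (fun=> 0); rewrite /pspan big1 ?subrr ?nrm0 ?ltW// => p _.
  by rewrite scale0r.
- move=> a b ha hb e e0; have e2 : 0 < e / 2 by rewrite divr_gt0.
  have [n [c hc]] := ha _ e2; have [m [c' hc']] := hb _ e2.
  have [N [d1 [d2 [h1 h2]]]] := pspan_common c c'.
  exists N, (fun p => d1 p + d2 p); rewrite -pspanD -h1 -h2 opprD addrACA.
  by rewrite (le_trans (nrmD _ _))// [e]splitr lerD.
- move=> t a ha e e0; have t1 : 0 < cmod t + 1 by rewrite ltr_wpDl ?cmod_ge0.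
  have [n [c hc]] := ha _ (divr_gt0 e0 t1); exists n, (fun p => t * c p).
  rewrite -pspanZ -scalerBr nrmZ (le_trans (ler_wpM2l (cmod_ge0 t) hc))//.
  by rewrite mulrCA ler_piMr ?(ltW e0)// ler_pdivrMr// mul1r lerDl.
- move=> a b ha hb e e0.
  have K0 : 0 < nrm a + nrm b + 1 by rewrite ltr_wpDl ?addr_ge0 ?nrm_ge0.
  (* The error of the product is at most de |b| + (|a| + 1) de; de <= 1 ensures that the approximant
     of a has norm at most |a| + 1. *)
  pose de := Num.min 1 (e / (nrm a + nrm b + 1)).
  have d0 : 0 < de by rewrite lt_min ltr01 divr_gt0.
  have d1 : de <= 1 by rewrite ge_min lexx.
  have dK : de * (nrm a + nrm b + 1) <= e by rewrite -ler_pdivlMr// ge_min lexx orbT.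
  have [n [c hc]] := ha _ d0; have [m [c' hc']] := hb _ d0.
  have [N [x [y [h1 h2]]]] := pspan_common c c'.
  exists N, (fun p => x p * y p); rewrite -pspanM -h1 -h2.
  have -> : a ** b - pspan c ** pspan c' = (a - pspan c) ** b + pspan c ** (b - pspan c').
    by rewrite cmulBl cmulBr addrA subrK.
  have nc : nrm (pspan c) <= nrm a + 1.
    by have := nrm_trans a (pspan c) 0; rewrite !subr0 nrmBC; move: hc d1; lra.
  rewrite (le_trans _ dK)// (le_trans (nrmD _ _))//.
  have -> : de * (nrm a + nrm b + 1) = de * nrm b + (nrm a + 1) * de by ring.
  by rewrite lerD// (le_trans (nrmM _ _))// ler_pM ?nrm_ge0.
- move=> a ha e /ha[n [c hc]]; exists n, (fun p => conjc (c p)).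
  by rewrite -pspanS -cstarB nrm_cstar.
- apply/closed_nrmP => a ha e e0; have e2 : 0 < e / 2 by rewrite divr_gt0.
  have [b hb ab] := ha _ e2; have [n [c hc]] := hb _ e2; exists n, c.
  by rewrite (le_trans (nrm_trans b _ _))// [e]splitr lerD.
Qed.

End Span.
End Diagonal.

(** * Points of the spectrum as characters *)

Section Characters.
Variables (R : realType) (G : graph) (A : cstarAlgebra R).
Variables (P : vertex G -> A) (S : edge G -> A).
Hypothesis UA : graph_cstar P S.
Hypotheses (Gsinks : no_sinks G).
Local Notation one := (graph_unit P).
Local Notation Pp p := (P_path P S p).
Local Notation Dg := (Defs.diagonal P S).
Let CK := UA.1.
Let cmul1 := cmul1 UA.
Let c1mul := c1mul UA.
Let sDg : cstar_subalgebra Dg := @diag_subalg R G A P S.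

Section LocalValue.
Variables (z : nat -> edge G) (q : forall n, gpath G n).
Hypothesis qP : forall n, is_prefix (q n) z.

(* [t] is the value of [d] at the point [z] of the spectrum: [d] is close to the scalar [t] on
   small cylinders around [z]. *)
Definition value_at (d : A) (t : R[i]) := forall e : R, 0 < e -> exists N : nat,
  forall n, (N <= n)%N -> nrm ((d - t *: one) ** Pp (q n)) <= e /\
                          nrm (Pp (q n) ** (d - t *: one)) <= e.

Lemma value_at_mul (d : A) (t : R[i]) (c : R) : (forall e : R, 0 < e -> exists N : nat,
   forall n, (N <= n)%N -> nrm ((d - t *: one) ** Pp (q n)) <= e * c /\
                          nrm (Pp (q n) ** (d - t *: one)) <= e * c) -> value_at d t.
Proof.
move=> h e e0; have c0 : 0 < `|c| + 1 by rewrite ltr_wpDl.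
have [N hN] := h _ (divr_gt0 e0 c0); exists N => n /hN[h1 h2].
have k : e / (`|c| + 1) * c <= e.
  rewrite mulrAC ler_pdivrMr// ler_pM2l// (le_trans (ler_norm c))//.
  by rewrite lerDl.
by split; [exact: le_trans h1 k | exact: le_trans h2 k].
Qed.

(** The projection of a cylinder is nonzero, hence of norm exactly 1, so multiplying by it turns the
    scalar t - t' into an element of norm |t - t'|. *)
Lemma value_at_dist d d' t t' : value_at d t -> value_at d' t' -> cmod (t - t') <= nrm (d - d').
Proof.
move=> ht ht'; rewrite -subr_le0; apply: (@le0_of_small _ _ 2) => e e0.
have [N hN] := ht _ e0; have [N' hN'] := ht' _ e0.
have [h1 _] := hN _ (leq_maxl N N'); have [h2 _] := hN' _ (leq_maxr N N').
set n := maxn N N' in h1 h2.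
have tE : (t - t') *: Pp (q n) = (d - d') ** Pp (q n) - (d - t *: one) ** Pp (q n)
    + (d' - t' *: one) ** Pp (q n).
  rewrite !cmulBl !cmulZl c1mul scalerBl.
  by rewrite opprB [d ** _ - _ + _]addrC !addrA !subrK.
have := nrmZ (t - t') (Pp (q n)); rewrite nrm_P_path// mulr1 => <-; rewrite tE.
have := nrmD ((d - d') ** Pp (q n) - (d - t *: one) ** Pp (q n)) ((d' - t' *: one) ** Pp (q n)).
have := nrmB ((d - d') ** Pp (q n)) ((d - t *: one) ** Pp (q n)).
have := nrmM (d - d') (Pp (q n)); rewrite nrm_P_path// mulr1; lra.
Qed.

Lemma value_at_unique d t t' : value_at d t -> value_at d t' -> t = t'.
Proof.
move=> h h'; apply/eqP; rewrite -subr_eq0 -cmod_eq0 eq_le cmod_ge0 andbT.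
by have := value_at_dist h h'; rewrite subrr nrm0.
Qed.

Lemma value_at_P_path l (mu : gpath G l) : value_at (Pp mu) (`[< is_prefix mu z >])%:R.
Proof.
move=> e e0; exists l => n ln.
have h := prefix_P_path UA mu ln (qP n).
have h' : Pp (q n) ** Pp mu = (if `[< is_prefix mu z >] then Pp (q n) else 0).
  rewrite -[LHS]cstarK cstarM !P_path_star h.
  by case: ifP; rewrite ?cstar0 ?P_path_star.
rewrite cmulBl cmulBr cmulZl cmulZr c1mul cmul1 h h'.
by case: asboolP => _; rewrite ?scale1r ?scale0r subrr nrm0 ltW.
Qed.

Lemma value_atD a b s t : value_at a s -> value_at b t -> value_at (a + b) (s + t).
Proof.
move=> ha hb; apply: (@value_at_mul _ _ 2) => e e0.
have [N hN] := ha _ e0; have [N' hN'] := hb _ e0; exists (maxn N N') => n.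
rewrite geq_max => /andP[/hN[a1 a2] /hN'[b1 b2]].
have -> : a + b - (s + t) *: one = (a - s *: one) + (b - t *: one).
  by rewrite scalerDl opprD addrACA.
rewrite cmulDl cmulDr mulr_natr mulr2n.
by split; rewrite (le_trans (nrmD _ _))// lerD.
Qed.

Lemma value_atZ c a t : value_at a t -> value_at (c *: a) (c * t).
Proof.
move=> ha; apply: (@value_at_mul _ _ (cmod c)) => e e0.
have [N hN] := ha _ e0; exists N => n /hN[a1 a2].
rewrite -scalerA -scalerBr cmulZl cmulZr !nrmZ.
by split; rewrite (mulrC e) ler_wpM2l ?cmod_ge0.
Qed.

(** Two factorizations of a b - s t, one per side, each placing the small factor next to the
    projection. *)
Lemma value_atM a b s t : value_at a s -> value_at b t -> value_at (a ** b) (s * t).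
Proof.
move=> ha hb; apply: (@value_at_mul _ _ (nrm a + cmod t + nrm b + cmod s)) => e e0.
have [N hN] := ha _ e0; have [N' hN'] := hb _ e0; exists (maxn N N') => n.
rewrite geq_max => /andP[/hN[a1 a2] /hN'[b1 b2]].
have e1 : a ** b - (s * t) *: one = a ** (b - t *: one) + t *: (a - s *: one).
  by rewrite cmulBr cmulZr cmul1 scalerBr scalerA (mulrC t) addrA subrK.
have e2 : a ** b - (s * t) *: one = (a - s *: one) ** b + s *: (b - t *: one).
  by rewrite cmulBl cmulZl c1mul scalerBr scalerA addrA subrK.
have := nrm_ge0 a; have := nrm_ge0 b; have := cmod_ge0 s; have := cmod_ge0 t => t0 s0 b0 a0.
split.
  rewrite e1 cmulDl -cmulA cmulZl (le_trans (nrmD _ _))// nrmZ.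
  rewrite (le_trans (lerD (nrmM _ _) (lexx _)))//.
  rewrite (le_trans (lerD (ler_wpM2l a0 b1) (ler_wpM2l t0 a1)))//.
  by move: (nrm a) (nrm b) (cmod s) (cmod t) a0 b0 s0 t0 => p r x y *; nra.
rewrite e2 cmulDr cmulA cmulZr (le_trans (nrmD _ _))// nrmZ.
rewrite (le_trans (lerD (nrmM _ _) (lexx _)))//.
rewrite (le_trans (lerD (ler_wpM2r b0 a2) (ler_wpM2l s0 b2)))//.
by move: (nrm a) (nrm b) (cmod s) (cmod t) a0 b0 s0 t0 => p r x y *; nra.
Qed.

(** Adjoints exchange the two one-sided estimates of [value_at]. *)
Lemma value_atS a t : value_at a t -> value_at (cstar a) (conjc t).
Proof.
move=> ha e /ha[N hN]; exists N => n /hN[a1 a2].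
have e1 : cstar a - conjc t *: one = cstar (a - t *: one).
  by rewrite cstarB cstarZ (graph_unit_star UA).
rewrite e1 -{1}(P_path_star P S (q n)) -{2}(P_path_star P S (q n)) -!cstarM !nrm_cstar.
by split.
Qed.

(** By [value_at_dist] the values of approximants form a Cauchy sequence, whose limit is the value
    of a. *)
Lemma value_at_closed a :
  (forall e : R, 0 < e -> exists2 d, (exists t, value_at d t) & nrm (a - d) <= e) ->
  exists t, value_at a t.
Proof.
move=> h.
have /choice[u hu] n : exists dt : A * R[i], value_at dt.1 dt.2 /\ nrm (a - dt.1) <= n.+1%:R^-1.
  have [|d [t dt] ad] := h n.+1%:R^-1; first by rewrite invr_gt0.
  by exists (d, t).
have near e : 0 < e -> exists N : nat, forall n, (N <= n)%N -> nrm (a - (u n).1) <= e.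
  move=> /pos_small[N hN]; exists N => n Nn; rewrite (le_trans (hu n).2)//.
  by rewrite (le_trans _ (ltW hN))// lef_pV2 ?posrE// ler_nat.
have [|t [_ _ ht]] := @Cseq_complete R (fun n => (u n).2).
  move=> e e0; have [N hN] := near _ (divr_gt0 e0 (ltr0n R 2)); exists N => m n /hN m1 /hN n1.
  rewrite (le_trans (value_at_dist (hu m).1 (hu n).1))//.
  by rewrite (le_trans (nrm_trans a _ _))// nrmBC [e]splitr lerD.
exists t; apply: (@value_at_mul _ _ 3) => e e0.
have [N hN] := near _ e0; have [N' hN'] := ht _ e0.
have h1 := hN _ (leq_maxl N N'); have h2 := hN' _ (leq_maxr N N').
set j := maxn N N' in h1 h2.
have [M hM] := (hu j).1 _ e0; exists M => n /hM[b1 b2].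
have -> : a - t *: one = (a - (u j).1) + ((u j).1 - (u j).2 *: one) + ((u j).2 - t) *: one.
  by rewrite scalerBl !addrA !subrK.
move: b1 b2; move: (_ - (u j).2 *: one) => Y b1 b2.
have : nrm (a - (u j).1) <= e by [].
move: (a - (u j).1) => X X1; set p := Pp (q n).
have np : nrm p = 1 by exact: nrm_P_path.
have k1 : nrm (X ** p) <= e by rewrite (le_trans (nrmM _ _))// np mulr1.
have k2 : nrm (p ** X) <= e by rewrite (le_trans (nrmM _ _))// np mul1r.
have k3 : nrm (((u j).2 - t) *: p) <= e by rewrite nrmZ np mulr1.
rewrite !cmulDl !cmulDr cmulZl cmulZr c1mul cmul1.
have -> : e * 3 = e + e + e by ring.
by split; rewrite (le_trans (nrmD _ _))// lerD// (le_trans (nrmD _ _))// lerD.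
Qed.

Lemma value_at_exists d : Dg d -> exists t, value_at d t.
Proof.
apply: (diag_ind (C := [set d | exists t, value_at d t])) => [|l p]; last first.
  by eexists; exact: value_at_P_path.
split.
- exists 0 => e e0; exists 0%N => n _.
  by rewrite scale0r subrr c0mul cmul0 nrm0 ltW.
- by move=> a b [s hs] [t ht]; exists (s + t); exact: value_atD.
- by move=> c a [t ht]; exists (c * t); exact: value_atZ.
- by move=> a b [s hs] [t ht]; exists (s * t); exact: value_atM.
- by move=> a [t ht]; exists (conjc t); exact: value_atS.
- by apply/closed_nrmP => a; exact: value_at_closed.
Qed.

End LocalValue.

Definition prefix_character (z : nat -> edge G) (chi : A -> R[i]) :=
  character_on Dg chi /\ forall l (p : gpath G l),
    (is_prefix p z -> chi (Pp p) = 1) /\ (~ is_prefix p z -> chi (Pp p) = 0).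

Lemma exists_prefix_character z : infinite_paths G z -> exists chi, prefix_character z chi.
Proof.
move=> zp; pose q n := projT1 (cid (exists_prefix n zp)).
have qP n : is_prefix (q n) z := projT2 (cid (exists_prefix n zp)).
have /choice[chi hchi] d : exists t, Dg d -> value_at q d t.
  have [/(value_at_exists qP)[t ht]|nd] := pselect (Dg d); first by exists t.
  by exists 0.
have chiE d t : Dg d -> value_at q d t -> chi d = t.
  by move=> hd ht; exact: (value_at_unique (hchi d hd) ht).
have chiP l (p : gpath G l) : chi (Pp p) = (`[< is_prefix p z >])%:R.
  by apply: chiE; [exact: diag_P | exact: value_at_P_path].
exists chi; split; last first.
  by move=> l p; split=> h; rewrite chiP; [rewrite asboolT|rewrite asboolF].
split.
- by move=> a b da db; apply: chiE; [exact: (subalgD sDg)|apply: value_atD; exact: hchi].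
- by move=> t a da; apply: chiE; [exact: (subalgZ sDg)|apply: value_atZ; exact: hchi].
- by move=> a b da db; apply: chiE; [exact: (subalgM sDg)|apply: value_atM; exact: hchi].
- by move=> a da; apply: chiE; [exact: (subalgS sDg)|apply: value_atS; exact: hchi].
- exists (Pp (q 0%N)); first exact: diag_P.
  by rewrite chiP asboolT//; apply/eqP; rewrite oner_eq0.
Qed.

Lemma point_charP z : infinite_paths G z -> prefix_character z (point_char P S z).
Proof.
move=> /exists_prefix_character[chi hchi]; rewrite /point_char.
by case: xgetP => [f _ //|h]; case: (h chi).
Qed.

Lemma char_bound chi d : character_on Dg chi -> Dg d -> cmod (chi d) <= 2 * nrm d.
Proof.
exact: (character_bound cmul1 c1mul sDg (diag_one UA Gsinks)).
Qed.

Lemma charB chi a b : character_on Dg chi -> Dg a -> Dg b -> chi (a - b) = chi a - chi b.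
Proof.
move=> hc da db; rewrite -scaleN1r (Defs.charD hc)//; last exact: (subalgZ sDg).
by rewrite (charZ hc)// mulN1r.
Qed.

Lemma char_pspan chi n (c : gpath G n -> R[i]) : character_on Dg chi ->
  chi (pspan P S c) = \sum_p c p * chi (Pp p).
Proof.
move=> hc; have d0 : Dg 0 by exact: (subalg0 sDg).
suff [_ ->] : Dg (pspan P S c) /\ chi (pspan P S c) = \sum_p c p * chi (Pp p) by [].
rewrite /pspan; elim/big_rec2: _ => [|p x y _ [dy <-]].
  by split=> //; have := charZ hc 0 d0; rewrite scale0r mul0r.
have dp : Dg (c p *: Pp p) by apply: (subalgZ sDg); exact: diag_P.
split; first exact: (subalgD sDg).
by rewrite (Defs.charD hc)// (charZ hc)//; exact: diag_P.
Qed.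

(** The two characters agree on the spans of cylinder projections, which are dense, and both are
    continuous. *)
Lemma prefix_character_unique z chi chi' d : prefix_character z chi -> prefix_character z chi' ->
  Dg d -> chi d = chi' d.
Proof.
move=> [hc hz] [hc' hz'] dd; apply/eqP; rewrite -subr_eq0 -cmod_eq0 eq_le cmod_ge0 andbT.
apply: (@le0_of_small _ _ 4) => e e0; have [n [c ce]] := diag_approx UA Gsinks dd e0.
have dc : Dg (pspan P S c) by exact: pspan_diag.
have cc : chi (pspan P S c) = chi' (pspan P S c).
  rewrite !char_pspan//; apply: eq_bigr => p _; congr (_ * _).
  have [h|h] := pselect (is_prefix p z).
    by rewrite (hz _ _).1// (hz' _ _).1.
  by rewrite (hz _ _).2// (hz' _ _).2.
have -> : chi d - chi' d = chi (d - pspan P S c) - chi' (d - pspan P S c).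
  by rewrite !charB// cc opprB addrA subrK.
have dm : Dg (d - pspan P S c) by exact: (subalgB sDg).
have := char_bound hc dm; have := char_bound hc' dm.
have := cmodD (chi (d - pspan P S c)) (- chi' (d - pspan P S c)); rewrite cmodN.
by move: ce; lra.
Qed.

(** Approximate d by a span: its coefficient at p is its value at any infinite path extending p, so
    it is at most M + 2e, the 2 coming from [char_bound]. *)
Lemma diag_norm_bound d (M : R) : Dg d -> 0 <= M ->
  (forall z, infinite_paths G z -> cmod (point_char P S z d) <= M) -> nrm d <= M.
Proof.
move=> dd M0 h; rewrite -subr_le0; apply: (@le0_of_small _ _ 3) => e e0.
have [n [c ce]] := diag_approx UA Gsinks dd e0.
have dc : Dg (pspan P S c) by exact: pspan_diag.
suff : nrm (pspan P S c) <= M + 2 * e.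
  by have := nrm_trans (pspan P S c) d 0; rewrite !subr0; move: ce; lra.
apply: (nrm_pspan UA Gsinks); first by lra.
move=> p; have [z [zp pz]] := exists_extension p Gsinks.
have [hc hz] := point_charP zp.
have -> : c p = point_char P S z (pspan P S c).
  rewrite char_pspan// (bigD1 p)//= (hz _ _).1// mulr1 big1 ?addr0// => r rp.
  rewrite (hz _ _).2 ?mulr0// => rz; case/negP: rp; apply/eqP; exact: prefix_inj rz pz.
have dm : Dg (pspan P S c - d) by exact: (subalgB sDg).
have := char_bound hc dm; rewrite nrmBC (charB hc)// => k1.
have := cmodD (point_char P S z d) (point_char P S z (pspan P S c) - point_char P S z d).
by rewrite addrC subrK; have := h z zp; move: ce; lra.
Qed.

Lemma diag_eq d d' : Dg d -> Dg d' ->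
  (forall z, infinite_paths G z -> point_char P S z d = point_char P S z d') -> d = d'.
Proof.
move=> dd dd' h; apply/eqP; rewrite -subr_eq0; apply/eqP/nrm_eq0/eqP.
rewrite eq_le nrm_ge0 andbT; apply: diag_norm_bound => //; first exact: (subalgB sDg).
move=> z zp; have [hc _] := point_charP zp.
by rewrite charB// h// subrr /cmod normr0.
Qed.

End Characters.

(** * The action of lambda on the spectrum of the diagonal *)

Section Coding.
Variables (G : graph) (k : nat) (tau : {perm gpath G k.+1}).
Hypotheses (Gsinks : no_sinks G) (tauE : endpoint_fixing tau).

(* [y] is the path [beta f_0 f_1 ...], where [beta] is the source of the path [w] of the
   permutation graph and the [f_i] are its second labels. *)
Definition coded (w : nat -> gpath G k.+1) (y : nat -> edge G) :=
  [/\ infinite_paths G y, is_prefix (pfront (tau (w 0%N))) y &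
      forall i, y (k + i)%N = plast (tau (w i))].

Lemma tpath_heads w : tpath tau w -> infinite_paths G (fun i => phead (w i)).
Proof. by move=> hw i /=; rewrite -psrc_tail hw (psrc_front_tau tauE). Qed.

Lemma tpathS w : tpath tau w -> tpath tau (w \o succn).
Proof. by move=> hw i; exact: (hw i.+1). Qed.

Lemma walk_nth (e : edge G) v s i : walk v s -> (i.+1 < size s)%N ->
  rng (nth e s i) = src (nth e s i.+1).
Proof.
elim: s v i => // f s IHs v [|i] /= /andP[_ ws]; last by move=> si; exact: IHs ws _.
by case: s ws {IHs} => //= g s /andP[/eqP ->].
Qed.

Lemma exists_coded w : tpath tau w -> exists y, coded w y.
Proof.
move=> hw; pose e0 := phead (w 0%N).
pose y j := if (j < k)%N then nth e0 (pedges (pfront (tau (w 0%N)))) j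
            else plast (tau (w (j - k)%N)).
have yk i : y (k + i)%N = plast (tau (w i)) by rewrite /y ltnNge leq_addr /= addKn.
(* The first k + 1 edges of y form tau(w 0), so y is a path that far. *)
have ye : tval (pedges (tau (w 0%N))) = mkseq y k.+1.
  have y0 : y k = plast (tau (w 0%N)) by rewrite -yk addn0.
  rewrite pedges_front mkseqS y0; congr rcons.
  set s := pedges (pfront _); rewrite -[LHS](mkseq_nth e0) size_tuple.
  apply/eq_in_map => j; rewrite mem_iota => /andP[_ jk].
  by rewrite /y jk.
have yp : is_prefix (tau (w 0%N)) y.
  split=> //; rewrite psrc_head; congr src.
  by have := ye; rewrite pedgesE mkseq_cons => -[].
exists y; split=> //; last exact: prefix_front.
move=> j /=; have [jk|kj] := ltnP j k.
  have := @walk_nth e0 _ _ j (walk_psrc (tau (w 0%N))).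
  rewrite size_tuple ltnS => /(_ jk); rewrite ye !nth_mkseq//.
  exact: ltnW.
(* Beyond k, consecutive second labels compose because tau keeps the range of [w (j - k)] and the
   next edge starts at its tail. *)
rewrite -(subnKC kj) -addnS !yk -prng_front -hw prng_tail -prng_last.
by have [_ ->] := (endpoint_fixingP tau).1 tauE (w (j - k)%N).
Qed.

Lemma exists_decoded y : infinite_paths G y -> exists w, tpath tau w /\ coded w y.
Proof.
move=> yp.
have /choice[st stP] (ai : gpath G k * nat) : exists p : gpath G k.+1,
    prng ai.1 = src (y (k + ai.2)%N) -> pfront (tau p) = ai.1 /\ plast (tau p) = y (k + ai.2)%N.
  have [h|h] := pselect (prng ai.1 = src (y (k + ai.2)%N)); last first.
    by have [p _] := exists_gpath k.+1 (src (y 0%N)) Gsinks; exists p.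
  have [p [? ?]] := exists_prcons (esym h).
  by exists (tau^-1 p)%g; rewrite permKV.
have [q qy] := exists_prefix k.+1 yp.
(* The successive vertices, starting from the first k edges of y: the edge leaving [a n] with second
   label y_(k+n) is unique and leads to [a n.+1]. *)
pose a := fix a n := if n is n'.+1 then ptail (st (a n', n')) else pfront q.
have key n : prng (a n) = src (y (k + n)%N).
  elim: n => [|n IHn] /=.
    rewrite prng_front addn0; congr src; have [_] := qy.
    by rewrite pedges_front mkseqS => /eqP; rewrite eqseq_rcons => /andP[_ /eqP].
  have [_ h] := stP (a n, n) IHn.
  rewrite prng_tail; have [_ <-] := (endpoint_fixingP tau).1 tauE (st (a n, n)).
  by rewrite prng_last h /= yp addnS.
exists (fun n => st (a n, n)); split=> [n|]; first by rewrite (stP (a n.+1, n.+1) (key _)).1.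
split=> // [|i]; last by rewrite (stP (a i, i) (key _)).2.
by rewrite (stP (a 0%N, 0%N) (key _)).1; exact: prefix_front.
Qed.

Lemma mkseqD (T : Type) (f : nat -> T) n l :
  mkseq f (n + l) = mkseq f n ++ mkseq (fun i => f (n + i)%N) l.
Proof. by rewrite /mkseq iotaD map_cat add0n -[in iota n l](addn0 n) iotaDl -map_comp. Qed.

Lemma coded_upto l (nu : gpath G l) w w' y y' : coded w y -> coded w' y' ->
  pfront (tau (w 0%N)) = pfront (tau (w' 0%N)) -> (forall i, (i < l)%N -> w i = w' i) ->
  is_prefix nu y -> is_prefix nu y'.
Proof.
move=> [_ [b1 b2] yw] [_ [b1' b2'] yw'] ww0 ww [ns ne]; split.
  by rewrite ns -b1 ww0.
rewrite ne; apply/eq_in_map => j; rewrite mem_iota add0n => /andP[_ jl].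
have [jk|kj] := ltnP j k.
  by rewrite -(nth_mkseq (y 0%N) y jk) -(nth_mkseq (y 0%N) y' jk) -b2 -b2' ww0.
by rewrite -(subnKC kj) yw yw' ww// (leq_ltn_trans (leq_subr _ _)).
Qed.

End Coding.

(** * The endomorphism restricted to the diagonal *)

Section DiagonalEndomorphism.
Variables (R : realType) (G : graph) (A : cstarAlgebra R).
Variables (P : vertex G -> A) (S : edge G -> A).
Hypothesis UA : graph_cstar P S.
Hypotheses (Gsinks : no_sinks G) (Gsources : no_sources G).
Variables (k : nat) (tau : {perm gpath G k.+1}).
Hypothesis tauE : endpoint_fixing tau.
Local Notation one := (graph_unit P).
Local Notation Pp p := (P_path P S p).
Local Notation Dg := (Defs.diagonal P S).
Local Notation U := (U_perm P S tau).
Local Notation lam := (Defs.lambda P S tau).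
Local Notation pc := (point_char P S).
Let CK := UA.1.
Let cmul1 := cmul1 UA.
Let c1mul := c1mul UA.
Let sDg : cstar_subalgebra Dg := @diag_subalg R G A P S.
Let lamH : star_hom lam := lambda_hom UA Gsinks tauE.

Let UU : cstar U ** U = one := U_perm_starU Gsinks CK cmul1 c1mul tauE.

(** U permutes the first k + 1 edges and keeps the remaining ones. *)
Lemma U_perm_long n (q : gpath G (n + k.+1)) : exists q' : gpath G (n + k.+1),
  prng q' = prng q /\ U ** S_path P S q = S_path P S q'.
Proof.
elim: n q => [|n IHn] q.
  by exists (tau q); rewrite (U_perm_S CK tauE) ((endpoint_fixingP tau).1 tauE q).2.
have [r [rq Ur]] := IHn (pfront q).
have [|q' [qf ql]] := @exists_prcons G _ (plast q) r; first by rewrite rq prng_front.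
exists q'; rewrite !(S_path_rcons CK cmul1 c1mul) cmulA Ur qf ql; split=> //.
by rewrite !prng_last ql.
Qed.

Lemma U_perm_P_diag l (p : gpath G l) : Dg (U ** Pp p ** cstar U).
Proof.
(* Short cylinders are split into longer ones until the length reaches k + 1; j bounds the length
   still missing. *)
suff key j : forall l (p : gpath G l), (k.+1 <= l + j)%N -> Dg (U ** Pp p ** cstar U).
  by apply: (key k.+1); exact: leq_addl.
elim: j => [|j IHj] {}l {}p; last first.
  move=> kl; rewrite (P_path_refine UA Gsinks) cmul_sumr cmul_suml.
  apply: (subalg_sum _ sDg) => q _; apply: IHj.
  by rewrite addSnnS.
rewrite addn0 => /subnK lE; rewrite -lE in p *.
have [q [_ Uq]] := U_perm_long p.
by rewrite /P_path cmulA Uq -cmulA -cstarM Uq; exact: diag_P.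
Qed.

Lemma P_vertex_comm v l (p : gpath G l) : P v ** Pp p = Pp p ** P v.
Proof.
have h : P v ** Pp p = if psrc p == v then Pp p else 0.
  by rewrite /P_path cmulA (P_S_pathE CK); case: eqP; rewrite ?c0mul.
rewrite h -[RHS]cstarK cstarM P_path_star (ck_starP CK) h.
by case: eqP; rewrite ?P_path_star ?cstar0.
Qed.

(** For V = U S_e one has V* V = P_(r(e)), so d -> V d V* is multiplicative only where this
    projection can be moved past d. The commutation is therefore carried along in the induction. *)
Lemma U_S_diag e d : Dg d -> Dg ((U ** S e) ** d ** cstar (U ** S e)).
Proof.
have [V VE] : exists V, V = U ** S e by exists (U ** S e).
rewrite -VE; have VV : cstar V ** V = P (rng e).
  by rewrite VE cstarM -cmulA (cmulA (cstar U)) UU c1mul (ck_initial CK).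
have VP : V ** P (rng e) = V by rewrite VE -cmulA (ck_SP CK).
pose C := [set d | Dg (V ** d ** cstar V) /\ P (rng e) ** d = d ** P (rng e)].
suff h : Dg d -> C d by move=> /h[].
apply: diag_ind => [|l p]; last first.
  split; last exact: P_vertex_comm.
  have -> : V ** Pp p ** cstar V =
      (U ** (S e ** S_path P S p)) ** cstar (U ** (S e ** S_path P S p)).
    by rewrite VE /P_path !cstarM !cmulA.
  have [ps|/eqP ps] := eqVneq (psrc p) (rng e); last first.
    by rewrite (S_S_path_eq0 CK ps) cmul0 c0mul; exact: (subalg0 sDg).
  have [q [<- <-]] := exists_pcons ps.
  rewrite -(S_path_cons CK) cstarM !cmulA -(cmulA U).
  exact: U_perm_P_diag.
split.
- by rewrite /C /= !(c0mul, cmul0); split=> //; exact: (subalg0 sDg).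
- move=> a b [ha ca] [hb cb]; split; last by rewrite cmulDr cmulDl ca cb.
  by rewrite cmulDr cmulDl; exact: (subalgD sDg).
- move=> t a [ha ca]; split; last by rewrite cmulZr cmulZl ca.
  by rewrite cmulZr cmulZl; exact: (subalgZ sDg).
- move=> a b [ha ca] [hb cb]; split; last by rewrite cmulA ca -cmulA cb cmulA.
  have -> : V ** (a ** b) ** cstar V = (V ** a ** cstar V) ** (V ** b ** cstar V).
    rewrite !cmulA -[in RHS](cmulA _ (cstar V) V) VV -[in RHS](cmulA V a) -ca.
    by rewrite [in RHS](cmulA V (P _)) VP.
  exact: (subalgM sDg).
- move=> a [ha ca]; split; last first.
    by rewrite -[LHS]cstarK cstarM cstarK (ck_starP CK) -ca cstarM (ck_starP CK).
  have -> : V ** cstar a ** cstar V = cstar (V ** a ** cstar V).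
    by rewrite !cstarM cstarK cmulA.
  exact: (subalgS sDg).
- apply/closed_nrmP => a h; split.
    apply: (closed_nrmP Dg).1 (subalg_topclosed sDg) _ _ => e' e0.
    pose K := nrm V * nrm V + 1.
    have K0 : 0 < K by rewrite ltr_wpDl// mulr_ge0 ?nrm_ge0.
    have [b [hb _] ab] := h _ (divr_gt0 e0 K0); exists (V ** b ** cstar V) => //.
    rewrite -cmulBl -cmulBr (le_trans (nrmM _ _))// nrm_cstar.
    rewrite (le_trans (ler_wpM2r (nrm_ge0 _) (nrmM _ _)))// mulrAC.
    rewrite (le_trans (ler_wpM2l _ ab)) ?mulr_ge0 ?nrm_ge0//.
    by rewrite mulrCA ler_piMr ?(ltW e0)// ler_pdivrMr// mul1r lerDl.
  apply: (@nrm_small_eq _ _ _ _ (2 * nrm (P (rng e)))) => e' e0.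
  have [b [_ cb] ab] := h _ e0.
  rewrite (le_trans (nrm_trans (P (rng e) ** b) _ _))// {2}cb -cmulBr -cmulBl.
  rewrite mulrCA mulr_natl mulr2n lerD// (le_trans (nrmM _ _))//.
    by rewrite mulrC ler_wpM2r ?nrm_ge0.
  by rewrite nrmBC ler_wpM2r ?nrm_ge0.
Qed.

Lemma lambda_P_path l (p : gpath G l.+1) :
  lam (Pp p) = (U ** S (phead p)) ** lam (Pp (ptail p)) ** cstar (U ** S (phead p)).
Proof.
rewrite -(lambda_S UA Gsinks tauE) -(star_homS lamH) -!(star_homM lamH); congr lam.
by rewrite /P_path (S_path_cons CK) cstarM !cmulA.
Qed.

Lemma P_path0 (p : gpath G 0) : Pp p = P (psrc p).
Proof. by rewrite /P_path /S_path tuple0 /= (ck_starP CK) (ck_PP CK) eqxx. Qed.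

Lemma lambda_diag d : Dg d -> Dg (lam d).
Proof.
apply: (diag_ind (C := [set d | Dg (lam d)])) => [|l p] /=; last first.
  elim: l p => [|l IHl] p; last by rewrite lambda_P_path; apply: U_S_diag.
  by rewrite P_path0 (lambda_P UA Gsinks Gsources tauE) -P_path0; exact: diag_P.
split=> /=.
- by rewrite (star_hom0 lamH); exact: (subalg0 sDg).
- by move=> a b ha hb; rewrite (star_homD lamH); exact: (subalgD sDg).
- by move=> t a ha; rewrite (star_homZ lamH); exact: (subalgZ sDg).
- by move=> a b ha hb; rewrite (star_homM lamH); exact: (subalgM sDg).
- by move=> a ha; rewrite (star_homS lamH); exact: (subalgS sDg).
- apply/closed_nrmP => a h.
  apply: (closed_nrmP Dg).1 (subalg_topclosed sDg) _ _ => e e0.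
  have [b hb ab] := h _ (divr_gt0 e0 (ltr0n R 2)); exists (lam b) => //.
  rewrite -(star_homB _ _ lamH) (le_trans (star_hom_bound cmul1 c1mul _ lamH))//.
  by rewrite mulrC -ler_pdivlMr.
Qed.

Section Absorption.

Let F (w : nat -> gpath G k.+1) n := S_seq P S (mkseq (fun i => plast (tau (w i))) n).

(** With tau(e alpha) = beta f_0 the product S_beta S_(f_0) F' equals U S_e S_alpha F', where F' is
    the product of the later second labels. So one step of [lambda_P_path] strips off U S_e and
    leaves the same claim for the shifted path. *)
Lemma lambda_absorb n (p : gpath G n) w : tpath tau w ->
  is_prefix p (fun i => phead (w i)) ->
  lam (Pp p) ** (S_path P S (pfront (tau (w 0%N))) ** F w n) =
  S_path P S (pfront (tau (w 0%N))) ** F w n.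
Proof.
elim: n p w => [|n IHn] p w hw pw.
  rewrite P_path0 (lambda_P UA Gsinks Gsources tauE) cmulA; congr (_ ** _).
  by have [-> _] := pw; rewrite -(psrc_front_tau tauE) (P_S_path CK).
have [ph /(_ (tpath_heads tauE hw)) pt] := prefix_tail pw.
have FE : F w n.+1 = S (plast (tau (w 0%N))) ** F (w \o succn) n by rewrite /F mkseq_cons.
have e0 : S_path P S (pfront (tau (w 0%N))) ** F w n.+1 =
   U ** S (phead p) ** (S_path P S (pfront (tau (w 1%N))) ** F (w \o succn) n).
  rewrite FE cmulA -(S_path_rcons CK cmul1 c1mul) cmulA -(U_perm_S CK tauE).
  by rewrite (S_path_cons CK) hw ph !cmulA.
rewrite e0 lambda_P_path -!cmulA; congr (U ** (S _ ** _)).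
rewrite cstarM (cmulA (cstar (S _) ** cstar U)) -(cmulA (cstar (S _))) -!cmulA.
rewrite (cmulA (cstar U)) UU c1mul (cmulA (cstar (S _))) (ck_initial CK).
have -> : P (rng (phead p)) ** (S_path P S (pfront (tau (w 1%N))) ** F (w \o succn) n) =
    S_path P S (pfront (tau (w 1%N))) ** F (w \o succn) n.
  by rewrite cmulA ph -psrc_tail hw (P_S_path CK).
exact: IHn (tpathS hw) pt.
Qed.

Lemma S_path_coded n (q : gpath G (k + n)) w y : coded tau w y -> is_prefix q y ->
  S_path P S q = S_path P S (pfront (tau (w 0%N))) ** F w n.
Proof.
move=> [_ [b1 b2] yw] [qs qe].
rewrite (S_path_seq CK cmul1) qe mkseqD (S_seq_cat _ c1mul) cmulA qs -b1 -b2.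
rewrite -(S_path_seq CK cmul1); congr (_ ** S_seq _ _ _).
by apply: eq_map => i; rewrite yw.
Qed.

Lemma lambda_prefix n (p : gpath G n) (q : gpath G (k + n)) w y : tpath tau w -> coded tau w y ->
  is_prefix p (fun i => phead (w i)) -> is_prefix q y -> lam (Pp p) ** Pp q = Pp q.
Proof.
move=> hw wy pw qy.
by rewrite /P_path (S_path_coded wy qy) cmulA lambda_absorb.
Qed.

End Absorption.

(** Both sides are characters with the same values on cylinders: [lambda_prefix] gives the value 1
    on prefixes, and uniqueness does the rest. *)
Lemma character_lambda w y d : tpath tau w -> coded tau w y -> Dg d ->
  pc y (lam d) = pc (fun i => phead (w i)) d.
Proof.
move=> hw wy dd; have xp := tpath_heads tauE hw.
have [yp _ _] := wy; have [hc hy] := point_charP UA Gsinks yp.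
have val1 n (p : gpath G n) : is_prefix p (fun i => phead (w i)) -> pc y (lam (Pp p)) = 1.
  move=> px; have [q qy] := exists_prefix (k + n) yp.
  have := congr1 (pc y) (lambda_prefix hw wy px qy).
  rewrite (Defs.charM hc); [|by apply: lambda_diag; exact: diag_P|exact: diag_P].
  by rewrite (hy _ _).1// mulr1.
apply: (prefix_character_unique UA Gsinks (z := fun i => phead (w i))
  (chi := pc y \o lam)) => //; last first.
  exact: (point_charP UA).
split; last first.
  move=> l p; split=> [|px] /=; first exact: val1.
  (* A path p that is not a prefix is orthogonal to the prefix p' of the same length, on which the
     value is 1. *)
  have [p' p'x] := exists_prefix l xp.
  have := P_path_orth UA p p'; case: eqP => [pp'|_ pp0]; first by case: px; rewrite pp'.
  have := congr1 (pc y \o lam) pp0; rewrite /= (star_homM lamH) (star_hom0 lamH).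
  rewrite (Defs.charM hc); [|by apply: lambda_diag; exact: diag_P..].
  rewrite (val1 _ _ p'x) mulr1 => ->.
  by have := charZ hc 0 (subalg0 sDg); rewrite scale0r mul0r.
split=> /=.
- move=> a b da db; rewrite (star_homD lamH) (Defs.charD hc)//; exact: lambda_diag.
- by move=> t a da; rewrite (star_homZ lamH) (charZ hc)//; exact: lambda_diag.
- move=> a b da db; rewrite (star_homM lamH) (Defs.charM hc)//; exact: lambda_diag.
- by move=> a da; rewrite (star_homS lamH) (charS hc)//; exact: lambda_diag.
- have [p px] := exists_prefix 0 xp; exists (Pp p); first exact: diag_P.
  by rewrite val1//; apply/eqP; rewrite oner_eq0.
Qed.

Variable m : nat.
Hypothesis sync : syncing tau m.

(** Every value of c is a value of its image, at the coded path. The estimate makes the range on the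
    diagonal closed. *)
Lemma lambda_bounded_below c : Dg c -> nrm c <= 2 * nrm (lam c).
Proof.
move=> dc; apply: (diag_norm_bound UA Gsinks) => // [|x xp].
  by rewrite mulr_ge0 ?nrm_ge0.
have [w [hw wx]] := exists_lift Gsinks tauE sync xp.
have [y wy] := exists_coded tauE hw.
have -> : x = (fun i => phead (w i)) by apply: funext => i; rewrite wx.
rewrite -(character_lambda hw wy dc); have [yp _ _] := wy.
apply: (char_bound UA Gsinks); last exact: lambda_diag.
by have [] := point_charP UA Gsinks yp.
Qed.

Lemma lambda_onto_P l (nu : gpath G l) : exists c, Dg c /\ lam c = Pp nu.
Proof.
(* The labels 0, ..., l + m determine the source and the first l edges of a lift, hence the first l
   edges of the coded path; the preimage of P_nu collects the mu for which these begin with nu. *)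
pose N := (l + m).+1.
pose M (mu : gpath G N) := `[< exists w y, [/\ tpath tau w, coded tau w y, is_prefix nu y &
  is_prefix mu (fun i => phead (w i))] >].
have dc : Dg (pspan P S (fun mu => (M mu)%:R)) by exact: pspan_diag.
exists (pspan P S (fun mu => (M mu)%:R)); split=> //.
apply: (diag_eq UA Gsinks) => [||y yp]; [exact: lambda_diag|exact: diag_P|].
have [w [hw wy]] := exists_decoded Gsinks tauE yp.
have xp := tpath_heads tauE hw.
rewrite (character_lambda hw wy dc).
have [hc hx] := point_charP UA Gsinks xp; have [_ hy] := point_charP UA Gsinks yp.
have [mu mux] := exists_prefix N xp.
rewrite (char_pspan _ hc) (bigD1 mu)//= (hx _ _).1// mulr1 big1 => [|r rmu]; last first.
  rewrite (hx _ _).2 ?mulr0// => rx; case/negP: rmu; apply/eqP; exact: prefix_inj rx mux.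
rewrite addr0; have [nuy|nuy] := pselect (is_prefix nu y).
  by rewrite (hy _ _).1// /M asboolT//; exists w, y.
rewrite (hy _ _).2// /M asboolF// => -[w' [y' [hw' wy' nuy' mux']]]; apply: nuy.
have heads i : (i <= l + m)%N -> phead (w' i) = phead (w i).
  move=> il; have [_ e1] := mux; have [_ e2] := mux'.
  have := congr1 (fun s => nth (phead (w 0%N)) s i) (etrans (esym e2) e1).
  by rewrite !nth_mkseq.
apply: (coded_upto wy' wy _ _ nuy').
  apply: (source_unique_upto sync hw' hw) => i im.
  by apply: heads; rewrite (leq_trans im)// leq_addl.
exact: (lift_unique_upto sync hw' hw heads).
Qed.

(** For limits, the lower bound makes the chosen preimages of the approximants a Cauchy sequence. *)
Lemma lambda_onto d : Dg d -> exists c, Dg c /\ lam c = d.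
Proof.
apply: (diag_ind (C := [set d | exists c, Dg c /\ lam c = d])) => [|l p]; last exact: lambda_onto_P.
split=> /=.
- by exists 0; split; [exact: (subalg0 sDg)|exact: star_hom0].
- move=> _ _ [a [da <-]] [b [db <-]]; exists (a + b).
  by split; [exact: (subalgD sDg)|rewrite (star_homD lamH)].
- move=> t _ [a [da <-]]; exists (t *: a).
  by split; [exact: (subalgZ sDg)|rewrite (star_homZ lamH)].
- move=> _ _ [a [da <-]] [b [db <-]]; exists (a ** b).
  by split; [exact: (subalgM sDg)|rewrite (star_homM lamH)].
- move=> _ [a [da <-]]; exists (cstar a).
  by split; [exact: (subalgS sDg)|rewrite (star_homS lamH)].
- apply/closed_nrmP => a h.
  have /choice[c hc] n : exists c, Dg c /\ nrm (a - lam c) <= n.+1%:R^-1.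
    have [|_ [c [dc <-]] ac] := h n.+1%:R^-1; first by rewrite invr_gt0.
    by exists c.
  have near e : 0 < e -> exists N : nat, forall n, (N <= n)%N -> nrm (a - lam (c n)) <= e.
    move=> /pos_small[N hN]; exists N => n Nn; rewrite (le_trans (hc n).2)//.
    by rewrite (le_trans _ (ltW hN))// lef_pV2 ?posrE// ler_nat.
  have [|b hb] := @nrm_complete R A c.
    move=> e e0; have [N hN] := near _ (divr_gt0 e0 (ltr0n R 4)).
    exists N => i j /hN hi /hN hj.
    have dij : Dg (c i - c j) by apply: (subalgB sDg); [exact: (hc i).1|exact: (hc j).1].
    rewrite (le_trans (lambda_bounded_below dij))// (star_homB _ _ lamH).
    have := nrm_trans a (lam (c i)) (lam (c j)); rewrite (nrmBC _ a).
    by move: hi hj; lra.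
  exists b; split; first by apply: closed_limit (subalg_topclosed sDg) _ hb => n; exact: (hc n).1.
  apply: (@nrm_small_eq _ _ _ _ 3) => e e0.
  have [N hN] := near _ e0; have [N' hN'] := hb _ e0.
  have h1 := hN _ (leq_maxl N N'); have h2 := hN' _ (leq_maxr N N').
  set j := maxn N N' in h1 h2.
  have := nrm_trans (lam (c j)) (lam b) a; rewrite -(star_homB _ _ lamH) (nrmBC (lam (c j)) a).
  have := star_hom_bound cmul1 c1mul (b - c j) lamH; rewrite (nrmBC b).
  by move: h1 h2; lra.
Qed.

Lemma phi_plusE w y : tpath tau w -> coded tau w y ->
  phi_plus P S tau (fun i => phead (w i)) = y.
Proof.
move=> hw wy; have [yp _ _] := wy.
have xp := tpath_heads tauE hw.
(* Surjectivity keeps the choice in [lambda_diag_inv] away from its default value 0. *)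
have invP d : Dg d -> Dg (lambda_diag_inv P S tau d) /\ lam (lambda_diag_inv P S tau d) = d.
  move=> dd; rewrite /lambda_diag_inv; case: xgetP => [c _ []//|h].
  by have [c hc] := lambda_onto dd; case: (h c).
have yval d : Dg d -> pc y d = pc (fun i => phead (w i)) (lambda_diag_inv P S tau d).
  by move=> /invP[dc ld]; rewrite -(character_lambda hw wy dc) ld.
apply: xget_unique; first by split.
move=> y' [y'p hy']; apply: funext => n.
have [_ hz] := point_charP UA Gsinks y'p; have [_ hz'] := point_charP UA Gsinks yp.
have [p py'] := exists_prefix n.+1 y'p.
have dp : Dg (Pp p) by exact: diag_P.
have : pc y (Pp p) = 1 by rewrite (yval _ dp) -(hy' _ dp) (hz _ _).1.
have [[_ e1]|npy] := pselect (is_prefix p y).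
  have [_ e2] := py' => _.
  have := congr1 (fun s => nth (y n) s n) (etrans (esym e2) e1).
  by rewrite !nth_mkseq.
by rewrite (hz' _ _).2// => /esym/eqP; rewrite oner_eq0.
Qed.

Lemma phi_two_sidedE x : bi_infinite_paths G x ->
  phi_two_sided P S tau x = (fun i => textile_map tau x (i - k%:Z)).
Proof.
move=> xp; have [z [hz zx]] := exists_bilift Gsinks tauE sync xp.
have -> : x = (fun i => phead (z i)) by apply: funext => i; rewrite zx.
rewrite (textile_mapE tauE sync hz); apply: funext => i.
(* The coded path begins with the k edges of a vertex, so its coordinate j = i + n is the second
   label number j - k, that is the one at time i - k; n >= |i| + k guarantees j >= k. *)
have plus (n j : nat) : (`|i| + k <= n)%N -> i + n%:Z = j%:Z ->
    phi_plus P S tau (fun l : nat => phead (z (l%:Z - n%:Z))) j = plast (tau (z (i - k%:Z))).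
  move=> nk ij.
  have hw : tpath tau (fun l : nat => z (l%:Z - n%:Z)).
    move=> l; have -> : (l.+1%:Z - n%:Z) = (l%:Z - n%:Z) + 1 by lia.
    exact: hz.
  have [y wy] := exists_coded tauE hw; rewrite (phi_plusE hw wy).
  have [_ _ yw] := wy; have kj : (k <= j)%N by lia.
  by rewrite -(subnKC kj) yw; congr (plast (tau (z _))); lia.
apply: xget_unique; first by exists (`|i| + k)%N.
move=> e [N hN].
pose n := (N + (`|i| + k))%N; pose j := absz (i + n%:Z)%R.
have ij : i + n%:Z = j%:Z by rewrite /n /j; lia.
by rewrite -(hN n j _ ij) ?leq_addr// plus// leq_addl.
Qed.

End DiagonalEndomorphism.

(** The [k] here is k - 1 in the English statement: tau permutes paths of length [k.+1] and pi paths
    of length [k]. The conditions are proved in a cycle. *)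
Theorem proposition5p4 (R : realType) (G : graph)
    (A : cstarAlgebra R) (P : vertex G -> A) (S : edge G -> A)
    (k : nat) (tau tau' : {perm gpath G k.+1}) :
  no_sinks G -> no_sources G -> every_cycle_has_exit G ->
  graph_cstar P S ->
  endpoint_fixing tau -> endpoint_fixing tau' ->
  synchronizing1 tau -> synchronizing1 tau' ->
  [<-> label_shift tau = label_shift tau';
       exists pi : {perm gpath G k}, endpoint_fixing pi /\
         forall m, tau' m = gmap pi tau m;
       exists pi : {perm gpath G k}, endpoint_fixing pi /\
         forall x : A, Ad (U_perm P S pi) (lambda P S tau x) = lambda P S tau' x;
       forall x, bi_infinite_paths G x -> textile_map tau x = textile_map tau' x;
       forall x, bi_infinite_paths G x ->
         phi_two_sided P S tau x = phi_two_sided P S tau' x].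
Proof.
move=> Gsinks Gsources _ UA tauE tauE' /(synchronizing1P)[m sync] /(synchronizing1P)[m' sync'].
tfae.
- exact: (label_shift_gmap Gsinks Gsources tauE tauE' sync sync').
- move=> [pi [piE h]]; exists pi; split=> //.
  exact: (gmap_Ad UA Gsinks Gsources tauE tauE' piE).
(* Condition (3) is turned back into (2), which yields equal label shifts and thereby equal textile
   maps. *)
- move=> [pi [piE h]] x _; apply: label_shift_textile.
  apply: (gmap_label_shift piE) => //.
  exact: (Ad_gmap UA Gsinks tauE tauE' piE h).
- move=> h x xp.
  rewrite (phi_two_sidedE UA Gsinks Gsources tauE sync xp).
  by rewrite (phi_two_sidedE UA Gsinks Gsources tauE' sync' xp) h.
- move=> h; apply: (textile_label_shift Gsinks tauE tauE' sync sync') => x xp.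
  have := h x xp; rewrite (phi_two_sidedE UA Gsinks Gsources tauE sync xp).
  rewrite (phi_two_sidedE UA Gsinks Gsources tauE' sync' xp) => e.
  (* Evaluation at i + k undoes the shift between the two kinds of maps. *)
  by apply: funext => i; have := congr1 (fun y => y (i + k%:Z)) e; rewrite addrK.
Qed.
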